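(* Let $n$ and $k$ be positive integers. Let $G$ be an $n$-vertex multigraph that has a non-homotopic $k$-crossing drawing. Then $|E(G)| \leq 6^{13 n (k+1)}$.
   Context: A multigraph may have parallel edges and loops. A drawing $\phi$ of a multigraph $G$ maps each vertex $v$ to a point $\phi_v\in\mathbb{R}^2$, the points $\phi_v$ being distinct, and maps each edge $e=vw$ to a continuous curve $\phi_e\colon[0,1]\to\mathbb{R}^2$ with endpoints $\phi_v,\phi_w$, such that $\phi_e(t)$ is not the image of any vertex for $t\in(0,1)$, and such that there are finitely many crossings. A crossing is an unordered pair of distinct pairs $(e,s),(f,t)\in E(G)\times(0,1)$ with $\phi_e(s)=\phi_f(t)$; when $e=f$ it is a self-intersection of $e$ (so a point through which $j$ edge-passages go contributes $\binom{j}{2}$ crossings). The drawing is $k$-crossing if every pair of distinct edges cross at most $k$ times and every edge has at most $k$ self-intersections. Two parallel edges $e,f$ with end-vertices $v,w$ (possibly $v=w$, i.e. loops) are homotopic if there is a homotopy in $\mathbb{R}^2\setminus\{\phi_x : x\in V(G)\setminus\{v,w\}\}$ taking $\phi_e$ to $\phi_f$ with the endpoints $\phi_v,\phi_w$ fixed throughout. The drawing is non-homotopic if no two parallel edges (including loops at the same vertex) are homotopic. *)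

(* Defs.v *)
From HB Require Import structures.
From mathcomp Require Import all_boot all_order all_algebra.
From mathcomp Require Import all_classical all_reals all_analysis.

Set Implicit Arguments.
Unset Strict Implicit.
Unset Printing Implicit Defensive.

Import Order.TTheory GRing.Theory Num.Theory.
Import numFieldNormedType.Exports.

Local Open Scope classical_set_scope.
Local Open Scope card_scope.
Local Open Scope ring_scope.

(* Undirected multigraphs on finitely many vertices: an edge is a loop iff its
   set of end-vertices is a singleton, and two edges are parallel iff they have
   the same set of end-vertices.  The edges are not assumed to be finitely
   many. *)
Record multigraph := Multigraph {
  vertex : finType;
  edge : Type;
  ends : edge -> {set vertex};
  ends_card : forall e, (0 < #|ends e| <= 2)%N
}.

Section Curves.
Variable R : realType.

(* Curves and homotopies are total functions; only their values on [0, 1],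
   resp. [0, 1] x [0, 1], matter. *)
Definition reverse_curve (c : R -> R * R) : R -> R * R := fun t => c (1 - t).

(* For a curve c with endpoint a, this is c traversed starting from a; it is c
   itself when c is closed. *)
Definition curve_from (a : R * R) (c : R -> R * R) : R -> R * R :=
  if c 0 == a :> R * R then c else reverse_curve c.

(* The first argument of the homotopy is its time parameter. *)
Definition path_homotopic (A : set (R * R)) (c d : R -> R * R) : Prop :=
  exists H : R * R -> R * R,
    [/\ {within `[0, 1] `*` `[0, 1], continuous H},
        forall t : R, t \in `[0, 1] -> H (0, t) = c t /\ H (1, t) = d t,
        forall u : R, u \in `[0, 1] -> H (u, 0) = c 0 /\ H (u, 1) = c 1 &
        forall u t : R, u \in `[0, 1] -> t \in `[0, 1] -> A (H (u, t))].

End Curves.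

Section Drawings.
Variables (R : realType) (G : multigraph).

(* Crossings between e and f, as two-element subsets of E(G) x (0, 1);
   for e = f these are the self-intersections of e. *)
Definition crossings_between (curve : edge G -> R -> R * R) (e f : edge G) :
    set (set (edge G * R)) :=
  [set c | exists s t : R,
     [/\ s \in `]0, 1[, t \in `]0, 1[, (e, s) <> (f, t),
         curve e s = curve f t & c = [set (e, s); (f, t)]]].

Definition crossings (curve : edge G -> R -> R * R) :
    set (set (edge G * R)) :=
  [set c | exists e f, crossings_between curve e f c].

Record drawing := Drawing {
  vpoint : vertex G -> R * R;
  curve : edge G -> R -> R * R;
  vpoint_inj : injective vpoint;
  curve_continuous : forall e, {within `[0, 1], continuous (curve e)};
  curve_ends : forall e, exists v w,
    [/\ ends e = [set v; w]%SET, curve e 0 = vpoint v & curve e 1 = vpoint w];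
  curve_avoids : forall e (t : R) v, t \in `]0, 1[ -> curve e t <> vpoint v;
  crossings_finite : finite_set (crossings curve)
}.

Definition k_crossing (k : nat) (phi : drawing) : Prop :=
  (forall e f, e <> f -> crossings_between (curve phi) e f #<= `I_k) /\
  (forall e, crossings_between (curve phi) e e #<= `I_k).

(* Edges are undirected, so for non-loops the curve of f is first directed so
   as to start at the same vertex as the curve of e; for loops, curve_from
   leaves the curve of f unchanged. *)
Definition homotopic (phi : drawing) (e f : edge G) : Prop :=
  ends e = ends f /\
  path_homotopic (~` (vpoint phi @` [set x | x \notin ends e]))
    (curve phi e) (curve_from (curve phi e 0) (curve phi f)).

Definition non_homotopic (phi : drawing) : Prop :=
  forall e f, e <> f -> ~ homotopic phi e f.

End Drawings.

(* Main.v *)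
Require Import Defs.
From HB Require Import structures.
From mathcomp Require Import all_boot all_order all_algebra.
From mathcomp Require Import all_classical all_reals all_analysis.
From mathcomp Require Import ring lra zify.

(* Perturb the curves so that they become polygonal, without new crossings and
   within their homotopy classes.  A piecewise linear homeomorphism of the plane,
   obtained by straightening a path that runs alongside edges, then puts the
   vertices on the x-axis in such a way that all edges but at most 2n of them
   meet the axis at most (8k + 4)n times.  Such an edge alternates between arcs
   above and below the axis, and it is determined up to homotopy by the order in
   which these arcs end among the vertices on the axis.  The arcs on one side are
   a system of chords; crossing chords yield self-intersections of the edge, so
   that at most k + 1 pairs of chords cross on each side.  The pattern is therefore
   encoded by a parenthesis word with few corrections, of length at most
   L = 8kn + 5n + 2k + 6 over 9 letters.  Hence there are at most 9^L + 2n edges,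
   which is at most 6^(13n(k + 1)) for n >= 2; for n = 1 any two loops are
   homotopic by the linear homotopy. *)

Set Implicit Arguments.
Unset Strict Implicit.
Unset Printing Implicit Defensive.

Import Order.TTheory GRing.Theory Num.Theory.
Import numFieldNormedType.Exports.

Local Open Scope classical_set_scope.
Local Open Scope card_scope.
Local Open Scope ring_scope.

(** * Continuity in the plane *)

(** A continuous edge may meet a line infinitely often; the bound has to come from the crossings.
    Each vertex is joined to the axis by a path along at most two edges, and any other edge meets
    this path only where it crosses one of the two, hence at most 2k times. The axis is then
    detoured along two sides of a thin triangle about the straightened path. Polygonality bounds the
    meetings with each side by 2(2k) + 2, whence 8k + 4 per vertex; the two edges followed may run
    along the axis and are given up, whence 2n. Homotopies are carried back by the inverse
    homeomorphism, so only the pattern along the final axis counts. That interleaved chords on one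
    side meet is proved by a parity count on a grid, in place of the Jordan curve theorem. A word
    spends one letter on each of at most (8k + 4)n + 2 points of the axis, one on each vertex (the
    gaps are coded by their increments), one on each of at most 2(k + 1) crossing pairs of chords,
    and two on the ends of the curve; the sum is L. Finally 9^4 < 6^5 changes the base. *)

Section Continuity.
Variables (R : realType) (T : topologicalType).
Implicit Types f g : T -> R.

Lemma cont_pair f g : continuous f -> continuous g ->
  continuous (fun x => (f x, g x) : R * R).
Proof.
move=> cf cg x; apply: (@cvg_pair _ _ _ _ (nbhs (f x)) (nbhs (g x))).
- exact: cf.
- exact: cg.
Qed.

Lemma cont_fst (f : T -> R * R) : continuous f -> continuous (fun x => (f x).1).
Proof. by move=> cf x; apply: (cvg_comp _ _ (cf x)); exact: cvg_fst. Qed.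

Lemma cont_snd (f : T -> R * R) : continuous f -> continuous (fun x => (f x).2).
Proof. by move=> cf x; apply: (cvg_comp _ _ (cf x)); exact: cvg_snd. Qed.

Lemma cont_cst (U : topologicalType) (a : U) : continuous (fun _ : T => a).
Proof. by move=> x; exact: cvg_cst. Qed.

Lemma cont_add (V : normedModType R) (f g : T -> V) : continuous f -> continuous g ->
  continuous (fun x => f x + g x).
Proof. by move=> cf cg x; apply: cvgD; [exact: cf|exact: cg]. Qed.

Lemma cont_sub (V : normedModType R) (f g : T -> V) : continuous f -> continuous g ->
  continuous (fun x => f x - g x).
Proof. by move=> cf cg x; apply: cvgB; [exact: cf|exact: cg]. Qed.

Lemma cont_mul f g : continuous f -> continuous g ->
  continuous (fun x => f x * g x).
Proof. by move=> cf cg x; apply: cvgM; [exact: cf|exact: cg]. Qed.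

Lemma cont_scale (V : normedModType R) f (g : T -> V) : continuous f -> continuous g ->
  continuous (fun x => f x *: g x).
Proof. by move=> cf cg x; apply: cvgZ; [exact: cf|exact: cg]. Qed.

Lemma cont_norm (V : normedModType R) (f : T -> V) : continuous f ->
  continuous (fun x => `|f x|).
Proof. by move=> cf x; apply: cvg_norm; exact: cf. Qed.

Lemma cont_max f g : continuous f -> continuous g ->
  continuous (fun x => Num.max (f x) (g x)).
Proof. by move=> cf cg x; apply: (@continuous_max R T f g x); [exact: cf|exact: cg]. Qed.

Lemma cont_min f g : continuous f -> continuous g ->
  continuous (fun x => Num.min (f x) (g x)).
Proof. by move=> cf cg x; apply: (@continuous_min R T f g x); [exact: cf|exact: cg]. Qed.

Lemma cont_comp (U W : topologicalType) (h : U -> W) (f : T -> U) :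
  continuous f -> continuous h -> continuous (fun x => h (f x)).
Proof. by move=> cf ch x; apply: continuous_comp; [exact: cf|exact: ch]. Qed.

Lemma cont_id : continuous (fun x : T => x).
Proof. by move=> x; exact: cvg_id. Qed.
End Continuity.

Section Plane.
Variable R : realType.
Notation pt := (R * R)%type.

Lemma pt_ext (a b : pt) : a.1 = b.1 -> a.2 = b.2 -> a = b.
Proof. by case: a b => [? ?] [? ?] /= -> ->. Qed.

Lemma scaleRE (a b : R) : a *: b = a * b.
Proof. by []. Qed.

Lemma pt_norm (a : pt) : `|a| = Num.max `|a.1| `|a.2|.
Proof. by []. Qed.
End Plane.

Ltac pt_ring := apply: pt_ext; rewrite /= ?scaleRE; ring.

Section PlanarCurves.
Variable R : realType.
Notation pt := (R * R)%type.

(** Composition with [clamp] makes a total continuous function out of one that matters only on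
    [0, 1], so that no subspace topology has to be carried along. *)
Definition clamp (t : R) : R := Num.max 0 (Num.min 1 t).

Lemma clamp_cont : continuous clamp.
Proof.
rewrite /clamp; apply: cont_max; first exact: cont_cst.
by apply: cont_min; [exact: cont_cst|exact: cont_id].
Qed.

Lemma clamp_itv t : 0 <= clamp t <= 1.
Proof. by rewrite /clamp maxEle minEle; case: (lerP 1 t) => h1; [case: (lerP 0 1)|case: (lerP 0 t)] => h2; lra. Qed.

Lemma clamp_id t : 0 <= t <= 1 -> clamp t = t.
Proof. by rewrite /clamp maxEle minEle => h; case: (lerP 1 t) => h1; [case: (lerP 0 1)|case: (lerP 0 t)] => h2; lra. Qed.

Lemma clamp_le0 t : t <= 0 -> clamp t = 0.
Proof. by rewrite /clamp maxEle minEle => h; case: (lerP 1 t) => h1; [case: (lerP 0 1)|case: (lerP 0 t)] => h2; lra. Qed.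

Lemma clamp_ge1 t : 1 <= t -> clamp t = 1.
Proof. by rewrite /clamp maxEle minEle => h; case: (lerP 1 t) => h1; [case: (lerP 0 1)|case: (lerP 0 t)] => h2; lra. Qed.

Lemma compact_sep (A B : set pt) : compact A -> compact B ->
  (forall x, A x -> ~ B x) ->
  exists2 d, 0 < d & forall x y, A x -> B y -> d < `|x - y|.
Proof.
move=> cA cB AB.
have [->|/set0P A0] := eqVneq A set0; first by exists 1.
have [->|/set0P B0] := eqVneq B set0; first by exists 1.
have cAB := compact_setX cA cB.
have AB0 : A `*` B !=set0 by case: A0 B0 => a Aa [b Bb]; exists (a, b).
have cf : continuous (fun z : pt * pt => `|z.1 - z.2|).
  apply: cont_norm; apply: cont_sub => z; [exact: cvg_fst|exact: cvg_snd].
have [[a b]] := compact_EVT_min AB0 cAB (continuous_subspaceT cf).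
rewrite inE /= => -[Aa Bb] H.
have ab0 : 0 < `|a - b|.
  by rewrite normr_gt0 subr_eq0; apply/eqP => E; apply: (AB a Aa); rewrite E.
exists (`|a - b| / 2); first by lra.
move=> x y Ax By; have := H (x, y); rewrite inE /= => /(_ (conj Ax By)); lra.
Qed.

Definition seg (a b : pt) : set pt :=
  [set z | exists2 l : R, 0 <= l <= 1 & z = a + l *: (b - a)].

Lemma seg_l a b : seg a b a.
Proof. by exists 0; [lra|pt_ring]. Qed.

Lemma seg_r a b : seg a b b.
Proof. by exists 1; [lra|pt_ring]. Qed.

Lemma seg_sub a b x y : seg a b x -> seg a b y -> seg x y `<=` seg a b.
Proof.
move=> [l hl ->] [m hm ->] z [u hu ->]; exists (l + u * (m - l)); first by nra.
by pt_ring.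
Qed.

Lemma seg_compact a b : compact (seg a b).
Proof.
have -> : seg a b = (fun l : R => a + l *: (b - a)) @` `[0, 1].
  apply/seteqP; split=> z.
    by move=> [l hl ->]; exists l => //=; rewrite in_itv.
  by move=> [l /=]; rewrite in_itv /= => hl <-; exists l.
apply: continuous_compact; last exact: segment_compact.
apply: continuous_subspaceT; apply: cont_add; first exact: cont_cst.
by apply: cont_scale; [exact: cont_id|exact: cont_cst].
Qed.

Fixpoint polyline (l : seq pt) : set pt :=
  match l with
  | [::] => set0
  | [:: a] => [set a]
  | a :: ((b :: _) as l') => seg a b `|` polyline l'
  end.

Lemma polyline_compact l : compact (polyline l).
Proof.
elim: l => [|a [|b l] IH]; first exact: compact0.
  exact: compact_set1.
by apply: compactU => //; exact: seg_compact.
Qed.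

Lemma polyline_closed l : closed (polyline l).
Proof. by apply: compact_closed; [exact: norm_hausdorff|exact: polyline_compact]. Qed.

Lemma polyline_head a l : polyline (a :: l) a.
Proof. by case: l => [|b l] //=; left; exact: seg_l. Qed.

Lemma polyline_mem x l : x \in l -> polyline l x.
Proof.
elim: l => // a l IH; rewrite inE => /orP[/eqP ->|xl]; first exact: polyline_head.
by case: l IH xl => // b l IH xl; right; exact: IH.
Qed.

Lemma first_hit (g : R -> pt) (K : set pt) : continuous g -> closed K -> K (g 1) ->
  exists t : R, [/\ 0 <= t <= 1, K (g t) & forall s : R, 0 <= s <= 1 -> K (g s) -> t <= s].
Proof.
move=> cg cK K1.
pose S := `[0, 1] `&` g @^-1` K.
have cS : compact S.
  apply: (subclosed_compact _ (@segment_compact R 0 1)); last by move=> x [].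
  apply: closedI; first exact: itv_closed.
  by apply: (closed_comp _ cK) => x _; exact: cg.
have S0 : S !=set0 by exists 1; split => //=; rewrite in_itv /= ler01 lexx.
have [t] := compact_EVT_min S0 cS (continuous_subspaceT (@cont_id R)).
rewrite inE => -[/=]; rewrite in_itv /= => t01 Kt H.
exists t; split=> // s s01 Ks; apply: H; rewrite inE; split=> //=.
Qed.

End PlanarCurves.

(** * Loop erasure for polygonal lines with time labels *)

Notation tpoly l := (polyline (map snd l)).

Section Erasure.
Variable R : realType.
Notation pt := (R * R)%type.
Notation tp := (R * pt)%type.
Implicit Types (Q : R -> set pt) (a b c : tp) (l : seq tp).

Fixpoint simple l : Prop :=
  match l with
  | a :: ((b :: _) as l') =>
    [/\ a.1 < b.1, a.2 <> b.2,
        forall z, seg a.2 b.2 z -> tpoly l' z -> z = b.2 & simple l']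
  | _ => True
  end.

(** [Q] is indexed by the time of the left vertex of a segment. Loop erasure keeps these labels, so
    [Q] remembers to which moment of the original curve a surviving segment belongs. *)
Fixpoint segs_in Q l : Prop :=
  match l with
  | a :: ((b :: _) as l') => seg a.2 b.2 `<=` Q a.1 /\ segs_in Q l'
  | _ => True
  end.

(** When the line is cut inside a segment, the new head inherits the time of that segment's left
    vertex; the shortened segment then satisfies [Q] at the same time as before. *)
Lemma simple_suffix Q b l z : simple (b :: l) -> segs_in Q (b :: l) ->
  tpoly (b :: l) z -> exists b' l',
  [/\ simple (b' :: l') /\ segs_in Q (b' :: l'), b'.2 = z, b.1 <= b'.1,
      last b' l' = (last b l : tp) \/ l' = [::] /\ z = (last b l).2 /\ b' = last b l
    & tpoly (b' :: l') `<=` tpoly (b :: l)].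
Proof.
elim: l b => [|c l IH] b sb Qb; first by move=> ->; exists b, [::]; split=> //; left.
have [bc nbc sbc sc] := sb; have [Qbc Qc] := Qb.
have [zc _|nzc [zbc|//]] := pselect (tpoly (c :: l) z).
  have [b' [l' [s' e' le' la' sub']]] := IH c sc Qc zc.
  exists b', l'; split=> //; first exact: (le_trans (ltW bc)).
  by move=> x /sub' Px; right.
exists (b.1, z), (c :: l).
have sub : seg z c.2 `<=` seg b.2 c.2 by apply: seg_sub => //; exact: seg_r.
split=> //=; last 1 first.
- by move=> x [/sub h|h]; [left|right].
- split; last by split=> // x /sub /Qbc.
  split=> //; last by move=> x /sub; exact: sbc.
  by move=> E; apply: nzc; rewrite E; exact: polyline_head.
- by left.
Qed.

(* Loop erasure from the front: attach each new segment to the simple tail at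
   the first point where it meets that tail. *)
Lemma loop_erasure Q a l : path (fun x y : tp => x.1 < y.1) a l ->
  segs_in Q (a :: l) -> exists b l',
  [/\ simple (b :: l') /\ segs_in Q (b :: l'), b.2 = a.2,
      a.1 <= b.1 /\ (b = a \/ tpoly l a.2), last b l' = (last a l : tp)
    & tpoly (b :: l') `<=` tpoly (a :: l)].
Proof.
elim: l a => [|c l IH] a /=; first by exists a, [::]; split=> //; split=> //; left.
move=> /andP[ac pc] [Qac Qc].
have [b [l' [[sb Qb] bc [cb _] lab sub]]] := IH c pc Qc.
pose g (t : R) := a.2 + t *: (c.2 - a.2).
have cg : continuous g.
  apply: cont_add; first exact: cont_cst.
  by apply: cont_scale; [exact: cont_id|exact: cont_cst].
have g1 : tpoly (b :: l') (g 1).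
  have -> : g 1 = b.2 by rewrite bc /g; pt_ring.
  exact: polyline_head.
have [t [t01 gt tmin]] := first_hit cg (@polyline_closed R _) g1.
have [b' [l2 [[sb' Qb'] eb' bb' lab' sub']]] := simple_suffix sb Qb gt.
have {}lab' : last b' l2 = last c l.
  by rewrite -lab; case: lab' => // -[-> [_ ->]].
have lt_a : a.1 < b'.1 by apply: (lt_le_trans ac); apply: le_trans bb'.
(* For [t = 0] the point of [a] already lies on the tail: [a] is dropped, and the new head may carry
   a later time. The alternative [tpoly l a.2] in the conclusion records this case. *)
have [t0|t0] := eqVneq t 0.
  have ga : g t = a.2 by rewrite t0 /g; pt_ring.
  exists b', l2; split=> //; [by rewrite eb'| |by move=> z /sub' /sub h; right].
  by split; [exact: ltW|right; apply: sub; rewrite -ga].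
have seg_g : seg a.2 (g t) `<=` seg a.2 c.2.
  by apply: seg_sub; [exact: seg_l|exists t].
exists a, (b' :: l2); split=> //.
- split; last by split=> //= x; rewrite eb' => /seg_g /Qac.
  split=> //.
    rewrite eb' => E; case/eqP: t0; apply/eqP; rewrite eq_le; case/andP: t01 => -> _.
    rewrite andbT; apply: tmin; first by lra.
    have -> : g 0 = g t by rewrite -E /g; pt_ring.
    exact: gt.
  rewrite eb' => z [u u01 ->] /sub' zb.
  have ug : a.2 + u *: (g t - a.2) = g (u * t) by rewrite /g; pt_ring.
  have : t <= u * t by apply: tmin; [nra|rewrite -ug].
  have [->|u1 tu] := eqVneq u 1; first by rewrite /g => _; pt_ring.
  have {}t0 : 0 < t by rewrite lt0r t0; case/andP: t01.
  case/andP: u01 => _; rewrite le_eqVlt (negbTE u1) /= => u1'; exfalso; nra.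
- by split=> //; left.
- by move=> z /= [|/sub' /sub h]; [rewrite eb' => /seg_g h; left|right].
Qed.

End Erasure.

(** * Piecewise linear curves *)

Section PiecewiseLinear.
Variable R : realType.
Notation pt := (R * R)%type.
Notation tp := (R * pt)%type.
Implicit Types (f g : R -> R) (c : R -> pt).

(** Piecewise linearity is expressed locally, by an affine germ on each side of every point (the
    left one after reflection). Sums, maxima and case distinctions then need no lists of
    breakpoints; [plc_breaks] recovers such lists. *)
Definition rgerm f (t : R) : Prop :=
  exists d p v : R, 0 < d /\ forall s, t <= s <= t + d -> f s = p + s * v.

Definition plf f : Prop :=
  (forall t, rgerm f t) /\ (forall t, rgerm (fun s => f (- s)) t).

Definition plc c : Prop := plf (fun t => (c t).1) /\ plf (fun t => (c t).2).

Lemma rgerm_ext f g t d : 0 < d -> (forall s, t <= s <= t + d -> f s = g s) ->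
  rgerm g t -> rgerm f t.
Proof.
move=> d0 fg [d' [p [v [d'0 H]]]].
exists (Num.min d d'), p, v; split; first by rewrite lt_min d0.
by move=> s; rewrite minElt; case: ltP => h ss; rewrite fg ?H//; lra.
Qed.

Lemma rgerm_lin f g (x y : R) t : rgerm f t -> rgerm g t ->
  rgerm (fun s => x * f s + y * g s) t.
Proof.
move=> [d [p [v [d0 H]]]] [d' [p' [v' [d'0 H']]]].
exists (Num.min d d'), (x * p + y * p'), (x * v + y * v'); split.
  by rewrite lt_min d0.
move=> s; rewrite minElt; case: ltP => h ss; rewrite H ?H'; try lra; ring.
Qed.

Lemma rgerm_affine (p v : R) t : rgerm (fun s => p + s * v) t.
Proof. by exists 1, p, v. Qed.

(** Of two affine germs, the larger one at [t] stays the larger for a while; in case of a tie the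
    slope decides. *)
Lemma rgerm_max f g t : rgerm f t -> rgerm g t ->
  rgerm (fun s => Num.max (f s) (g s)) t.
Proof.
wlog le_gf : f g / g t <= f t.
  move=> W hf hg; have [h|h] := leP (g t) (f t); first exact: W.
  have := W g f (ltW h) hg hf; apply: (rgerm_ext ltr01) => s _; exact: maxC.
move=> [d [p [v [d0 H]]]] [d' [p' [v' [d'0 H']]]].
pose D s := p + s * v - (p' + s * v').
have D0 : 0 <= D t by rewrite /D -H -?H'; lra.
have [e [e0 [ed ed']]] : exists e, 0 < e /\ e <= d /\ e <= d'.
  by exists (Num.min d d'); rewrite lt_min d0 d'0 !ge_min !lexx orbT.
have key p0 v0 e1 : 0 < e1 -> e1 <= e -> (forall s, t <= s <= t + e1 ->
    Num.max (p + s * v) (p' + s * v') = p0 + s * v0) ->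
    rgerm (fun s => Num.max (f s) (g s)) t.
  move=> e10 le1 K; exists e1, p0, v0; split=> // s ss.
  by rewrite H ?H' ?K//; lra.
have [vv|vv] := leP v' v.
  apply: (key p v e) => // s ss; apply/max_idPl; rewrite /D in D0; nra.
have [Dt|Dt] := eqVneq (D t) 0.
  apply: (key p' v' e) => // s ss; apply/max_idPr; rewrite /D in Dt; nra.
have {}D0 : 0 < D t by rewrite lt0r Dt.
(* [D t / (v' - v)] is the delay after which the steeper germ of [g] catches up. *)
pose e1 := Num.min e (D t / (v' - v)).
have e1D : e1 * (v' - v) <= D t.
  rewrite -ler_pdivlMr; last lra.
  by rewrite ge_min lexx orbT.
apply: (key p v e1).
- by rewrite lt_min e0 /= divr_gt0//; lra.
- by rewrite ge_min lexx.
- move=> s ss; apply/max_idPl; rewrite /D in e1D; nra.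
Qed.

Lemma plf_lin f g (x y : R) : plf f -> plf g -> plf (fun s => x * f s + y * g s).
Proof.
by move=> [f1 f2] [g1 g2]; split=> t; [exact: rgerm_lin|exact: (rgerm_lin x y (f2 t))].
Qed.

Lemma plf_max f g : plf f -> plf g -> plf (fun s => Num.max (f s) (g s)).
Proof.
by move=> [f1 f2] [g1 g2]; split=> t; [exact: rgerm_max|exact: (rgerm_max (f2 t))].
Qed.

Lemma plf_affine (p v : R) : plf (fun s => p + s * v).
Proof.
split=> t; first exact: rgerm_affine.
by apply: (rgerm_ext ltr01 _ (rgerm_affine p (- v) t)) => s _; ring.
Qed.

Lemma plf_ext f g : f =1 g -> plf g -> plf f.
Proof.
move=> fg [g1 g2]; split=> t; first by apply: (rgerm_ext ltr01 _ (g1 t)) => s _.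
by apply: (rgerm_ext ltr01 _ (g2 t)) => s _; exact: fg.
Qed.

Lemma plf_cst (p : R) : plf (fun=> p).
Proof. by apply: (plf_ext _ (plf_affine p 0)) => s; ring. Qed.

Lemma plf_id : plf (fun s => s).
Proof. by apply: (plf_ext _ (plf_affine 0 1)) => s; ring. Qed.

Lemma plf_add f g : plf f -> plf g -> plf (fun s => f s + g s).
Proof. by move=> pf pg; apply: (plf_ext _ (plf_lin 1 1 pf pg)) => s; ring. Qed.

Lemma plf_scale (x : R) f : plf f -> plf (fun s => x * f s).
Proof. by move=> pf; apply: (plf_ext _ (plf_lin x 0 pf pf)) => s; ring. Qed.

Lemma plf_sub f g : plf f -> plf g -> plf (fun s => f s - g s).
Proof. by move=> pf pg; apply: (plf_ext _ (plf_lin 1 (-1) pf pg)) => s; ring. Qed.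

Lemma plf_min f g : plf f -> plf g -> plf (fun s => Num.min (f s) (g s)).
Proof.
move=> pf pg; apply: (plf_ext _ (plf_scale (-1) (plf_max (plf_scale (-1) pf) (plf_scale (-1) pg)))) => s.
by rewrite maxEle minEle; case: (lerP (f s) (g s)) => h; case: (lerP (-1 * f s) (-1 * g s)) => h'; lra.
Qed.

Lemma plf_abs f : plf f -> plf (fun s => `|f s|).
Proof.
move=> pf; apply: (plf_ext _ (plf_max pf (plf_scale (-1) pf))) => s.
by rewrite maxEle; case: (ger0P (f s)) => h; case: (lerP (f s) (-1 * f s)) => h'; lra.
Qed.

Lemma plf_if f g m : plf f -> plf g -> f m = g m ->
  plf (fun t => if t <= m then f t else g t).
Proof.
move=> [f1 f2] [g1 g2] fg; split=> t.
  have [tm|mt] := ltP t m.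
    apply: (@rgerm_ext _ f t (m - t)) => //; first by lra.
    by move=> s ss; rewrite ifT//; lra.
  apply: (@rgerm_ext _ g t 1) => // s ss; case: ifP => // sm.
  by have -> : s = m by lra.
have [tm|mt] := leP (- t) m.
  apply: (@rgerm_ext _ (fun s => f (- s)) t 1) => // s ss.
  by rewrite ifT//; lra.
apply: (@rgerm_ext _ (fun s => g (- s)) t (- t - m)) => //; first lra.
move=> s ss; case: ifP => // sm.
by have -> : - s = m by lra.
Qed.

(** The two germs at [t] give a Lipschitz bound near [t]. *)
Lemma plf_continuous f : plf f -> continuous f.
Proof.
move=> [f1 f2] t.
have [d [p [v [d0 H]]]] := f1 t; have [d' [p' [v' [d'0 H']]]] := f2 (- t).
have B s : t - d' <= s <= t + d -> `|f t - f s| <= (`|v| + `|v'|) * `|t - s|.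
  move=> ss; have [ts|st] := leP t s.
    rewrite !H; [|lra|lra].
    have -> : p + t * v - (p + s * v) = v * (t - s) by ring.
    by rewrite normrM ler_wpM2r// lerDl.
  have H2 u : t - d' <= u <= t -> f u = p' - u * v'.
    by move=> hu; rewrite -[u in LHS]opprK H'; [ring|lra].
  rewrite !H2; [|lra|lra].
  have -> : p' - t * v' - (p' - s * v') = - v' * (t - s) by ring.
  by rewrite normrM normrN ler_wpM2r// lerDr.
pose C := `|v| + `|v'| + 1.
have C0 : 0 < C by rewrite /C; have := normr_ge0 v; have := normr_ge0 v'; lra.
apply/cvgrPdist_le => e e0.
have m0 : 0 < Num.min (Num.min d d') (e / C) by rewrite !lt_min d0 d'0 divr_gt0.
near=> s.
have : `|t - s| < Num.min (Num.min d d') (e / C).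
  by near: s; apply/nbhs_ballP; exists (Num.min (Num.min d d') (e / C)).
rewrite !lt_min => /andP[/andP[sd sd'] seC].
apply: (le_trans (B s _)).
  by move: sd sd'; rewrite !ltr_norml; lra.
move: seC; rewrite ltr_pdivlMr// /C; have := normr_ge0 (t - s); nra.
Unshelve. all: by end_near. Qed.

End PiecewiseLinear.

(** * From lists of vertices to piecewise linear curves and back *)

Section Interpolation.
Variable R : realType.
Notation pt := (R * R)%type.
Notation tp := (R * pt)%type.
Implicit Types (a b c : tp) (l : seq tp) (Q : R -> set pt).
Notation ltt := (fun x y : tp => x.1 < y.1).

Lemma plf_clamp (f : R -> R) : plf f -> plf (fun t => clamp (f t)).
Proof.
move=> pf; apply: plf_max; first exact: plf_cst.
by apply: plf_min => //; exact: plf_cst.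
Qed.

Lemma plc_continuous (g : R -> pt) : plc g -> continuous g.
Proof.
move=> [g1 g2].
have -> : g = (fun t => ((g t).1, (g t).2)) by apply/funext => t; case: (g t).
by apply: cont_pair; exact: plf_continuous.
Qed.

Fixpoint interp b l (t : R) : pt :=
  match l with
  | [::] => b.2
  | c :: l' => if t <= c.1 then
      b.2 + clamp ((t - b.1) / (c.1 - b.1)) *: (c.2 - b.2) else interp c l' t
  end.

Lemma interp_le b l t : path ltt b l -> t <= b.1 -> interp b l t = b.2.
Proof.
case: l => //= c l /andP[bc _] tb; rewrite ifT; last lra.
rewrite clamp_le0; first by pt_ring.
by rewrite pmulr_lle0 ?invr_gt0; lra.
Qed.

Lemma interp_last b l : path ltt b l -> interp b l (last b l).1 = (last b l).2.
Proof.
elim: l b => //= c l IH b /andP[bc pc]; case: ifP => h; last exact: IH.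
have /eqP : (last c l).1 = c.1.
  apply/le_anti; rewrite h /=; elim: l c pc {IH h bc} => //= d l IH c /andP[cd pd].
  by apply: (le_trans (ltW cd)); exact: IH.
case: l pc {IH h} => [|d l] /= pc => [_|].
  by rewrite divff ?subr_eq0 ?gt_eqF// clamp_ge1//; pt_ring.
case/andP: pc => cd pd /eqP E; exfalso; suff : c.1 < (last d l).1 by rewrite E ltxx.
apply: (lt_le_trans cd); elim: l d pd {E cd} => //= e l IH d /andP[de pe].
by apply: (le_trans (ltW de)); exact: IH.
Qed.

Lemma interp_plc b l : path ltt b l -> plc (interp b l).
Proof.
elim: l b => [|c l IH] b /=; first by split; exact: plf_cst.
move=> /andP[bc pc].
have pcl : plf (fun t => clamp ((t - b.1) / (c.1 - b.1))).
  apply: plf_clamp; apply: (plf_ext _ (plf_scale (c.1 - b.1)^-1 (plf_sub (@plf_id R) (plf_cst b.1)))).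
  by move=> t; rewrite mulrC.
have E : clamp ((c.1 - b.1) / (c.1 - b.1)) = 1.
  by rewrite divff ?subr_eq0 ?gt_eqF// clamp_ge1.
have [IH1 IH2] := IH c pc.
split.
  apply: (@plf_ext _ _ (fun t => if t <= c.1 then
     b.2.1 + clamp ((t - b.1) / (c.1 - b.1)) * (c.2.1 - b.2.1) else (interp c l t).1)).
    by move=> t; case: ifP.
  apply: plf_if => //; last by rewrite E interp_le//; ring.
  apply: plf_add; first exact: plf_cst.
  by apply: (plf_ext _ (plf_scale (c.2.1 - b.2.1) pcl)) => t; rewrite mulrC.
apply: (@plf_ext _ _ (fun t => if t <= c.1 then
   b.2.2 + clamp ((t - b.1) / (c.1 - b.1)) * (c.2.2 - b.2.2) else (interp c l t).2)).
  by move=> t; case: ifP.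
apply: plf_if => //; last by rewrite E interp_le//; ring.
apply: plf_add; first exact: plf_cst.
by apply: (plf_ext _ (plf_scale (c.2.2 - b.2.2) pcl)) => t; rewrite mulrC.
Qed.

Lemma interp_seg b c l t : b.1 < c.1 -> t <= c.1 -> seg b.2 c.2 (interp b (c :: l) t).
Proof.
by move=> bc tc; exists (clamp ((t - b.1) / (c.1 - b.1))); rewrite ?clamp_itv//= tc.
Qed.

Lemma interp_poly b l t : path ltt b l -> tpoly (b :: l) (interp b l t).
Proof.
elim: l b => //= c l IH b /andP[bc pc]; case: ifP => tc; last by right; exact: IH.
by left; have := interp_seg l bc tc; rewrite /= tc.
Qed.

(** [T] and [T'] are the times of consecutive vertices around [t]. The later vertex [w] ends one
    segment and starts the next, so it satisfies [Q] at both times; this is what allows the original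
    curve at [T] and at [T'] to be compared. *)
Lemma interp_near Q b l t : path ltt b l -> segs_in Q (b :: l) ->
  Q (last b l).1 (last b l).2 -> b.1 <= t <= (last b l).1 ->
  exists T T' w, [/\ b.1 <= T <= t, t <= T' <= (last b l).1, Q T (interp b l t), Q T w & Q T' w].
Proof.
elim: l b => [|c l IH] b /=.
  by move=> _ _ Qb bt; exists b.1, b.1, b.2; split => //; lra.
move=> /andP[bc pc] [Qbc Qc] Ql bt.
have [tc|ct] := leP t c.1.
  have le_last : c.1 <= (last c l).1.
    elim: l c pc {IH Qc Ql bt bc Qbc tc} => //= d l IH c /andP[cd pd].
    by apply: (le_trans (ltW cd)); exact: IH.
  exists b.1, c.1, c.2; split => //; [lra|lra| | |].
  - by apply: Qbc; have := interp_seg l bc tc; rewrite /= tc.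
  - by apply: Qbc; exact: seg_r.
  - case: l Qc Ql {pc IH bt le_last} => [_ //|d l] [Qcd _] _.
    by apply: Qcd; exact: seg_l.
have [|T [T' [w [h1 h2 h3 h4 h5]]]] := IH c pc Qc Ql; first lra.
by exists T, T', w; split => //; lra.
Qed.

Lemma interp_inj b l s t : path ltt b l -> simple (b :: l) ->
  b.1 <= s <= (last b l).1 -> b.1 <= t <= (last b l).1 ->
  interp b l s = interp b l t -> s = t.
Proof.
elim: l b s t => [|c l IH] b s t /=; first by lra.
move=> /andP[bc pc] [_ nbc sbc sc].
wlog st : s t / s <= t.
  move=> W; have [st|ts] := leP s t; first exact: W.
  by move=> hs ht E; apply/esym; apply: W => //; lra.
move=> hs ht; have [tc|ct] := leP t c.1.
  rewrite ifT; last lra.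
  rewrite !clamp_id.
  - move=> E; have {}E : ((s - t) / (c.1 - b.1)) *: (c.2 - b.2) = 0.
      have -> : ((s - t) / (c.1 - b.1)) *: (c.2 - b.2) =
        (b.2 + ((s - b.1) / (c.1 - b.1)) *: (c.2 - b.2)) -
        (b.2 + ((t - b.1) / (c.1 - b.1)) *: (c.2 - b.2)) by pt_ring.
      by rewrite E subrr.
    move/eqP: E; rewrite scaler_eq0 => /orP[|/eqP E].
      by rewrite mulf_eq0 invr_eq0 => /orP[/eqP|/eqP]; lra.
    by case: nbc; apply/esym/eqP; rewrite -subr_eq0 E.
  - by rewrite divr_ge0 ?ler_pdivrMr; lra.
  - by rewrite divr_ge0 ?ler_pdivrMr; lra.
have [sc'|cs] := leP s c.1; last by apply: IH => //; lra.
move=> E; have := interp_seg l bc sc'; rewrite /= sc' E => h.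
have := sbc _ h (interp_poly t pc).
rewrite -(interp_le pc (lexx _)) => /IH tE.
have : t = c.1 by apply: tE => //; lra.
lra.
Qed.

Fixpoint breaks (g : R -> pt) (a : R) (s : seq R) : Prop :=
  if s is b :: s' then
    [/\ a < b, exists p v : pt, forall t, a <= t <= b -> g t = p + t *: v
      & breaks g b s']
  else True.

Lemma breaks_rcons g (a : R) s (b : R) : breaks g a s -> last a s < b ->
  (exists p v : pt, forall t, last a s <= t <= b -> g t = p + t *: v) ->
  breaks g a (rcons s b).
Proof.
elim: s a => [|x s IH] a /=; first by move=> _ ab H; split.
by move=> [ax H B] lb H'; split => //; exact: IH.
Qed.

(** The times that a finite subdivision from [a] can reach have a supremum. The left germ there
    shows that it is reached, the right germ that it is not below [b]. *)
Lemma plc_breaks g (a b : R) : plc g -> a <= b -> exists s, breaks g a s /\ last a s = b.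
Proof.
move=> [[g1r g1l] [g2r g2l]] ab.
pose S := [set x : R | a <= x <= b /\ exists s, breaks g a s /\ last a s = x].
have Sa : S a by split; [rewrite lexx|exists [::]].
have hS : has_sup S by split; [exists a|exists b => x [/andP[]]].
have le_sup x : S x -> x <= sup S by move=> Sx; apply: sup_upper_bound.
have supb : sup S <= b by apply: ge_sup => //; [exists a|move=> x [/andP[]]].
have asup := le_sup _ Sa.
have Ssup : S (sup S).
  have [d [p [v [d0 H]]]] := g1l (- sup S); have [d' [p' [v' [d'0 H']]]] := g2l (- sup S).
  have m0 : 0 < Num.min d d' by rewrite lt_min d0.
  have [x Sx] := sup_adherent m0 hS.
  have := le_sup _ Sx; rewrite le_eqVlt => /orP[/eqP <- //|xS].
  rewrite ltrBlDr -ltrBlDl lt_min => /andP[xd xd'].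
  split; first lra.
  have [_ [s [bs ls]]] := Sx.
  exists (rcons s (sup S)); split; last by rewrite last_rcons.
  apply: breaks_rcons => //; rewrite ls//.
  exists (p, p'), (- v, - v') => t ht.
  apply: pt_ext; rewrite /= ?scaleRE.
    by rewrite -[t in LHS]opprK H; [ring|lra].
  by rewrite -[t in LHS]opprK H'; [ring|lra].
have [supb'|bsup] := ltP (sup S) b; last first.
  have -> : b = sup S by lra.
  by case: Ssup.
exfalso.
have [d [p [v [d0 H]]]] := g1r (sup S); have [d' [p' [v' [d'0 H']]]] := g2r (sup S).
pose m := Num.min (Num.min d d') (b - sup S).
have m0 : 0 < m by rewrite !lt_min d0 d'0; lra.
have [md [md' mb]] : m <= d /\ m <= d' /\ m <= b - sup S.
  by rewrite !ge_min !lexx !orbT.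
suff /le_sup : S (sup S + m) by lra.
split; first lra.
have [_ [s [bs ls]]] := Ssup.
exists (rcons s (sup S + m)); split; last by rewrite last_rcons.
apply: breaks_rcons => //; rewrite ls; first lra.
exists (p, p'), (v, v') => t ht.
by apply: pt_ext; rewrite /= ?scaleRE; [apply: H|apply: H']; lra.
Qed.

Lemma breaks_poly g (a : R) s : breaks g a s ->
  forall z, polyline (map g (a :: s)) z -> exists2 t, a <= t <= last a s & z = g t.
Proof.
elim: s a => [|b s IH] a /=; first by move=> _ z ->; exists a; rewrite ?lexx.
move=> [ab [p [v H]] B] z [[u hu ->]|hz].
  have le_last : b <= last b s.
    elim: s b B {H IH ab} => //= c s IH b [bc _ B].
    by apply: (le_trans (ltW bc)); exact: IH.
  exists (a + u * (b - a)); first by nra.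
  by rewrite !H; [pt_ring|nra|lra|lra].
by have [t ht ->] := IH b B z hz; exists t => //; lra.
Qed.

End Interpolation.

Section SmallConstants.
Variable R : realType.

(** Serves to choose one constant for finitely many requirements, each of which persists when the
    constant shrinks. *)
Lemma small_seq (I : eqType) (s : seq I) (P : I -> R -> Prop) :
  (forall i d d', 0 < d' <= d -> P i d -> P i d') ->
  (forall i, i \in s -> exists2 d, 0 < d & P i d) ->
  exists2 d, 0 < d & forall i, i \in s -> P i d.
Proof.
move=> mono; elim: s => [|i s IH] H; first by exists 1.
have [|d d0 Hd] := IH; first by move=> j js; apply: H; rewrite inE js orbT.
have [|e e0 He] := H i; first by rewrite inE eqxx.
exists (Num.min d e); first by rewrite lt_min d0.
move=> j; rewrite inE => /orP[/eqP ->|js].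
  by apply: (mono _ e) => //; rewrite lt_min d0 e0 ge_min lexx orbT.
by apply: (mono _ d); rewrite ?lt_min ?d0 ?e0 ?ge_min ?lexx//; exact: Hd.
Qed.

Lemma small_fin (I : finType) (P : I -> R -> Prop) :
  (forall i d d', 0 < d' <= d -> P i d -> P i d') ->
  (forall i, exists2 d, 0 < d & P i d) ->
  exists2 d, 0 < d & forall i, P i d.
Proof.
move=> mono H; have [d d0 Hd] := @small_seq I (enum I) P mono (fun i _ => H i).
by exists d => // i; apply: Hd; rewrite mem_enum.
Qed.
End SmallConstants.

(** * Polygonal approximation of drawings *)

Section Arcs.
Variable R : realType.
Notation pt := (R * R)%type.
Implicit Types (g : R -> pt).

Lemma curve_compact g (a b : R) : continuous g -> compact (g @` `[a, b]).
Proof.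
move=> cg; apply: continuous_compact; last exact: segment_compact.
exact: continuous_subspaceT.
Qed.

Lemma curve_sep g (a b : R) (K : set pt) : continuous g -> compact K ->
  (forall t, a <= t <= b -> ~ K (g t)) ->
  exists2 d, 0 < d & forall t y, a <= t <= b -> K y -> d < `|g t - y|.
Proof.
move=> cg cK H.
have [|d d0 Hd] := compact_sep (curve_compact (a := a) (b := b) cg) cK.
  by move=> z [t /=]; rewrite in_itv /= => ht <-; exact: H.
by exists d => // t y ht Ky; apply: Hd => //; exists t => //=; rewrite in_itv.
Qed.

(** The pairs of times whose images are at least [e] apart form a compact set; the minimum of their
    distance is the mesh. *)
Lemma uniform_mesh g (a b e : R) : continuous g -> 0 < e ->
  exists2 d, 0 < d & forall x y, a <= x <= b -> a <= y <= b -> `|x - y| < d ->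
    `|g x - g y| < e.
Proof.
move=> cg e0.
pose K := (`[a, b] `*` `[a, b]) `&` [set z : R * R | e <= `|g z.1 - g z.2|].
have cK : compact K.
  apply: (subclosed_compact _ (compact_setX (@segment_compact R a b) (@segment_compact R a b))); last by move=> ? [].
  apply: closedI.
    by apply: compact_closed; [exact: norm_hausdorff|apply: compact_setX; exact: segment_compact].
  apply: (@closed_comp _ _ (fun z : R * R => `|g z.1 - g z.2|) [set x | e <= x]).
    move=> x _; apply: cont_norm; apply: cont_sub; apply: cont_comp cg => z; [exact: cvg_fst|exact: cvg_snd].
  exact: closed_ge.
have [K0|/set0P K0] := eqVneq K set0.
  exists 1 => // x y hx hy _; rewrite ltNge; apply/negP => h.
  have : K (x, y) by split => //; split; rewrite /= in_itv.
  by rewrite K0.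
have cf : continuous (fun z : R * R => `|z.1 - z.2|).
  by apply: cont_norm; apply: cont_sub => z; [exact: cvg_fst|exact: cvg_snd].
have [[x0 y0]] := compact_EVT_min K0 cK (continuous_subspaceT cf).
rewrite inE => -[_ /= h0] Hmin.
exists `|x0 - y0|.
  rewrite normr_gt0 subr_eq0; apply/eqP => E; move: h0.
  by rewrite E subrr normr0; lra.
move=> x y hx hy; apply: contra_ltT; rewrite -!leNgt => h.
by apply: (Hmin (x, y)); rewrite inE; split => //; split; rewrite /= in_itv.
Qed.

(** An injective arc that returns close to an earlier point has stayed close to it in between;
    otherwise a minimum over a compact set of triples of times would produce a coincidence. This
    bounds what loop erasure can skip. *)
Lemma inj_modulus g (a b e : R) : continuous g -> 0 < e ->
  (forall s t, a <= s <= b -> a <= t <= b -> g s = g t -> s = t) ->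
  exists2 d, 0 < d & forall s x t, a <= s -> s <= x -> x <= t -> t <= b ->
    `|g s - g t| <= d -> `|g x - g s| < e.
Proof.
move=> cg e0 inj.
pose K := ((`[a, b] `*` `[a, b]) `*` `[a, b]) `&`
  [set z : R * R * R | [/\ e <= `|g z.1.2 - g z.1.1|, z.1.1 <= z.1.2 & z.1.2 <= z.2]].
have c11 : continuous (fun z : R * R * R => z.1.1).
  by apply: (@cont_fst R _ (fun z : R * R * R => z.1)) => z; exact: cvg_fst.
have c12 : continuous (fun z : R * R * R => z.1.2).
  by apply: (@cont_snd R _ (fun z : R * R * R => z.1)) => z; exact: cvg_fst.
have c2 : continuous (fun z : R * R * R => z.2) by move=> z; exact: cvg_snd.
have cK : compact K.
  have c3 := compact_setX (compact_setX (@segment_compact R a b) (@segment_compact R a b)) (@segment_compact R a b).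
  apply: (subclosed_compact _ c3); last by move=> ? [].
  apply: closedI; first exact: (compact_closed (@norm_hausdorff _ _) c3).
  have -> : [set z : R * R * R | [/\ e <= `|g z.1.2 - g z.1.1|, z.1.1 <= z.1.2 & z.1.2 <= z.2]] =
    (fun z : R * R * R => `|g z.1.2 - g z.1.1|) @^-1` [set x | e <= x] `&`
    ((fun z : R * R * R => z.1.2 - z.1.1) @^-1` [set x | 0 <= x] `&`
     (fun z : R * R * R => z.2 - z.1.2) @^-1` [set x | 0 <= x]).
    by apply/seteqP; split => z /=; rewrite !subr_ge0; [move=> [? ? ?]|move=> [? [? ?]]].
  apply: closedI; last apply: closedI.
  - apply: closed_comp; last exact: closed_ge.
    by move=> x _; apply: cont_norm; apply: cont_sub; exact: cont_comp cg.
  - by apply: closed_comp; [move=> x _; exact: cont_sub|exact: closed_ge].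
  - by apply: closed_comp; [move=> x _; exact: cont_sub|exact: closed_ge].
have [K0|/set0P K0] := eqVneq K set0.
  exists 1 => // s x t hs sx xt ht _; rewrite ltNge; apply/negP => h.
  have : K (s, x, t) by split => //=; split; [split|]; rewrite /= in_itv /=; lra.
  by rewrite K0.
have cf : continuous (fun z : R * R * R => `|g z.1.1 - g z.2|).
  by apply: cont_norm; apply: cont_sub; exact: cont_comp cg.
have [[[s0 x0] t0]] := compact_EVT_min K0 cK (continuous_subspaceT cf).
rewrite inE => -[[[]]] /=; rewrite !in_itv /= => hs0 hx0 ht0 [h0 sx0 xt0] Hmin.
have m0 : 0 < `|g s0 - g t0|.
  rewrite normr_gt0 subr_eq0; apply/eqP => /(inj _ _ hs0 ht0) E; move: h0.
  have -> : x0 = s0 by lra.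
  by rewrite subrr normr0; lra.
exists (`|g s0 - g t0| / 2); first by lra.
move=> s x t hs sx xt ht st; rewrite ltNge; apply/negP => h.
have := Hmin (s, x, t); rewrite inE /= => Hm.
have : `|g s0 - g t0| <= `|g s - g t|.
  by apply: Hm; split => //=; split; [split|]; rewrite /= in_itv /=; lra.
lra.
Qed.

Lemma first_below (f : R -> R) (a b r : R) : continuous f -> a < b -> r < f a -> f b <= r ->
  exists t, [/\ a < t <= b, f t = r & forall s, a <= s < t -> r < f s].
Proof.
move=> cf ab fa fb.
pose S := `[a, b] `&` f @^-1` [set x | x <= r].
have cS : compact S.
  apply: (subclosed_compact _ (@segment_compact R a b)); last by move=> x [].
  apply: closedI; first exact: itv_closed.
  by apply: (closed_comp _ (@closed_le R r)) => x _; exact: cf.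
have S0 : S !=set0 by exists b; split => //=; rewrite in_itv /= lexx ltW.
have [t] := compact_EVT_min S0 cS (continuous_subspaceT (@cont_id R)).
rewrite inE => -[/=]; rewrite in_itv /= => tab ft H.
have pre s : a <= s < t -> r < f s.
  move=> hs; rewrite ltNge; apply/negP => h.
  have : t <= s by apply: H; rewrite inE; split => //=; rewrite in_itv /=; lra.
  lra.
have at_ : a < t.
  rewrite lt_neqAle; case/andP: tab => -> _; rewrite andbT; apply/eqP => E.
  by move: ft; rewrite -E; lra.
exists t; split => //; first lra.
have [|c] := @IVT R f a t r (ltW at_) (continuous_subspaceT cf).
  by rewrite ge_min le_max ft (ltW fa) !orbT.
rewrite in_itv /= => hc fc; apply/le_anti; rewrite ft /=.
have : ~ (c < t) by move=> ct; have := pre c; rewrite fc ltxx; case/andP: hc => -> _; rewrite ct => /(_ erefl).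
move=> nct; have -> : t = c by lra.
by rewrite fc.
Qed.

(** [t1] is the last time at distance [r] from the start, [t2] the first one at distance [r] from
    the end. For small [r] the midpoint separates them, because each half of the arc stays away from
    the opposite end. *)
Lemma truncate_arc g (lo hi : R) : continuous g -> lo < hi ->
  (forall s t, lo <= s <= hi -> lo <= t <= hi -> g s = g t -> s = t) ->
  exists2 r0, 0 < r0 & forall r, 0 < r <= r0 -> exists t1 t2,
    [/\ lo < t1 /\ t1 < t2 /\ t2 < hi, `|g t1 - g lo| = r, `|g t2 - g hi| = r,
        forall t, t1 < t <= hi -> r < `|g t - g lo|
      & forall t, lo <= t < t2 -> r < `|g t - g hi|].
Proof.
move=> cg lohi inj; pose m := (lo + hi) / 2.
have [|d d0 Hd] := @curve_sep g m hi [set g lo] cg (@compact_set1 _ _).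
  by move=> t ht /= /inj; rewrite /m in ht; lra.
have [|e e0 He] := @curve_sep g lo m [set g hi] cg (@compact_set1 _ _).
  by move=> t ht /= /inj; rewrite /m in ht; lra.
exists (Num.min d e); first by rewrite lt_min d0.
move=> r; rewrite le_min => /andP[r0 /andP[rd re]].
(* A last time is a first time for the reversed curve, hence the change of sign. *)
have [||||t1' [h1 f1 p1]] := @first_below (fun u => `|g (- u) - g lo|) (- m) (- lo) r.
- apply: cont_norm; apply: cont_sub; last exact: cont_cst.
  have cN : continuous (fun u : R => - u) by move=> x; apply: cvgN; exact: cvg_id.
  exact: (cont_comp cN cg).
- by rewrite /m; lra.
- by rewrite opprK; apply: (le_lt_trans rd); apply: Hd => //; rewrite /m; lra.
- by rewrite opprK subrr normr0 ltW.
have [||||t2 [h2 f2 p2]] := @first_below (fun u => `|g u - g hi|) m hi r.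
- by apply: cont_norm; apply: cont_sub => //; exact: cont_cst.
- by rewrite /m; lra.
- by apply: (le_lt_trans re); apply: He => //; rewrite /m; lra.
- by rewrite subrr normr0 ltW.
have nlo : - t1' != lo by apply/eqP => E; move: f1; rewrite E subrr normr0; lra.
have nhi : t2 != hi by apply/eqP => E; move: f2; rewrite E subrr normr0; lra.
exists (- t1'), t2; split => //.
- split; first by rewrite lt_neqAle eq_sym nlo; lra.
  by split; [lra|rewrite lt_neqAle nhi; lra].
- move=> t ht; have [tm|mt] := leP m t.
    by apply: (le_lt_trans rd); apply: Hd => //; lra.
  by have := p1 (- t); rewrite opprK; apply; lra.
- move=> t ht; have [tm|mt] := leP t m; last by apply: p2; lra.
  by apply: (le_lt_trans re); apply: He => //; lra.
Qed.

End Arcs.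

(** * Simple polygonal approximation of one arc *)

Section PolygonalArcs.
Variable R : realType.
Notation pt := (R * R)%type.
Notation tp := (R * pt)%type.
Notation ltt := (fun x y : tp => x.1 < y.1).
Implicit Types (g : R -> pt).

Lemma seg_norm (p q z : pt) : seg p q z -> `|z - p| <= `|q - p|.
Proof.
move=> [u hu ->]; have -> : p + u *: (q - p) - p = u *: (q - p) by pt_ring.
rewrite normrZ ger0_norm; last lra.
by have := normr_ge0 (q - p); nra.
Qed.

(** The claims are quantified over a tail [tl], so that the chords can be continued by the radial
    segment into the end of the arc. *)
Lemma mesh_list g (a b d : R) : a < b -> 0 < d -> exists s : seq R,
  let m := map (fun x => (x, g x)) s in forall tl : seq tp,
  [/\ path ltt (b, g b) tl -> path ltt (a, g a) (m ++ tl),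
      last (a, g a) (m ++ tl) = last (b, g b) tl,
      forall Q, (forall x y, a <= x -> x < y -> y <= b -> y - x < d ->
        seg (g x) (g y) `<=` Q x) -> segs_in Q ((b, g b) :: tl) ->
        segs_in Q ((a, g a) :: m ++ tl)
    & forall z, tpoly ((a, g a) :: m ++ tl) z ->
       (exists x y, [/\ a <= x, x < y, y <= b, y - x < d & seg (g x) (g y) z])
       \/ tpoly ((b, g b) :: tl) z].
Proof.
move=> ab d0.
have [n] : exists n : nat, b - a <= n%:R * (d / 2).
  have d20 : 0 < d / 2 by lra.
  exists (Num.truncn ((b - a) / (d / 2))).+1.
  by rewrite -ler_pdivrMr// ltW// truncnS_gt.
elim: n a ab => [|n IH] a ab.
  by rewrite mul0r; lra.
move=> hn; have [lt_d|ge_d] := ltP (b - a) d.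
  exists [:: b] => m tl; split => //=.
  - by move=> ->; rewrite ab.
  - by move=> Q H Qb; split => //; apply: H.
  - by move=> z [h|h]; [left; exists a, b; split|right].
have ab' : a + d / 2 < b by lra.
have [|s Hs] := IH _ ab'.
  by move: hn; rewrite -natr1 mulrDl mul1r; lra.
exists (a + d / 2 :: s) => m tl; have [H1 H2 H3 H4] := Hs tl; split => /=.
- by move=> h; rewrite H1// andbT; lra.
- by rewrite H2.
- move=> Q H Qb; split; first by apply: H; lra.
  by apply: H3 => // x y hx xy hy yd; apply: H => //; lra.
- move=> z [h|/H4 [[x [y [hx xy hy yd h]]]|h]].
  + by left; exists a, (a + d / 2); split => //; lra.
  + by left; exists x, y; split => //; lra.
  + by right.
Qed.

Lemma simple_path b l : simple (R := R) (b :: l) -> path ltt b l.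
Proof. by elim: l b => //= c l IH b [-> _ _ /IH ->]. Qed.

(** The polygon consists of a radial segment, short chords along the truncated arc and another
    radial segment; loop erasure makes it simple. Every surviving point is within [eta] of the arc
    at the time of its label, and the stretch skipped between consecutive labels costs at most [rho]
    by the modulus of injectivity. *)
Lemma polygonal_arc g (lo hi t1 t2 r eta eps rho : R) : continuous g ->
  lo < t1 -> t1 < t2 -> t2 < hi -> `|g t1 - g lo| = r -> `|g t2 - g hi| = r ->
  0 < eps -> eps < r -> eps <= eta -> r <= eta -> r < `|g lo - g hi| ->
  (forall t, t1 <= t <= t2 -> r <= `|g t - g lo|) ->
  (forall s x t, lo <= s -> s <= x -> x <= t -> t <= hi -> `|g s - g t| <= 2 * eta ->
    `|g x - g s| < rho) ->
  exists be : R -> pt,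
  [/\ plc be, be lo = g lo /\ be hi = g hi,
      forall s t, lo <= s <= hi -> lo <= t <= hi -> be s = be t -> s = t,
      forall t, lo <= t <= hi -> `|be t - g t| <= eta + rho
    & forall t, lo <= t <= hi -> [\/ seg (g lo) (g t1) (be t), seg (g hi) (g t2) (be t)
        | exists2 x, t1 <= x <= t2 & `|be t - g x| <= eps]].
Proof.
move=> cg lt1 t12 t2h r1 r2 eps0 epsr epsE rE rlh rt modu.
have [d d0 Hd] := @uniform_mesh R g t1 t2 eps cg eps0.
have [s Hs] := @mesh_list g t1 t2 d t12 d0.
have [] := Hs [:: (hi, g hi)]; set m := map _ _ => P1 P2 P3 P4.
pose W z := [\/ seg (g lo) (g t1) z, seg (g hi) (g t2) z
        | exists2 x, t1 <= x <= t2 & `|z - g x| <= eps].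
pose Q T z := `|z - g T| <= eta /\ W z.
have chord x y z : t1 <= x -> x < y -> y <= t2 -> y - x < d -> seg (g x) (g y) z -> `|z - g x| <= eps.
  move=> hx xy hy yd /seg_norm h; apply: (le_trans h); apply: ltW; apply: Hd; [lra|lra|].
  by rewrite ger0_norm; lra.
pose l := (t1, g t1) :: m ++ [:: (hi, g hi)].
have pl : path ltt (lo, g lo) l.
  by rewrite /l /= lt1 /=; apply: P1 => /=; rewrite t2h.
have Ql : segs_in Q ((lo, g lo) :: l).
  rewrite /l; split.
    by move=> z h; split; [have /= := seg_norm h; rewrite r1; lra|apply: Or31].
  apply: P3 => /=.
    move=> x y hx xy hy yd z h; have c := chord _ _ _ hx xy hy yd h.
    by split; [lra|apply: Or33; exists x => //; lra].
  split => // z h; split.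
    have /= := seg_norm h; rewrite -[`|g hi - g t2|]normrN opprB r2; lra.
  apply: Or32; case: h => u hu ->; exists (1 - u); first lra.
  by rewrite /=; pt_ring.
have ll : last (lo, g lo) l = (hi, g hi) by rewrite /l /= P2.
(* The start is not visited again, so erasure leaves the head with its label [lo]. *)
have nlo : ~ tpoly l (g lo).
  move=> /P4 [[x [y [hx xy hy yd /(chord _ _ _ hx xy hy yd) h]]]|/= h].
    have := rt x; rewrite -normrN opprB in h => /(_ _); lra.
  case: h => [h|h].
    case: h => u hu E.
    have E2 : g lo - g hi = (1 - u) *: (g t2 - g hi) by rewrite E; pt_ring.
    move: rlh; rewrite E2 normrZ r2 ger0_norm; last lra.
    have r0 : 0 < r by lra.
    by nra.
  by move: rlh; rewrite h subrr normr0; lra.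
have [b [l' [[sb Qb] b2 [_ [Eb|//]] lb sub]]] := loop_erasure pl Ql.
have {Eb} ? := Eb; subst b.
have pb := simple_path sb.
rewrite ll in lb.
have E1 : interp (lo, g lo) l' lo = g lo by rewrite interp_le.
have E2 : interp (lo, g lo) l' hi = g hi.
  by have := interp_last pb; rewrite lb.
have Qhi : Q hi (g hi).
  by split; [rewrite subrr normr0; lra|apply: Or32; exact: seg_l].
have near t : lo <= t <= hi -> exists T T' w, [/\ lo <= T <= t, t <= T' <= hi,
    Q T (interp (lo, g lo) l' t), Q T w & Q T' w].
  by move=> ht; have := interp_near (t := t) pb Qb; rewrite lb; exact.
exists (interp (lo, g lo) l'); split => //.
- exact: interp_plc.
- by move=> u v hu hv; apply: interp_inj => //; rewrite lb.
- move=> t /near[T [T' [w [hT hT' [h _] [hw _] [hw' _]]]]].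
  have TT' : `|g T - g T'| <= 2 * eta.
    have -> : g T - g T' = (w - g T') - (w - g T) by pt_ring.
    by apply: (le_trans (ler_normB _ _)); lra.
  have := modu T t T'; rewrite TT' => /(_ _ _ _ _ isT) tT.
  have -> : interp (lo, g lo) l' t - g t = (interp (lo, g lo) l' t - g T) - (g t - g T) by pt_ring.
  apply: (le_trans (ler_normB _ _)); apply: lerD => //; apply: ltW; apply: tT; lra.
- by move=> t /near[T [T' [w [_ _ [_ h]]]]].
Qed.
End PolygonalArcs.

(** * Simultaneous approximation of arcs that meet only at ends *)

Section ArcFamily.
Variable R : realType.
Notation pt := (R * R)%type.

Definition meet_at_ends (J : finType) (lo hi : J -> R) (g : J -> R -> pt) : Prop :=
  forall j j' s t, lo j <= s <= hi j -> lo j' <= t <= hi j' -> g j s = g j' t ->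
    (j = j' /\ s = t) \/ ((s = lo j \/ s = hi j) /\ (t = lo j' \/ t = hi j')).

(** All arcs are truncated at the same distance [r] from their ends. Radial segments at a common end
    have equal norm and distinct tips, so they share only that end. The truncated arcs are disjoint
    and compact, hence a positive distance apart, and the chords stay within [ep] of them. *)
Lemma polygonal_family (J : finType) (lo hi : J -> R) (g : J -> R -> pt) (rho : R) :
  0 < rho -> (forall j, continuous (g j)) -> (forall j, lo j < hi j) ->
  (forall j, g j (lo j) <> g j (hi j)) -> meet_at_ends lo hi g ->
  exists be : J -> R -> pt,
  [/\ forall j, plc (be j), forall j, be j (lo j) = g j (lo j) /\ be j (hi j) = g j (hi j),
      forall j t, lo j <= t <= hi j -> `|be j t - g j t| <= rho
    & meet_at_ends lo hi be].
Proof.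
move=> rho0 cg lohi nloop meet.
have inj j s t : lo j <= s <= hi j -> lo j <= t <= hi j -> g j s = g j t -> s = t.
  move=> hs ht E; have [[_ ->//]|[[Es|Es] [Et|Et]]] := meet j j s t hs ht E; subst s t => //.
    by case: (nloop j).
  by case: (nloop j).
pose en j (b : bool) := if b then hi j else lo j.
pose p j b := g j (en j b).
have en_in j b : lo j <= en j b <= hi j by rewrite /en; have := lohi j; case: b; lra.
have [eta eta0 Heta] : exists2 eta : R, 0 < eta & forall j, eta <= rho / 2 /\
    forall s x t, lo j <= s -> s <= x -> x <= t -> t <= hi j ->
    `|g j s - g j t| <= 2 * eta -> `|g j x - g j s| < rho / 2.
  apply: small_fin => [j d d' hd [h1 h2]|j].
    by split; [lra|move=> s x t h3 h4 h5 h6 h7; apply: (h2 s x t) => //; lra].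
  have rho20 : 0 < rho / 2 by lra.
  have [d d0 Hd] := inj_modulus (cg j) rho20 (@inj j).
  exists (Num.min (rho / 2) (d / 2)); first by rewrite lt_min rho20; lra.
  have [m1 m2] : Num.min (rho / 2) (d / 2) <= rho / 2 /\ Num.min (rho / 2) (d / 2) <= d / 2.
    by rewrite !ge_min !lexx orbT.
  by split => // s x t h3 h4 h5 h6 h7; apply: (Hd s x t) => //; lra.
(* [r1] keeps the balls around different ends disjoint; [r2] below keeps each arc out of the balls
   around points that are not its ends. *)
have [r1 r10 Hr1] : exists2 r1 : R, 0 < r1 & forall i : J * bool * (J * bool),
    p i.1.1 i.1.2 <> p i.2.1 i.2.2 -> 2 * r1 < `|p i.1.1 i.1.2 - p i.2.1 i.2.2|.
  apply: small_fin => [i d d' hd h1 /h1|i]; first by lra.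
  have [E|/eqP N] := eqVneq (p i.1.1 i.1.2) (p i.2.1 i.2.2); first by exists 1.
  have h : 0 < `|p i.1.1 i.1.2 - p i.2.1 i.2.2| by rewrite normr_gt0 subr_eq0; apply/eqP.
  by exists (`|p i.1.1 i.1.2 - p i.2.1 i.2.2| / 4); lra.
have [r2 r20 Hr2] : exists2 r2 : R, 0 < r2 & forall i : J * (J * bool),
    (forall b, p i.2.1 i.2.2 <> p i.1 b) ->
    forall t, lo i.1 <= t <= hi i.1 -> r2 < `|g i.1 t - p i.2.1 i.2.2|.
  apply: small_fin => [i d d' hd h1 h2 t /(h1 h2)|[j [j' b']] /=]; first by lra.
  have [N|N] := pselect (forall b, p j' b' <> p j b); last by exists 1.
  have [|d d0 Hd] := @curve_sep R (g j) (lo j) (hi j) [set p j' b'] (cg j) (@compact_set1 _ _).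
    move=> t ht /= E; have [] := meet j j' t (en j' b') ht (en_in _ _) E.
      by move=> [Ej Et]; subst j'; exact: (N b').
    by move=> [[h|h] _]; [apply: (N false)|apply: (N true)]; rewrite -E h.
  by exists d => // _ t ht; exact: Hd.
have [r3 r30 Hr3] : exists2 r3 : R, 0 < r3 & forall j (r : R), 0 < r <= r3 -> exists t1 t2,
    [/\ lo j < t1 /\ t1 < t2 /\ t2 < hi j, `|g j t1 - g j (lo j)| = r, `|g j t2 - g j (hi j)| = r,
        forall t, t1 < t <= hi j -> r < `|g j t - g j (lo j)|
      & forall t, lo j <= t < t2 -> r < `|g j t - g j (hi j)|].
  apply: small_fin => [j d d' hd h r hr|j]; first by apply: h; lra.
  exact: (truncate_arc (cg j) (lohi j) (@inj j)).
have [r [r0 [re [rr1 [rr2 rr3]]]]] : exists r : R, 0 < r /\ r <= eta /\ r <= r1 /\ r <= r2 /\ r <= r3.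
  exists (Num.min (Num.min eta r1) (Num.min r2 r3)).
  by rewrite !lt_min eta0 r10 r20 r30 !ge_min !lexx !orbT.
have /choice[t1 H1] : forall j, exists t1, exists t2,
    [/\ lo j < t1 /\ t1 < t2 /\ t2 < hi j, `|g j t1 - g j (lo j)| = r, `|g j t2 - g j (hi j)| = r,
        forall t, t1 < t <= hi j -> r < `|g j t - g j (lo j)|
      & forall t, lo j <= t < t2 -> r < `|g j t - g j (hi j)|].
  by move=> j; apply: Hr3; rewrite r0.
have /choice[t2 {}H1] := H1.
pose T j (b : bool) := if b then t2 j else t1 j.
have T_in j b : t1 j <= T j b <= t2 j by have [[? [? ?]] _ _ _ _] := H1 j; rewrite /T; case: b; lra.
have T_norm j b : `|g j (T j b) - p j b| = r by have [] := H1 j; case: b.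
have K_r j b x : t1 j <= x <= t2 j -> `|g j x - p j b| <= r -> x = T j b.
  have [[? [? ?]] _ _ h4 h5] := H1 j => hx; case: b; rewrite /p /T /en => h.
    by have [xt|] := ltP x (t2 j); [have := h5 x; lra|lra].
  by have [xt|] := ltP (t1 j) x; [have := h4 x; lra|lra].
have interior j j' x y : t1 j <= x <= t2 j -> t1 j' <= y <= t2 j' -> g j x = g j' y -> j = j'.
  move=> hx hy E; have [[? [? ?]] _ _ _ _] := H1 j; have [[? [? ?]] _ _ _ _] := H1 j'.
  have [|||[-> //]|[h _]] := meet j j' x y; [lra|lra|done|].
  by exfalso; case: h => h; lra.
have radial_end j b z : seg (p j b) (g j (T j b)) z -> r <= `|z - p j b| -> z = g j (T j b).
  move=> [u hu ->].
  have -> : p j b + u *: (g j (T j b) - p j b) - p j b = u *: (g j (T j b) - p j b) by pt_ring.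
  rewrite normrZ T_norm ger0_norm; last lra.
  by move=> h; have -> : u = 1; [nra|pt_ring].
(* In the ball around its own end a truncated arc has only its tip, and the tips of different arcs
   differ. *)
have KR j j' b' x : j <> j' -> t1 j <= x <= t2 j -> ~ seg (p j' b') (g j' (T j' b')) (g j x).
  move=> jj' hx h; have := seg_norm h; rewrite T_norm => hr.
  have [[? [? ?]] _ _ _ _] := H1 j.
  have [N|] := pselect (forall b, p j' b' <> p j b).
    by have := Hr2 (j, (j', b')) N x; rewrite /= => /(_ _); lra.
  move=> /existsNP[b /contrapT Eb]; rewrite Eb in hr.
  have Ex := K_r _ _ _ hx hr.
  apply: jj'; apply: (interior j j' x (T j' b') hx (T_in _ _)).
  by apply: radial_end => //; rewrite Eb Ex T_norm.
have [eps eps0 Heps] : exists2 eps : R, 0 < eps & forall i : J * J, i.1 <> i.2 ->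
   (forall x y, t1 i.1 <= x <= t2 i.1 -> t1 i.2 <= y <= t2 i.2 -> 2 * eps < `|g i.1 x - g i.2 y|) /\
   (forall b x z, t1 i.1 <= x <= t2 i.1 -> seg (p i.2 b) (g i.2 (T i.2 b)) z -> eps < `|g i.1 x - z|).
  apply: small_fin => [i d d' hd h N|[j j'] /=].
    have [h1 h2] := h N; split => [x y hx hy|b x z hx hz].
      by have := h1 x y hx hy; lra.
    by have := h2 b x z hx hz; lra.
  have [->|/eqP N] := eqVneq j j'; first by exists 1.
  have [|d d0 Hd] := @curve_sep R (g j) (t1 j) (t2 j) _ (cg j) (curve_compact (a := t1 j') (b := t2 j') (cg j')).
    by move=> t ht [y /=]; rewrite in_itv /= => hy /esym /(interior _ _ _ _ ht hy).
  have sepR b : exists2 d', 0 < d' & forall x z, t1 j <= x <= t2 j ->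
      seg (p j' b) (g j' (T j' b)) z -> d' < `|g j x - z|.
    apply: curve_sep => //; first exact: seg_compact.
    by move=> t ht; exact: KR.
  have [d1 d10 Hd1] := sepR true; have [d2 d20 Hd2] := sepR false.
  pose m := Num.min (d / 2) (Num.min d1 d2).
  have [md [md1 md2]] : m <= d / 2 /\ m <= d1 /\ m <= d2 by rewrite !ge_min !lexx !orbT.
  exists m; first by rewrite !lt_min d10 d20; lra.
  move=> _; split => [x y hx hy|b x z hx hz].
    have : d < `|g j x - g j' y| by apply: Hd => //; exists y => //=; rewrite in_itv.
    by lra.
  by case: b hz => hz; [have := Hd1 x z hx hz|have := Hd2 x z hx hz]; lra.
pose ep := Num.min eps (r / 2).
have [ep1 [ep2 ep0]] : ep <= eps /\ ep <= r / 2 /\ 0 < ep by rewrite !ge_min !lexx !orbT lt_min eps0; split => //; split => //; lra.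
have /choice[be Hbe] : forall j, exists be : R -> pt,
  [/\ plc be, be (lo j) = g j (lo j) /\ be (hi j) = g j (hi j),
      forall s t, lo j <= s <= hi j -> lo j <= t <= hi j -> be s = be t -> s = t,
      forall t, lo j <= t <= hi j -> `|be t - g j t| <= eta + rho / 2
    & forall t, lo j <= t <= hi j -> [\/ seg (g j (lo j)) (g j (t1 j)) (be t), seg (g j (hi j)) (g j (t2 j)) (be t)
        | exists2 x, t1 j <= x <= t2 j & `|be t - g j x| <= ep]].
  move=> j; have [[? [? ?]] n1 n2 h1 h2] := H1 j.
  apply: (@polygonal_arc R (g j) (lo j) (hi j) (t1 j) (t2 j) r) => //; [lra|lra| | |].
  - by have := Hr1 ((j, false), (j, true)) (@nloop j); rewrite /p /=; lra.
  - move=> t ht; have [tt|tt] := ltP (t1 j) t; first by apply: ltW; apply: h1; lra.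
    by have -> : t = t1 j by [lra]; rewrite n1.
  - by have [_] := Heta j.
exists be; split; [by move=> j; have [] := Hbe j|by move=> j; have [] := Hbe j| |].
  move=> j t ht; have [_ _ _ h _] := Hbe j; apply: (le_trans (h t ht)).
  by have [? _] := Heta j; lra.
have W j t : lo j <= t <= hi j -> (exists b, seg (p j b) (g j (T j b)) (be j t)) \/
    exists2 x, t1 j <= x <= t2 j & `|be j t - g j x| <= ep.
  move=> ht; have [_ _ _ _ h] := Hbe j; case: (h t ht) => h'; last by right.
    by left; exists false.
  by left; exists true.
have p_end j b t : lo j <= t <= hi j -> be j t = p j b -> t = lo j \/ t = hi j.
  move=> ht; have [_ [e1 e2] bi _ _] := Hbe j; have := lohi j => ?.
  by case: b => E; [right|left]; apply: bi => //; rewrite ?lexx ?ltW// E /p /= ?e1 ?e2.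
move=> j j' s t hs ht E.
have [Ej|/eqP jj'] := eqVneq j j'.
  subst j'; left; split => //; have [_ _ bi _ _] := Hbe j; exact: bi.
right; have [[b h]|[x hx h]] := W j s hs; have [[b' h']|[y hy h']] := W j' t ht.
- have [Ep|Np] := pselect (p j b = p j' b'); last first.
    have /= := Hr1 ((j, b), (j', b')) Np.
    have := seg_norm h; have := seg_norm h'; rewrite -E !T_norm => n1 n2.
    have -> : p j b - p j' b' = (be j s - p j' b') - (be j s - p j b) by pt_ring.
    by move=> n3; have := ler_normB (be j s - p j' b') (be j s - p j b); lra.
  case: h h' => u hu Eu [u' hu' Eu'].
  have E3 : u *: (g j (T j b) - p j b) = u' *: (g j' (T j' b') - p j b).
    have -> : u *: (g j (T j b) - p j b) = be j s - p j b by rewrite Eu; pt_ring.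
    by rewrite E Eu' Ep; pt_ring.
  (* Both radial segments have norm [r], so the point divides them in the same ratio. *)
  have uu' : u = u'.
    have : `|u *: (g j (T j b) - p j b)| = `|u' *: (g j' (T j' b') - p j b)| by rewrite E3.
    rewrite !normrZ T_norm Ep T_norm !ger0_norm; [|lra|lra].
    by nra.
  have [u0|u0] := eqVneq u 0.
    have E1 : be j s = p j b by rewrite Eu u0; pt_ring.
    by split; [exact: (p_end j b)|apply: (p_end j' b') => //; rewrite -E E1].
  exfalso; apply: jj'; apply: (interior j j' (T j b) (T j' b') (T_in _ _) (T_in _ _)).
  have : u *: (g j (T j b) - g j' (T j' b')) = 0.
    have -> : u *: (g j (T j b) - g j' (T j' b')) =
       u *: (g j (T j b) - p j b) - u *: (g j' (T j' b') - p j b) by pt_ring.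
    by rewrite E3 uu' subrr.
  by move/eqP; rewrite scaler_eq0 (negbTE u0) /= subr_eq0 => /eqP.
- exfalso; have [_ hh] := Heps (j', j) (fun e => jj' (esym e)).
  have := hh b y (be j s) hy h; rewrite /= -normrN opprB E; lra.
- exfalso; have [_ hh] := Heps (j, j') jj'.
  have := hh b' x (be j' t) hx h'; rewrite /= -normrN opprB -E; lra.
- exfalso; have [hh _] := Heps (j, j') jj'.
  have := hh x y hx hy; rewrite /=.
  have -> : g j x - g j' y = (be j s - g j' y) - (be j s - g j x) by pt_ring.
  have := ler_normB (be j s - g j' y) (be j s - g j x); rewrite E in h *; lra.
Qed.
End ArcFamily.

(** * Cutting a drawing into finitely many arcs *)

Section BoundedLists.

(** Finiteness is stated throughout as a bound on duplicate-free lists; a longest such list is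
    complete. *)
Lemma bounded_listing (T : eqType) (P : T -> Prop) (N : nat) :
  (forall l : seq T, uniq l -> (forall x, x \in l -> P x) -> (size l <= N)%N) ->
  exists l : seq T, forall x, P x -> x \in l.
Proof.
move=> bd; pose Q n := `[< exists l : seq T, [/\ uniq l, forall x, x \in l -> P x & size l = n] >].
have exQ : exists n, Q n by exists 0%N; apply/asboolP; exists [::].
have ubQ n : Q n -> (n <= N)%N by move=> /asboolP[l [ul lP <-]]; exact: bd.
case: (ex_maxnP exQ ubQ) => n /asboolP[l [ul lP sl]] maxn.
exists l => x Px; apply/negPn/negP => nx.
have /maxn : Q n.+1.
  apply/asboolP; exists (x :: l); split; rewrite /= ?nx ?sl//.
  by move=> y; rewrite inE => /orP[/eqP ->|/lP].
by rewrite ltnn.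
Qed.
End BoundedLists.

Section Halves.
Variable R : realType.
Implicit Types (a b x y t : R) (s : seq R).

(** A stretch between two consecutive crossing times can be a closed curve. Its midpoint is not a
    crossing time, so each half has distinct end points, as [polygonal_family] requires. *)
Fixpoint halves a s : seq (R * R) :=
  if s is b :: s' then (a, (a + b) / 2) :: ((a + b) / 2, b) :: halves b s' else [::].

Lemma path_last a s : path <%R a s -> a <= last a s.
Proof. by elim: s a => //= b s IH a /andP[ab /IH]; exact: le_trans (ltW ab). Qed.

Lemma path_mem a s z : path <%R a s -> z \in a :: s -> a <= z <= last a s.
Proof.
elim: s a => [|b s IH] a /=; first by rewrite inE => _ /eqP ->; rewrite lexx.
move=> /andP[ab pb]; have := path_last pb; rewrite inE => h /orP[/eqP ->|/(IH _ pb)]; lra.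
Qed.

Lemma halvesP a s x y : path <%R a s -> (x, y) \in halves a s ->
  [/\ a <= x, x < y, y <= last a s, forall z, z \in a :: s -> ~ (x < z < y)
    & (x \in a :: s /\ y \notin a :: s /\ a < y < last a s) \/
      (y \in a :: s /\ x \notin a :: s /\ a < x < last a s)].
Proof.
elim: s a => //= b s IH a /andP[ab pb]; have := path_last pb => bl.
have between m : a < m < b -> m \notin a :: b :: s.
  move=> hm; apply/negP; rewrite inE => /orP[/eqP E|/(path_mem pb)]; lra.
have nz z : z \in a :: b :: s -> z = a \/ b <= z.
  by rewrite inE => /orP[/eqP ->|/(path_mem pb)/andP[? _]]; [left|right].
move=> hxy; have {hxy} [[-> ->]|[[-> ->]|h]] : (x = a /\ y = (a + b) / 2) \/
    (x = (a + b) / 2 /\ y = b) \/ (x, y) \in halves b s.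
  move: hxy; rewrite !inE => /orP[/eqP[-> ->]|/orP[/eqP[-> ->]|->]]; [by left|by right; left|by right; right].
- split; [lra|lra|lra|by move=> z /nz[->|]; lra|left].
  by rewrite between ?mem_head; [split => //; split => //; lra|lra].
- split; [lra|lra|lra|by move=> z /nz[->|]; lra|right].
  by rewrite between ?inE ?eqxx ?orbT; [split => //; split => //; lra|lra].
- have [h1 h2 h3 h4 h5] := IH b pb h; split => //; [lra| |].
    by move=> z; rewrite inE => /orP[/eqP ->|/h4//]; lra.
  case: h5 => -[i1 [i2 i3]]; [left|right]; (split; [by rewrite inE i1 orbT|]);
  (split; last lra); rewrite inE (negbTE i2) orbF; apply/eqP; lra.
Qed.

Lemma halves_coverR a s t : path <%R a s -> a <= t < last a s ->
  exists x y, (x, y) \in halves a s /\ x <= t < y.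
Proof.
elim: s a => [|b s IH] a /=; first by lra.
move=> /andP[ab pb] ht; have [h1|h1] := ltP t ((a + b) / 2).
  by exists a, ((a + b) / 2); rewrite inE eqxx; split => //; lra.
have [h2|h2] := ltP t b.
  by exists ((a + b) / 2), b; rewrite !inE eqxx orbT; split => //; lra.
have [|x [y [i h]]] := IH b pb; first lra.
by exists x, y; rewrite !inE i !orbT.
Qed.

Lemma halves_coverL a s t : path <%R a s -> a < t <= last a s ->
  exists x y, (x, y) \in halves a s /\ x < t <= y.
Proof.
elim: s a => [|b s IH] a /=; first by lra.
move=> /andP[ab pb] ht; have [h1|h1] := leP t ((a + b) / 2).
  by exists a, ((a + b) / 2); rewrite inE eqxx; split => //; lra.
have [h2|h2] := leP t b.
  by exists ((a + b) / 2), b; rewrite !inE eqxx orbT; split => //; lra.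
have [|x [y [i h]]] := IH b pb; first lra.
by exists x, y; rewrite !inE i !orbT.
Qed.

Lemma halves_overlap a s x y x' y' t : path <%R a s ->
  (x, y) \in halves a s -> (x', y') \in halves a s -> x <= t <= y -> x' <= t <= y' ->
  (x = x' /\ y = y') \/ ((t = x \/ t = y) /\ (t = x' \/ t = y')).
Proof.
elim: s a => //= b s IH a /andP[ab pb].
have low u v : (u, v) \in halves b s -> b <= u /\ u < v.
  by move=> /(halvesP pb)[].
rewrite !inE => /orP[/eqP[-> ->]|/orP[/eqP[-> ->]|h]] /orP[/eqP[-> ->]|/orP[/eqP[-> ->]|h']];
  try (by left); move=> ht ht'; try (have [? ?] := low _ _ h); try (have [? ?] := low _ _ h').
- by right; split; [right|left]; lra.
- exfalso; lra.
- by right; split; [left|right]; lra.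
- by right; split; [right|left]; lra.
- exfalso; lra.
- by right; split; [left|right]; lra.
- exact: (IH b pb h h').
Qed.

End Halves.

Section Drawing.
Variables (R : realType) (V E : finType).
Notation pt := (R * R)%type.
Implicit Types (pts : V -> pt) (c : E -> R -> pt) (src tgt : E -> V).

(** For [e = f] the smaller parameter comes first, so that every self-intersection is listed
    once. *)
Definition few_crossings (k : nat) c : Prop :=
  forall e f (l : seq (R * R)), uniq l ->
    (forall z, z \in l ->
      [/\ 0 < z.1 < 1, 0 < z.2 < 1, c e z.1 = c f z.2 & e = f -> z.1 < z.2]) ->
    (size l <= k)%N.

Definition drawn k pts c src tgt : Prop :=
  [/\ injective pts, forall e, continuous (c e),
      forall e, c e 0 = pts (src e) /\ c e 1 = pts (tgt e),
      forall e (t : R) v, 0 < t < 1 -> c e t <> pts v & few_crossings k c].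

(** Cut at all crossing times and at midpoints, the edges become arcs that meet only at ends and can
    be replaced together. Points of the new curves coincide only at parameters where the old ones
    did, so no crossing appears. *)
Lemma pl_drawing k pts c src tgt (rho : R) : 0 < rho ->
  drawn k pts c src tgt ->
  (forall e v (t : R), v <> src e -> v <> tgt e -> 0 <= t <= 1 -> rho < `|c e t - pts v|) ->
  exists c', [/\ drawn k pts c' src tgt, forall e, plc (c' e)
    & forall e (t : R), 0 <= t <= 1 -> `|c' e t - c e t| <= rho].
Proof.
move=> rho0 [pinj cc cends cav cfew] far.
have /choice[L HL] : forall ef : E * E, exists l : seq (R * R), forall z,
    [/\ 0 < z.1 < 1, 0 < z.2 < 1, c ef.1 z.1 = c ef.2 z.2 & ef.1 = ef.2 -> z.1 < z.2] -> z \in l.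
  by move=> [e f]; apply: (@bounded_listing _ _ k) => l ul lP; exact: (cfew e f l ul lP).
pose ct e := [seq x <- flatten [seq [seq z.1 | z <- L (e, f)] ++ [seq z.2 | z <- L (e, f)] | f <- enum E] | 0 < x < 1].
have ctP e f s t : 0 < s < 1 -> 0 < t < 1 -> c e s = c f t -> (e, s) <> (f, t) -> s \in ct e.
  move=> hs ht E1 N; rewrite mem_filter hs /=; apply/flattenP.
  exists ([seq z.1 | z <- L (e, f)] ++ [seq z.2 | z <- L (e, f)]).
    by apply/mapP; exists f => //; rewrite mem_enum.
  rewrite mem_cat; have [ef|/eqP ef] := eqVneq e f; last first.
    by rewrite (map_f fst (x := (s, t)))//; apply: HL; split.
  subst f; have [st|ts] := leP s t.
    have {}st : s < t by rewrite lt_neqAle st andbT; apply/eqP => E2; apply: N; rewrite E2.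
    by rewrite (map_f fst (x := (s, t)))//; apply: HL; split.
  by rewrite (map_f snd (x := (t, s))) ?orbT//; apply: HL; split.
pose sp e := sort <=%R (undup (rcons (ct e) 1)).
have spP e : path <%R 0 (sp e) /\ last 0 (sp e) = 1.
  have sp_s : sorted <%R (sp e).
    by rewrite lt_sorted_uniq_le sort_uniq undup_uniq sort_le_sorted.
  have sp_m x : x \in sp e -> 0 < x <= 1.
    rewrite mem_sort mem_undup mem_rcons inE mem_filter => /orP[/eqP ->|/andP[? _]]; lra.
  have sp_1 : 1 \in sp e by rewrite mem_sort mem_undup mem_rcons inE eqxx.
  have p0 : path <%R 0 (sp e).
    by rewrite (path_sortedE lt_trans) sp_s andbT; apply/allP => x /sp_m/andP[].
  split => //; apply/le_anti/andP; split.
    have := mem_last 0 (sp e); rewrite inE => /orP[/eqP ->|/sp_m]; lra.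
  have := path_mem p0 (z := 1); rewrite inE sp_1 orbT => /(_ isT); lra.
have spct e x : x \in ct e -> x \in 0 :: sp e.
  by move=> h; rewrite inE mem_sort mem_undup mem_rcons inE h !orbT.
pose arcs := [seq (e, ab) | e <- enum E, ab <- halves 0 (sp e)].
have arcsP e a b : ((e, (a, b)) \in arcs) = ((a, b) \in halves 0 (sp e)).
  apply/allpairsPdep/idP => [[e' [ab [_ h [-> ->]]]] //|h].
  by exists e, (a, b); rewrite mem_enum.
pose J := seq_sub arcs.
pose ed (j : J) := (ssval j).1; pose lo (j : J) := (ssval j).2.1; pose hi (j : J) := (ssval j).2.2.
have Jin j : (lo j, hi j) \in halves 0 (sp (ed j)).
  by rewrite -arcsP /lo /hi /ed; case: j => -[e [a b]].
have Jex e a b : (a, b) \in halves 0 (sp e) -> exists j : J, [/\ ed j = e, lo j = a & hi j = b].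
  by rewrite -arcsP => h; exists (SeqSub h).
have Jeq j j' : ed j = ed j' -> lo j = lo j' -> hi j = hi j' -> j = j'.
  move=> h1 h2 h3; apply: val_inj => /=; rewrite [ssval j]surjective_pairing [ssval j']surjective_pairing.
  by congr pair => //; rewrite [(ssval j).2]surjective_pairing [(ssval j').2]surjective_pairing; congr pair.
have Jb j : [/\ 0 <= lo j, lo j < hi j, hi j <= 1 & forall z, z \in ct (ed j) -> ~ (lo j < z < hi j)].
  have [p1 p2] := spP (ed j); have [] := halvesP p1 (Jin j); rewrite p2 => h1 h2 h3 h4 _.
  by split => // z /spct /h4.
pose g (j : J) := c (ed j).
have ends01 e f s t : (s = 0 \/ s = 1) -> 0 <= t <= 1 -> c e s = c f t -> t = 0 \/ t = 1.
  move=> hs ht E1; have [ts|nts] := pselect (0 < t < 1).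
    have [? ?] := cends e.
    by case: hs => hs; subst s; [case: (cav f t (src e) ts)|case: (cav f t (tgt e) ts)]; rewrite -E1.
  by have [|] := eqVneq t 0; [left|move=> /eqP ?; right]; lra.
have end_arc j t : lo j <= t <= hi j -> t = 0 \/ t = 1 -> t = lo j \/ t = hi j.
  by have [? ? ? _] := Jb j; move=> ht [] ?; subst t; [left|right]; lra.
have meet : meet_at_ends lo hi g.
  move=> j j' s t hs ht E1.
  have [? ? ? sj] := Jb j; have [? ? ? sj'] := Jb j'.
  have [[Ee Es]|N] := pselect ((ed j, s) = (ed j', t)).
    have [p1 p2] := spP (ed j); have := Jin j'; rewrite -Ee => inj'; rewrite -Es in ht.
    have [[El Eh]|[h1 h2]] := halves_overlap p1 (Jin j) inj' hs ht.
      by left; split => //; apply: Jeq.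
    by right; rewrite -Es.
  right; have [hs1|ns] := pselect (0 < s < 1); last first.
    have hs0 : s = 0 \/ s = 1 by have [|] := eqVneq s 0; [left|move=> /eqP ?; right]; lra.
    by split; [exact: end_arc|apply: end_arc => //; apply: (ends01 _ _ _ _ hs0 _ E1); lra].
  have [ht1|nt] := pselect (0 < t < 1); last first.
    have ht0 : t = 0 \/ t = 1 by have [|] := eqVneq t 0; [left|move=> /eqP ?; right]; lra.
    have := ends01 _ _ _ s ht0 _ (esym E1) => /(_ _); lra.
  have m1 := sj _ (ctP _ _ _ _ hs1 ht1 E1 N).
  have m2 := sj' _ (ctP _ _ _ _ ht1 hs1 (esym E1) (fun h => N (esym h))).
  split.
    by have [->|/eqP ?] := eqVneq s (lo j); [left|right]; lra.
  by have [->|/eqP ?] := eqVneq t (lo j'); [left|right]; lra.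
have nloop j : g j (lo j) <> g j (hi j).
  move=> E1; have [p1 p2] := spP (ed j); have [] := halvesP p1 (Jin j).
  rewrite p2 => h1 h2 h3 _ h5.
  suff X s t : c (ed j) s = c (ed j) t -> 0 <= s <= 1 -> s \in 0 :: sp (ed j) -> t \notin 0 :: sp (ed j) -> 0 < t < 1 -> False.
    case: h5 => -[i1 [i2 i3]]; first by apply: (X (lo j) (hi j) E1 _ i1 i2 i3); lra.
    by apply: (X (hi j) (lo j) (esym E1) _ i1 i2 i3); lra.
  move=> E2 hs si ti ht; have [hs1|ns] := pselect (0 < s < 1).
    have /spct : t \in ct (ed j).
      apply: (ctP _ _ _ _ ht hs1 (esym E2)) => -[E3].
      by move: ti; rewrite E3 si.
    by rewrite (negbTE ti).
  have hs0 : s = 0 \/ s = 1 by have [|] := eqVneq s 0; [left|move=> /eqP ?; right]; lra.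
  have := ends01 _ _ _ t hs0 _ E2 => /(_ _); lra.
have [be [bpl bends bnear bmeet]] := polygonal_family rho0 (fun j => cc (ed j)) (fun j => let: And4 _ h _ _ := Jb j in h) nloop meet.
have ex e t : 0 <= t <= 1 -> exists j, ed j = e /\ lo j <= t <= hi j.
  move=> ht; have [p1 p2] := spP e; have [t1|t1] := ltP t 1.
    have [|a [b [i h]]] := halves_coverR p1 (t := t); first by rewrite p2; lra.
    by have [j [h1 h2 h3]] := Jex _ _ _ i; exists j; split => //; rewrite h2 h3; lra.
  have [|a [b [i h]]] := halves_coverL p1 (t := t); first by rewrite p2; lra.
  by have [j [h1 h2 h3]] := Jex _ _ _ i; exists j; split => //; rewrite h2 h3; lra.
have /choice[js Hjs] : forall et : E * R, exists j, ed j = et.1 /\ lo j <= clamp et.2 <= hi j.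
  by move=> [e t]; apply: ex; exact: clamp_itv.
(* Adjacent arcs agree at their common end, so the choice made by [js] is harmless; clamping makes
   the curve constant outside [0, 1]. *)
pose c' e t := be (js (e, t)) (clamp t).
have b_end j t : t = lo j \/ t = hi j -> be j t = c (ed j) t.
  by have [h1 h2] := bends j; move=> [->|->].
have c'E j t : lo j <= t <= hi j -> c' (ed j) t = be j t.
  move=> ht; have [? ? ? _] := Jb j; have [/= h1 h2] := Hjs (ed j, t).
  have Et : clamp t = t by apply: clamp_id; lra.
  rewrite /c' Et; rewrite Et in h2.
  have [|[E4 _]|[i1 i2]] := meet j (js (ed j, t)) t t ht h2; [by rewrite /g h1|by rewrite -E4|].
  by rewrite (b_end _ _ i2) (b_end _ _ i1) h1.
have c'01 e : c' e 0 = c e 0 /\ c' e 1 = c e 1.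
  have [|j [ej hj]] := ex e 0; first lra.
  have [|j' [ej' hj']] := ex e 1; first lra.
  split.
    by rewrite -[in LHS]ej c'E// b_end ?ej//; apply: end_arc => //; left.
  by rewrite -[in LHS]ej' c'E// b_end ?ej'//; apply: end_arc => //; right.
have c'near e t : 0 <= t <= 1 -> `|c' e t - c e t| <= rho.
  by move=> /(ex e)[j [<- hj]]; rewrite c'E//; exact: bnear.
have c'plf (pr : pt -> R) : (forall j, plf (fun t => pr (be j t))) -> forall e, plf (fun t => pr (c' e t)).
  move=> plb e; have [p1 p2] := spP e; split => t.
    have [t0|t0] := ltP t 0.
      apply: (@rgerm_ext _ _ (fun=> pr (c' e 0)) t (- t)); [lra| |by have [h _] := plf_cst (pr (c' e 0)); exact: h].
      move=> s hs; congr pr.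
      have [|j [<- hj]] := ex e 0; first lra.
      rewrite [c' _ 0]c'E//; rewrite /c' clamp_le0; last lra.
      have [/= h1 h2] := Hjs (ed j, s); rewrite clamp_le0 in h2; last lra.
      by rewrite -(c'E (js (ed j, s)))// h1 c'E.
    have [t1|t1] := ltP t 1; last first.
      apply: (@rgerm_ext _ _ (fun=> pr (c' e 1)) t 1) => //; [|by have [h _] := plf_cst (pr (c' e 1)); exact: h].
      move=> s hs; congr pr.
      have [|j [<- hj]] := ex e 1; first lra.
      rewrite [c' _ 1]c'E//; rewrite /c' clamp_ge1; last lra.
      have [/= h1 h2] := Hjs (ed j, s); rewrite clamp_ge1 in h2; last lra.
      by rewrite -(c'E (js (ed j, s)))// h1 c'E.
    have [|a [b [i h]]] := halves_coverR p1 (t := t); first by rewrite p2; lra.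
    have [j [h1 h2 h3]] := Jex _ _ _ i.
    apply: (@rgerm_ext _ _ (fun s => pr (be j s)) t (b - t)); [lra| |by have [h' _] := plb j; exact: h'].
    by move=> s hs; rewrite -h1 c'E//; lra.
  have [t0|t0] := leP 0 t.
    apply: (@rgerm_ext _ _ (fun=> pr (c' e 0)) t 1) => //; [|by have [h _] := plf_cst (pr (c' e 0)); exact: h].
    move=> s hs; congr pr.
    have [|j [<- hj]] := ex e 0; first lra.
    rewrite [c' _ 0]c'E//; rewrite /c' clamp_le0; last lra.
    have [/= h1 h2] := Hjs (ed j, - s); rewrite clamp_le0 in h2; last lra.
    by rewrite -(c'E (js (ed j, - s)))// h1 c'E.
  have [t1|t1] := ltP t (-1).
    apply: (@rgerm_ext _ _ (fun=> pr (c' e 1)) t (- 1 - t)); [lra| |by have [h _] := plf_cst (pr (c' e 1)); exact: h].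
    move=> s hs; congr pr.
    have [|j [<- hj]] := ex e 1; first lra.
    rewrite [c' _ 1]c'E//; rewrite /c' clamp_ge1; last lra.
    have [/= h1 h2] := Hjs (ed j, - s); rewrite clamp_ge1 in h2; last lra.
    by rewrite -(c'E (js (ed j, - s)))// h1 c'E.
  have [|a [b [i h]]] := halves_coverL p1 (t := - t); first by rewrite p2; lra.
  have [j [h1 h2 h3]] := Jex _ _ _ i.
  apply: (@rgerm_ext _ _ (fun s => pr (be j (- s))) t (- t - a)); [lra| |by have [_ h'] := plb j; exact: h'].
  by move=> s hs; rewrite -h1 c'E//; lra.
have c'pl e : plc (c' e).
  by split; [apply: (c'plf fst) => j; have [] := bpl j|apply: (c'plf snd) => j; have [] := bpl j].
have c'meet e f s t : 0 <= s <= 1 -> 0 <= t <= 1 -> c' e s = c' f t -> (e, s) <> (f, t) -> c e s = c f t.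
  move=> /(ex e)[j [<- hj]] /(ex f)[j' [<- hj']]; rewrite !c'E// => E1 N.
  have [[E2 E3]|[h1 h2]] := bmeet _ _ _ _ hj hj' E1.
    by case: N; rewrite E2 E3.
  by rewrite -!b_end.
exists c'; split => //; split => //.
- by move=> e; exact: plc_continuous.
- by move=> e; have [-> ->] := c'01 e.
- move=> e t v ht E1.
  have vend : v = src e \/ v = tgt e.
    have [->|/eqP n1] := eqVneq v (src e); first by left.
    have [->|/eqP n2] := eqVneq v (tgt e); first by right.
    exfalso; have h := far e v t n1 n2; have h' := c'near e t; rewrite -E1 -normrN opprB in h; lra.
  have [h0 h1] := cends e; have [h0' h1'] := c'01 e.
  case: vend => vE; subst v.
    apply: (cav e t (src e) ht); rewrite -h0; apply: c'meet; [lra|lra|by rewrite E1 h0' h0|].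
    by move=> -[E2]; lra.
  apply: (cav e t (tgt e) ht); rewrite -h1; apply: c'meet; [lra|lra|by rewrite E1 h1' h1|].
  by move=> -[E2]; lra.
- move=> e f l ul H; apply: (cfew e f l ul) => z /H[h1 h2 h3 h4]; split => //.
  apply: c'meet; [lra|lra|done|].
  by move=> -[/h4 + E2]; rewrite E2 ltxx.
Qed.

End Drawing.

(** * Straightening a polygonal path *)

Section Homeo.
Variable R : realType.
Notation pt := (R * R)%type.
Implicit Types (h : pt -> pt) (F : set pt).

(** Piecewise linearity is demanded through its effect on curves, which passes to compositions
    without any triangulation. *)
Definition plhomeo h : Prop :=
  [/\ continuous h, exists g, [/\ continuous g, cancel h g & cancel g h]
    & forall c : R -> pt, plc c -> plc (fun t => h (c t))].

Lemma plhomeo_id : plhomeo id.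
Proof. by split => //; [exact: cont_id|exists id; split => //; exact: cont_id]. Qed.

Lemma plhomeo_comp h1 h2 : plhomeo h1 -> plhomeo h2 -> plhomeo (fun z => h2 (h1 z)).
Proof.
move=> [c1 [g1 [cg1 k1 k1']] p1] [c2 [g2 [cg2 k2 k2']] p2]; split.
- exact: cont_comp.
- exists (fun z => g1 (g2 z)); split; first exact: cont_comp.
    by move=> z; rewrite k2 k1.
  by move=> z; rewrite k1' k2'.
- by move=> c /p1 /p2.
Qed.

Lemma plhomeo_inj h : plhomeo h -> injective h.
Proof. by move=> [_ [g [_ k _]] _]; exact: can_inj k. Qed.

Lemma compact_closed_sep (A B : set pt) : compact A -> closed B ->
  (forall x, A x -> ~ B x) -> exists2 d : R, 0 < d & forall x y, A x -> B y -> d < `|x - y|.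
Proof.
move=> cA cB AB.
have [M [_ HM]] := compact_bounded cA.
have {}HM x : A x -> `|x| <= M + 1 by move=> Ax; apply: (HM (M + 1)) => //; lra.
pose N := M + 2; pose C := `[- N, N] `*` `[- N, N] : set pt.
have cC : compact C by apply: compact_setX; exact: segment_compact.
have cBC : compact (B `&` C).
  apply: (subclosed_compact _ cC); last by move=> ? [].
  apply: closedI => //; apply: compact_closed => //; exact: norm_hausdorff.
have [|d d0 Hd] := compact_sep cA cBC; first by move=> x Ax [/(AB _ Ax)].
exists (Num.min d (1 / 2)); first by rewrite lt_min d0; lra.
move=> x y Ax By; have [h|h] := leP `|x - y| 1; last by apply: le_lt_trans h; rewrite ge_min; lra.
apply: (@le_lt_trans _ _ d); first by rewrite ge_min lexx.
apply: Hd => //; split => //.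
have : `|y| <= N.
  have -> : y = x - (x - y) by pt_ring.
  by apply: (le_trans (ler_normB _ _)); have := HM x Ax; rewrite /N; lra.
rewrite pt_norm ge_max !ler_norml => /andP[h1 h2].
by split; rewrite /= in_itv.
Qed.

Definition mono_inv (f g : R -> R) : Prop :=
  [/\ {homo f : x y / x <= y}, {homo g : x y / x <= y}, cancel f g & cancel g f].

Lemma mono_inv_sym f g : mono_inv f g -> mono_inv g f.
Proof. by case. Qed.

(** A maximum of increasing bijections is inverted by the minimum of their inverses. This gives the
    sliding map below an explicit continuous inverse. *)
Lemma mono_inv_max f1 g1 f2 g2 : mono_inv f1 g1 -> mono_inv f2 g2 ->
  mono_inv (fun x => Num.max (f1 x) (f2 x)) (fun x => Num.min (g1 x) (g2 x)).
Proof.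
move=> [F1 G1 k1 k1'] [F2 G2 k2 k2']; split.
- by move=> x y xy; rewrite ge_max !le_max F1// F2// orbT.
- by move=> x y xy; rewrite le_min !ge_min G1// G2// orbT.
- move=> x /=; have [h|h] := leP (f1 x) (f2 x).
    by rewrite k2; apply/min_idPr; rewrite -[leLHS]k1; exact: G1.
  by rewrite k1; apply/min_idPl; rewrite -[leLHS]k2; apply: G2; exact: ltW.
- move=> x /=; have [h|h] := leP (g1 x) (g2 x).
    by rewrite k1'; apply/max_idPl; rewrite -[leRHS]k2'; exact: F2.
  by rewrite k2'; apply/max_idPr; rewrite -[leRHS]k1'; apply: F1; exact: ltW.
Qed.

Lemma mono_inv_affine (p m : R) : 0 < p -> mono_inv (fun x => p * x + m) (fun x => (x - m) / p).
Proof.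
move=> p0; split.
- by move=> x y xy; rewrite lerD2r ler_pM2l.
- by move=> x y xy; rewrite ler_pM2r ?invr_gt0// lerD2r.
- by move=> x /=; field; rewrite gt_eqF.
- by move=> x /=; field; rewrite gt_eqF.
Qed.

Lemma plf_affine2 (A B C : R) (c : R -> pt) : plc c -> plf (fun t => A * (c t).1 + B * (c t).2 + C).
Proof. by move=> [c1 c2]; apply: plf_add; [exact: plf_lin|exact: plf_cst]. Qed.

Lemma cont_affine2 (A B C : R) : continuous (fun z : pt => A * z.1 + B * z.2 + C).
Proof.
apply: cont_add; last exact: cont_cst.
apply: cont_add; (apply: cont_mul; first exact: cont_cst).
  by apply: cont_fst; exact: cont_id.
by apply: cont_snd; exact: cont_id.
Qed.

Lemma cont_along (u : pt) (X f : pt -> R) : continuous X -> continuous f ->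
  continuous (fun z : pt => z + (f z - X z) *: u).
Proof.
move=> cX cf; apply: cont_add; first exact: cont_id.
by apply: cont_scale; [exact: cont_sub|exact: cont_cst].
Qed.

Lemma plc_along (u : pt) (c : R -> pt) (f : R -> R) : plc c -> plf f -> plc (fun t => c t + f t *: u).
Proof.
move=> [c1 c2] pf; split.
  by apply: plf_add => //; apply: (plf_ext _ (plf_scale u.1 pf)) => t; rewrite mulrC.
by apply: plf_add => //; apply: (plf_ext _ (plf_scale u.2 pf)) => t; rewrite mulrC.
Qed.

(* The map slides points along [u], straightening the corner [a0 a1 a2]:
   in the coordinates (X, Y) of the basis (u, a2 - a1), [a0] = (0, 0),
   [b] = (1, 0), [a1] = (1, eps) and [a2] = (1, 1 + eps). *)
Lemma straighten_corner (a0 a1 a2 : pt) (rho : R) : 0 < rho <= 1 ->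
  (a1.1 - a0.1) * (a2.2 - a1.2) - (a1.2 - a0.2) * (a2.1 - a1.1) != 0 ->
  exists h b, [/\ plhomeo h, h a0 = b, exists2 e, 0 < e <= rho & b = a1 - e *: (a2 - a1),
    forall z, h z <> z -> exists2 y, seg a0 a1 y &
      `|z - y| <= 2 * rho * (`|a1 - a0| + `|a2 - a1|)
    & forall z, seg b a2 (h z) -> seg a0 a1 z \/ seg a1 a2 z].
Proof.
move=> hrho; set D := _ - _ => D0.
(* On the line Y = 0 the sliding map is the identity outside [-rho, 1 + rho] by the choice of [p]
   and [q], and it sends 0 to 1. With [K = p / e], at height y in [0, e] it sends [y / e] to 1, so
   the segment from [a0] to [a1] becomes upright. The value of [e] keeps the support within |Y| <=
   rho / 2. *)
pose e := rho ^+ 2 / 4; pose p := rho / (1 + rho); pose q := 1 + 1 / rho; pose K := p / e.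
have r0 : 0 < rho by lra.
have e0 : 0 < e by rewrite /e divr_gt0// exprn_gt0.
have er : e <= rho / 4 by rewrite /e ler_pM2r ?invr_gt0// expr2; nra.
have p0 : 0 < p by rewrite divr_gt0//; lra.
have p1 : p < 1 by rewrite ltr_pdivrMr; lra.
have q0 : 1 < q by rewrite ltrDl divr_gt0.
have K0 : 0 < K by rewrite divr_gt0.
pose w : pt := a2 - a1; pose b : pt := a1 - e *: w; pose u : pt := b - a0.
pose X (z : pt) : R := (w.2 / D) * z.1 + (- w.1 / D) * z.2 + (- (w.2 * a0.1 - w.1 * a0.2) / D).
pose Y (z : pt) : R := (- u.2 / D) * z.1 + (u.1 / D) * z.2 + (u.2 * a0.1 - u.1 * a0.2) / D.
have XE (z : pt) (s : R) : X (z + s *: u) = X z + s.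
  rewrite /X /u /b /w /= !scaleRE; move: D0; rewrite /D => D0; field; exact: D0.
have YE (z : pt) (s : R) : Y (z + s *: u) = Y z.
  rewrite /Y /u /b /w /= !scaleRE; move: D0; rewrite /D => D0; field; exact: D0.
have coord z : z = a0 + X z *: u + Y z *: w.
  by apply: pt_ext; rewrite /X /Y /u /b /w /= !scaleRE; move: D0; rewrite /D => D0; field; exact: D0.
pose m (y : R) : R := 1 - K * `|y|.
pose Phi (x y : R) : R := Num.max x (Num.min (p * x + m y) (q * x + m y)).
pose Psi (x y : R) : R := Num.min x (Num.max ((x - m y) / p) ((x - m y) / q)).
have inv y : mono_inv (Phi^~ y) (Psi^~ y).
  apply: (@mono_inv_max id id); first by split.
  by apply/mono_inv_sym/mono_inv_max; apply: mono_inv_sym; apply: mono_inv_affine => //; lra.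
pose h (z : pt) : pt := z + (Phi (X z) (Y z) - X z) *: u.
pose g (z : pt) : pt := z + (Psi (X z) (Y z) - X z) *: u.
have Xh z : X (h z) = Phi (X z) (Y z) by rewrite XE; ring.
have Yh z : Y (h z) = Y z by rewrite YE.
have Xg z : X (g z) = Psi (X z) (Y z) by rewrite XE; ring.
have Yg z : Y (g z) = Y z by rewrite YE.
have cX : continuous X by exact: cont_affine2.
have cY : continuous Y by exact: cont_affine2.
have cm : continuous (fun z => m (Y z)).
  apply: cont_sub; first exact: cont_cst.
  by apply: cont_mul; [exact: cont_cst|exact: cont_norm].
have hh : plhomeo h.
  split.
  - apply: cont_along => //; apply: cont_max => //.
    by apply: cont_min; apply: cont_add => //; apply: cont_mul => //; exact: cont_cst.
  - exists g; split.
    + apply: cont_along => //; apply: cont_min => //.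
      by apply: cont_max; apply: cont_mul; (exact: cont_sub || exact: cont_cst).
    + move=> z; rewrite [g (h z)]/g Xh Yh; have [_ _ k _] := inv (Y z).
      by rewrite (k (X z)) /h; pt_ring.
    + move=> z; rewrite [h (g z)]/h Xg Yg; have [_ _ _ k] := inv (Y z).
      by rewrite (k (X z)) /g; pt_ring.
  - move=> c pc; apply: plc_along => //.
    have pX : plf (fun t => X (c t)) by exact: plf_affine2.
    have pY : plf (fun t => Y (c t)) by exact: plf_affine2.
    have pm : plf (fun t => m (Y (c t))).
      by apply: plf_sub; [exact: plf_cst|apply: plf_scale; exact: plf_abs].
    apply: plf_sub => //; apply: plf_max => //.
    by apply: plf_min; apply: plf_add => //; exact: plf_scale.
have X0 : X a0 = 0 by rewrite /X /D; field; exact: D0.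
have Y0 : Y a0 = 0 by rewrite /Y /D; field; exact: D0.
have PhiE : Phi 0 0 = 1.
  by rewrite /Phi /m normr0 !mulr0 !add0r subr0 minxx; apply/max_idPr; exact: ler01.
have ha0 : h a0 = b by rewrite /h X0 Y0 PhiE /u; pt_ring.
exists h, b; split => //.
- by exists e => //; lra.
- move=> z hz.
  have N : X z < Num.min (p * X z + m (Y z)) (q * X z + m (Y z)).
    rewrite ltNge; apply/negP => /max_idPl hm; apply: hz.
    by rewrite /h /Phi hm; pt_ring.
  move: N; rewrite lt_min => /andP[N1 N2].
  have Kle : K * `|Y z| <= 1.
    rewrite /m in N1 N2.
    by have [x0|x0] := leP 0 (X z); nra.
  have KY0 : 0 <= K * `|Y z| by rewrite mulr_ge0// ltW.
  have xu : X z < 1 + rho.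
    have : (1 - p) * X z < 1 by rewrite /m in N1; lra.
    have -> : 1 - p = (1 + rho)^-1 by rewrite /p; field; lra.
    by rewrite mulrC ltr_pdivrMr; lra.
  have xl : - rho < X z.
    have : -1 < (q - 1) * X z by rewrite /m in N2; lra.
    have -> : q - 1 = rho^-1 by rewrite /q; field; lra.
    by rewrite mulrC ltr_pdivlMr; lra.
  have yb : `|Y z| <= rho / 2.
    have : `|Y z| <= 1 / K by rewrite ler_pdivlMr// mulrC.
    have -> : 1 / K = rho * (1 + rho) / 4 by rewrite /K /p /e; field; lra.
    by nra.
  pose x' := clamp (X z).
  exists (a0 + x' *: (a1 - a0)); first by exists x' => //; exact: clamp_itv.
  have -> : z - (a0 + x' *: (a1 - a0)) = (X z - x') *: (a1 - a0) + (Y z - e * X z) *: w.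
    by rewrite {1}(coord z) /u /b; pt_ring.
  apply: (le_trans (ler_normD _ _)); rewrite !normrZ.
  have d1 : `|X z - x'| <= rho.
    rewrite /x'; have [x0|x0] := leP (X z) 0.
      by rewrite clamp_le0// subr0 ler_norml; lra.
    have [x1|x1] := leP 1 (X z); first by rewrite clamp_ge1// ler_norml; lra.
    by rewrite clamp_id ?subrr ?normr0; lra.
  have d2 : `|Y z - e * X z| <= rho.
    apply: (le_trans (ler_normB _ _)).
    have : `|e * X z| <= rho / 2 by rewrite ler_norml; nra.
    by lra.
  have n1 := normr_ge0 (a1 - a0); have n2 := normr_ge0 (a2 - a1).
  by rewrite -/w in n2 *; nra.
- move=> z [s hs E].
  have E2 : h z = a0 + 1 *: u + (s * (1 + e)) *: w by rewrite E /u /b /w; pt_ring.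
  have YW y : Y (a0 + 1 *: u + y *: w) = y.
    rewrite /Y /u /b /w /= !scaleRE; move: D0; rewrite /D => D0; field; exact: D0.
  have XW y : X (a0 + 1 *: u + y *: w) = 1.
    rewrite /X /u /b /w /= !scaleRE; move: D0; rewrite /D => D0; field; exact: D0.
  pose y := s * (1 + e).
  have y0 : 0 <= y by rewrite mulr_ge0; lra.
  have y1 : y <= 1 + e by rewrite /y; nra.
  have Yz : Y z = y by rewrite -Yh E2 YW.
  have Xz : X z = Psi 1 y.
    have [_ _ k _] := inv y.
    by rewrite -[LHS](k (X z)) -Yz -Xh E2 XW.
  (* The preimage of the upright segment: the segment [a0 a1] up to height [e], the segment [a1 a2]
     above. *)
  have {}Xz : X z = Num.min 1 (y / e).
    rewrite Xz /Psi /m (ger0_norm y0); congr Num.min.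
    have -> : 1 - (1 - K * y) = K * y by ring.
    have -> : K * y / p = y / e by rewrite /K; field; rewrite !gt_eqF.
    apply/max_idPl.
    have -> : y / e = K * y / p by rewrite /K; field; rewrite !gt_eqF.
    by apply: ler_wpM2l; [rewrite mulr_ge0// ltW|rewrite lef_pV2 ?posrE; lra].
  have [ye|ye] := leP y e.
    left; exists (y / e); first by rewrite divr_ge0 ?ler_pdivrMr//; lra.
    have {}Xz : X z = y / e by rewrite Xz; apply/min_idPr; rewrite ler_pdivrMr; lra.
    have ey : y = e * (y / e) by field; rewrite gt_eqF.
    by rewrite {1}(coord z) Xz Yz {2}ey /u /b; pt_ring.
  right; exists (y - e); first lra.
  have {}Xz : X z = 1 by rewrite Xz; apply/min_idPl; rewrite ler_pdivlMr; lra.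
  by rewrite {1}(coord z) Xz Yz /u /b /w; pt_ring.
Qed.

End Homeo.

Section Straighten.
Variable R : realType.
Notation pt := (R * R)%type.
Implicit Types (h : pt -> pt) (F : set pt) (l : seq pt).

Fixpoint psimple l : Prop :=
  match l with
  | a :: ((b :: _) as l') =>
    [/\ a <> b, forall z, seg a b z -> polyline l' z -> z = b & psimple l']
  | _ => True
  end.

Lemma simple_psimple (l : seq (R * pt)) : simple l -> psimple (map snd l).
Proof. by elim: l => // a [|b l] // IH [_ h1 h2 /IH h3]; split. Qed.

Lemma polyline_last a l : polyline (a :: l) (last a l).
Proof. by apply: polyline_mem; exact: mem_last. Qed.

Lemma seg_collinear (a0 a1 a2 : pt) :
  (a1.1 - a0.1) * (a2.2 - a1.2) - (a1.2 - a0.2) * (a2.1 - a1.1) = 0 ->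
  a0 <> a1 -> a1 <> a2 -> (forall z, seg a0 a1 z -> seg a1 a2 z -> z = a1) ->
  forall z, seg a0 a2 z -> seg a0 a1 z \/ seg a1 a2 z.
Proof.
move=> D0 n01 n12 H.
have [la Ela] : exists la : R, a2 - a1 = la *: (a1 - a0).
  have [E1|n1] := eqVneq (a1.1 - a0.1) 0.
    have n2 : a1.2 - a0.2 != 0.
      by apply/eqP => E2; apply: n01; apply: pt_ext; lra.
    exists ((a2.2 - a1.2) / (a1.2 - a0.2)); apply: pt_ext; rewrite /= !scaleRE; last by field.
    move/eqP: D0; rewrite E1 mul0r sub0r oppr_eq0 mulf_eq0 (negbTE n2) /= => /eqP ->.
    by rewrite mulr0.
  exists ((a2.1 - a1.1) / (a1.1 - a0.1)); apply: pt_ext; rewrite /= !scaleRE; first by field.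
  apply: (mulfI n1); have -> : (a1.1 - a0.1) * (a2.2 - a1.2) = (a1.2 - a0.2) * (a2.1 - a1.1) by lra.
  by field.
have la0 : 0 < la.
  rewrite ltNge; apply/negP => la0.
  pose s := if la <= -1 then - la^-1 else 1.
  have [hs hs'] : 0 < s <= 1 /\ -1 <= s * la.
    rewrite /s; case: ifP => h.
      have ln : la != 0 by apply/eqP; lra.
      rewrite mulNr mulVf//; split => //; rewrite oppr_gt0 invr_lt0 lerNl.
      have l0 : la < 0 by lra.
      by rewrite l0 /= -[leLHS]invrN1 lef_nV2 ?negrE//; lra.
    by split; lra.
  have /H E : seg a0 a1 (a1 + s *: (a2 - a1)).
    exists (1 + s * la); first by have : s * la <= 0; [nra|lra].
    by rewrite Ela; pt_ring.
  have : a1 + s *: (a2 - a1) = a1 by apply: E; exists s => //; lra.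
  move=> E2; apply: n12; have : s *: (a2 - a1) = 0.
    have -> : s *: (a2 - a1) = a1 + s *: (a2 - a1) - a1 by pt_ring.
    by rewrite E2 subrr.
  move/eqP; rewrite scaler_eq0 gt_eqF /=; last lra.
  by rewrite subr_eq0 => /eqP.
move=> z [x hx ->].
have [h|h] := leP (x * (1 + la)) 1.
  left; exists (x * (1 + la)); first by nra.
  have -> : a2 - a0 = (a2 - a1) + (a1 - a0) by pt_ring.
  by rewrite Ela; pt_ring.
right; exists ((x * (1 + la) - 1) / la); first by rewrite divr_ge0 ?ler_pdivrMr//; nra.
have -> : a2 - a0 = (a2 - a1) + (a1 - a0) by pt_ring.
rewrite Ela; apply: pt_ext; rewrite /= !scaleRE; field; lra.
Qed.

(** Corners are removed one at a time from the front. The homeomorphism of a corner is supported so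
    close to the first segment that [F] and the path from [a2] on stay fixed, and the start moves to
    the prolongation of the second segment beyond [a1]. Since the final segment pulls back into the
    path, whatever meets the segment met the path before. *)
Lemma straighten_path l a0 F : closed F -> psimple (a0 :: l) -> l <> [::] ->
  (forall z, polyline (a0 :: l) z -> F z -> z = last a0 l) ->
  exists h, [/\ plhomeo h, h a0 <> last a0 l, forall z, F z -> h z = z,
    forall z, seg (h a0) (last a0 l) (h z) -> polyline (a0 :: l) z
    & forall z, seg (h a0) (last a0 l) z -> F z -> z = last a0 l].
Proof.
move En : (size l) => n; elim: n l a0 F En => [|n IH] l a0 F; first by case: l.
case: l => [//|a1 [|a2 l]] /= En cF.
  move=> [n01 _ _] _ H; exists id; split => //; first exact: plhomeo_id.
    by move=> z h; left.
  by move=> z h; apply: H; left.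
move=> [n01 s01 [n12 s12 sl]] _ H; set q := last a2 l.
have n1 : ~ polyline (a2 :: l) a1 by move=> /(s12 _ (seg_l _ _)).
have n02 : a0 <> a2.
  move=> E; apply: n01; apply: s01; first exact: seg_l.
  by right; rewrite E; exact: polyline_head.
have [D0|D0] := eqVneq ((a1.1 - a0.1) * (a2.2 - a1.2) - (a1.2 - a0.2) * (a2.1 - a1.1)) 0.
  have s02 : forall z, seg a0 a2 z -> seg a0 a1 z \/ seg a1 a2 z.
    by apply: seg_collinear => // z h1 h2; apply: s01 => //; left.
  have [|||||h [h1 h2 h3 h4 h5]] := IH (a2 :: l) a0 F.
  - by case: En.
  - exact: cF.
  - split => // z /s02 [h|h] hz; last exact: s12.
    by exfalso; apply: n1; have <- : z = a1 by apply: s01 => //; right.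
  - by [].
  - move=> z [/s02 [h|h]|h] Fz; apply: H => //; [by left|by right; left|by right; right].
  - exists h; split => // z /h4 [/s02 [h'|h']|h']; [by left|by right; left|by right; right].
pose F' := F `|` polyline (a2 :: l).
have cF' : closed F' by apply: closedU => //; exact: polyline_closed.
have dis z : seg a0 a1 z -> ~ F' z.
  move=> hz [Fz|pz].
    have Ez : z = q by apply: H => //; left.
    have pq : polyline (a2 :: l) q by exact: polyline_last.
    have : z = a1 by apply: s01 => //; right; rewrite Ez.
    by move=> E; apply: n1; rewrite -E Ez.
  by apply: n1; have <- : z = a1 by apply: s01 => //; right.
have [d d0 Hd] := compact_closed_sep (@seg_compact R a0 a1) cF' dis.
pose N := `|a1 - a0| + `|a2 - a1|.
have N0 : 0 <= N by rewrite addr_ge0.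
pose rho := Num.min 1 (d / (2 * (N + 1))).
have rho0 : 0 < rho by rewrite lt_min ltr01 divr_gt0//; lra.
have rho1 : rho <= 1 by rewrite ge_min lexx.
have rhod : 2 * rho * N < d.
  have : rho * (2 * (N + 1)) <= d by rewrite -ler_pdivlMr; [rewrite ge_min lexx orbT|lra].
  by clear En; nra.
have hr : 0 < rho <= 1 by rewrite rho0.
have [h1 [b [ph1 hb [e he Eb] supp hseg]]] := straighten_corner hr D0.
have fix1 z : F' z -> h1 z = z.
  move=> Fz; apply: contrapT => /supp[y sy]; have := Hd y z sy Fz.
  by rewrite -normrN opprB -/N; lra.
have bseg z : seg b a2 z -> seg b a1 z \/ seg a1 a2 z.
  move=> [x hx ->]; have [h|h] := leP (x * (1 + e)) e.
    left; exists (x * (1 + e) / e); first by clear En; rewrite divr_ge0 ?ler_pdivrMr; nra.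
    have en0 : e != 0 by rewrite gt_eqF//; case/andP: he.
    by rewrite Eb; apply: pt_ext; rewrite /= !scaleRE; field.
  right; exists (x * (1 + e) - e); first by clear En; nra.
  by rewrite Eb; pt_ring.
have bdis z : seg b a1 z -> ~ F' z.
  move=> [x hx Ez] Fz; have := Hd a1 z (seg_r _ _) Fz.
  have -> : a1 - z = (e * (1 - x)) *: (a2 - a1) by rewrite Ez Eb; pt_ring.
  rewrite normrZ ger0_norm; last by clear En; nra.
  clear En; have hA := normr_ge0 (a2 - a1); have hB := normr_ge0 (a1 - a0).
  have ex : e * (1 - x) <= rho by nra.
  have := ler_wpM2r hA ex; rewrite /N in rhod; have := mulr_ge0 (ltW rho0) hB; nra.
have [|||||h [h2 h3 h4 h5 h6]] := IH (a2 :: l) b F.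
- by case: En.
- exact: cF.
- split => //.
    move=> E; apply: n12; have : (1 + e) *: (a2 - a1) = 0.
      have -> : (1 + e) *: (a2 - a1) = a2 - b by rewrite Eb; pt_ring.
      by rewrite E subrr.
    by move/eqP; rewrite scaler_eq0 gt_eqF /=; [rewrite subr_eq0 => /eqP|lra].
  by move=> z /bseg [h|h] pz; [case: (bdis z h); right|exact: s12].
- by [].
- move=> z [/bseg [h|h]|h] Fz; first by case: (bdis z h); left.
    by apply: H => //; right; left.
  by apply: H => //; right; right.
exists (fun z => h (h1 z)); rewrite hb; split => //.
- exact: plhomeo_comp.
- by move=> z Fz; rewrite fix1 ?h4//; left.
- move=> z /h5 [/hseg[]|]; [by left|by right; left|move=> pz; right; right].
  have : h1 (h1 z) = h1 z by apply: fix1; right.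
  by move=> /(plhomeo_inj ph1) <-.
Qed.

End Straighten.

(** * An axis that most edges meet few times *)

Section Pieces.
Variable R : realType.
Notation pt := (R * R)%type.
Implicit Types (a b t : R) (s : seq R) (c : R -> pt).

Fixpoint pieces a s : seq (R * R) :=
  if s is b :: s' then (a, b) :: pieces b s' else [::].

Lemma breaks_path c a s : breaks c a s -> path <%R a s.
Proof. by elim: s a => //= b s IH a [-> _ /IH]. Qed.

Lemma piecesP a s x y : path <%R a s -> (x, y) \in pieces a s ->
  [/\ a <= x, x < y & y <= last a s].
Proof.
elim: s a => //= b s IH a /andP[ab pb]; have := path_last pb => bl.
by rewrite inE => /orP[/eqP[-> ->]|/(IH _ pb)[h1 h2 h3]]; split => //; lra.
Qed.

Lemma pieces_affine c a s x y : breaks c a s -> (x, y) \in pieces a s ->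
  exists p v : pt, forall t, x <= t <= y -> c t = p + t *: v.
Proof.
elim: s a => //= b s IH a [_ H B]; rewrite inE => /orP[/eqP[-> ->] //|].
exact: IH.
Qed.

Lemma pieces_cover a s t : path <%R a s -> a < t < last a s ->
  exists x y, (x, y) \in pieces a s /\ x <= t <= y.
Proof.
elim: s a => [|b s IH] a /=; first by lra.
move=> /andP[ab pb] ht; have [h2|h2] := leP t b.
  by exists a, b; rewrite inE eqxx; split => //; lra.
have [|x [y [i h]]] := IH b pb; first lra.
by exists x, y; rewrite inE i orbT.
Qed.

Lemma pieces_overlap a s x y x' y' t : path <%R a s ->
  (x, y) \in pieces a s -> (x', y') \in pieces a s ->
  x <= t <= y -> x' <= t <= y' -> (t == x) = (t == x') -> (x, y) = (x', y').
Proof.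
elim: s a => //= b s IH a /andP[ab pb].
have low u v : (u, v) \in pieces b s -> b <= u /\ u < v by move=> /(piecesP pb)[].
rewrite !inE => /orP[/eqP[-> ->]|h] /orP[/eqP[-> ->]|h'] // ht ht' E.
- have [? ?] := low _ _ h'; have tb : t = x' by lra.
  by exfalso; move: E; rewrite tb eqxx => /eqP; lra.
- have [? ?] := low _ _ h; have tb : t = x by lra.
  by exfalso; move: E; rewrite tb eqxx => /esym/eqP; lra.
- exact: (IH b pb h h').
Qed.

Lemma pieces_uniq a s : path <%R a s -> uniq (pieces a s).
Proof.
elim: s a => //= b s IH a /andP[ab pb]; rewrite IH// andbT.
by apply/negP => /(piecesP pb)[]; lra.
Qed.

(* Near a segment that a polygonal curve meets [N] times, a slightly rotated
   segment is met at most once per linear piece touching the original. *)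
Lemma few_side_times c N : plc c ->
  (forall l : seq R, uniq l ->
    (forall t, t \in l -> [/\ 0 < t < 1, (c t).1 = 0 & 0 <= (c t).2 <= 1]) -> (size l <= N)%N) ->
  exists2 e0 : R, 0 < e0 & forall de : R, 0 < de < e0 -> forall l : seq R, uniq l ->
    (forall t, t \in l -> [/\ 0 < t < 1, (c t).1 = de * (c t).2 & 0 < (c t).2 < 1]) ->
    (size l <= 2 * N + 2)%N.
Proof.
move=> pc bN.
have [s [Bs ls]] := plc_breaks pc (@ler01 R); have ps := breaks_path Bs.
have cc := plc_continuous pc.
pose meets (m : R * R) := exists t, [/\ m.1 <= t <= m.2, (c t).1 = 0 & 0 <= (c t).2 <= 1].
pose M := [seq m <- pieces 0 s | `[< meets m >]].
have [e0 e00 He0] : exists2 e0 : R, 0 < e0 & forall m, m \in pieces 0 s ->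
   (~ meets m -> forall de t, 0 < de < e0 -> m.1 <= t <= m.2 -> (c t).1 = de * (c t).2 -> ~ (0 < (c t).2 < 1)) /\
   (meets m -> forall de t t', 0 < de < e0 -> m.1 <= t <= m.2 -> m.1 <= t' <= m.2 ->
      (c t).1 = de * (c t).2 -> (c t').1 = de * (c t').2 -> 0 < (c t).2 < 1 -> t = t').
  apply: small_seq => [m d d' hd [h1 h2]|[a b] im].
    split; [move=> nm de t hde|move=> mm de t t' hde]; [apply: h1|apply: h2] => //; lra.
  have [a0 ab b1] := piecesP ps im.
  have [mm|nm] := pselect (meets (a, b)); last first.
    pose K := `[a, b] `&` [set t | 0 <= (c t).2 <= 1].
    have cK : compact K.
      apply: (subclosed_compact _ (@segment_compact R a b)); last by move=> ? [].
      apply: closedI; first exact: itv_closed.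
      have -> : [set t | 0 <= (c t).2 <= 1] = (fun t => (c t).2) @^-1` `[0, 1]%classic.
        by apply/seteqP; split => t /=; rewrite in_itv.
      by apply: closed_comp; [move=> x _; exact: cont_snd|exact: itv_closed].
    have [K0|/set0P K0] := eqVneq K set0.
      exists 1 => //; split => // _ de t _ ht _ h.
      by have : K t by [split; rewrite /= ?in_itv //=; lra]; rewrite K0.
    have cf : continuous (fun t => `|(c t).1|) by apply: cont_norm; exact: cont_fst.
    have [t0] := compact_EVT_min K0 cK (continuous_subspaceT cf).
    rewrite inE => -[/=]; rewrite in_itv /= => ht0 h0 Hmin.
    exists `|(c t0).1|.
      by rewrite normr_gt0; apply/eqP => E; apply: nm; exists t0.
    split => // _ de t hde ht E h; have := Hmin t; rewrite inE => /(_ _).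
    have -> : `|(c t).1| = de * (c t).2 by rewrite E ger0_norm//; nra.
    suff Kt : K t by move=> /(_ Kt); nra.
    by split; rewrite /= ?in_itv //=; lra.
  have [p [v Hpv]] := pieces_affine Bs im.
  (* A linear piece that meets a rotated line twice lies on it. If it lies on the line of some slope
     [ds], smaller slopes are safe; otherwise all slopes are. *)
  have [[ds [ds0 [Hds [tz htz ntz]]]]|nds] := pselect (exists ds : R, 0 < ds /\
     (forall t, a <= t <= b -> (c t).1 = ds * (c t).2) /\ exists2 t, a <= t <= b & (c t).2 <> 0).
    exists ds => //; split => // _ de t t' hde ht ht' E E' h /=.
    have := Hds t ht; rewrite E => E2; exfalso; nra.
  exists 1 => //; split => // _ de t t' hde ht ht' E E' h.
  apply: contrapT => ntt; apply: nds; exists de; split; first by lra.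
  move: E E'; rewrite !Hpv// /= !scaleRE => E E'.
  have Ev : v.1 = de * v.2.
    have : (t - t') * (v.1 - de * v.2) = 0 by lra.
    move/eqP; rewrite mulf_eq0 => /orP[/eqP ?|/eqP ?]; last lra.
    by exfalso; apply: ntt; lra.
  split; last by exists t => //; lra.
  move=> u hu; rewrite Hpv//= !scaleRE.
  have Ep : p.1 = de * p.2 by rewrite Ev in E; lra.
  by rewrite Ev Ep; ring.
have sM : (size M <= 2 * N + 2)%N.
  have /choice[tm Htm] : forall m, exists t, meets m -> [/\ m.1 <= t <= m.2, (c t).1 = 0 & 0 <= (c t).2 <= 1].
    move=> m; have [[t ht]|nm] := pselect (meets m); first by exists t.
    by exists 0.
  have MP m : m \in M -> m \in pieces 0 s /\ [/\ m.1 <= tm m <= m.2, (c (tm m)).1 = 0 & 0 <= (c (tm m)).2 <= 1].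
    by rewrite mem_filter => /andP[/asboolP/Htm ? ?].
  (* At most two pieces share a meeting time: one that starts there and one that does not. This is
     the factor 2. *)
  pose f m := (tm m, tm m == m.1).
  have finj : {in M &, injective f}.
    move=> [x y] [x' y'] /MP[i [h _ _]] /MP[i' [h' _ _]] [E1 E2].
    by apply: (pieces_overlap ps i i' h); [rewrite E1|move: E2; rewrite /= -E1].
  pose T := undup [seq t <- map tm M | 0 < t < 1].
  have sT : (size T <= N)%N.
    apply: bN; first exact: undup_uniq.
    move=> t; rewrite mem_undup mem_filter => /andP[ht /mapP[m /MP[_ [_ h1 h2]] Et]].
    by rewrite Et in ht *; split.
  have -> : size M = size (map f M) by rewrite size_map.
  (* The end times 0 and 1 are not counted by [N], but the first and the last piece may meet the
     segment there: the summand 2. *)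
  pose B := [seq (t, true) | t <- T] ++ [seq (t, false) | t <- T] ++ [:: (0, true); (1, false)].
  have : (size (map f M) <= size B)%N.
    apply: uniq_leq_size; first by rewrite map_inj_in_uniq// filter_uniq// pieces_uniq.
    move=> _ /mapP[m mM ->]; have [im [hm _ _]] := MP m mM.
    have := im; rewrite [m in m \in _]surjective_pairing => /(piecesP ps)[h1 h2 h3]; rewrite ls in h3.
    rewrite !mem_cat /f.
    have [t01|nt01] := boolP (0 < tm m < 1).
      have tT : tm m \in T by rewrite mem_undup mem_filter t01 map_f.
      by case: (tm m == m.1); rewrite (map_f (pair^~ _)) ?orbT.
    have [E0|/eqP N0] := eqVneq (tm m) 0.
      have -> : tm m == m.1 by apply/eqP; lra.
      by rewrite E0 !inE eqxx !orbT.
    have E1 : tm m = 1.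
      by apply: contrapT => N1; move/negP: nt01; apply; lra.
    have /negbTE -> : tm m != m.1 by apply/eqP; lra.
    by rewrite E1 !inE eqxx !orbT.
  by move=> h; apply: (leq_trans h); rewrite !size_cat !size_map /= addnA addnn -mul2n leq_add2r leq_mul2l.
exists e0 => // de hde l ul Hl; apply: leq_trans sM.
have /choice[pm Hpm] : forall t, exists m, 0 < t < 1 -> m \in pieces 0 s /\ m.1 <= t <= m.2.
  move=> t; have [ht|nt] := pselect (0 < t < 1); last by exists (0, 0).
  have [|x [y [i h]]] := pieces_cover ps (t := t); first by rewrite ls.
  by exists (x, y).
have -> : size l = size (map pm l) by rewrite size_map.
have lM t : t \in l -> meets (pm t).
  move=> tl; have [ht E h] := Hl t tl; have [im hm] := Hpm t ht.
  apply: contrapT => nm; have [/(_ nm) h1 _] := He0 _ im.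
  exact: (h1 de t hde hm E h).
apply: uniq_leq_size.
  rewrite map_inj_in_uniq// => t t' tl tl' Epm.
  have [ht E h] := Hl t tl; have [ht' E' h'] := Hl t' tl'.
  have [im hm] := Hpm t ht; have [im' hm'] := Hpm t' ht'.
  have [_ /(_ (lM t tl)) H] := He0 _ im; rewrite -Epm in hm'.
  exact: (H de t t').
move=> _ /mapP[t tl ->]; rewrite mem_filter; apply/andP; split.
  by apply/asboolP; exact: lM.
by have [ht _ _] := Hl t tl; have [] := Hpm t ht.
Qed.

End Pieces.

(** * Detour of the axis through a vertex *)

Section Tent.
Variable R : realType.
Notation pt := (R * R)%type.

Lemma plhomeo_shear_x (ka : R) : plhomeo (fun z : pt => (z.1 + ka * z.2, z.2)).
Proof.
have cont (k : R) : continuous (fun z : pt => (z.1 + k * z.2, z.2) : pt).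
  apply: cont_pair; last by apply: cont_snd; exact: cont_id.
  apply: cont_add; first by apply: cont_fst; exact: cont_id.
  by apply: cont_mul; [exact: cont_cst|apply: cont_snd; exact: cont_id].
split => //.
- exists (fun z : pt => (z.1 + (- ka) * z.2, z.2)); split => //.
    by move=> z; apply: pt_ext => //=; ring.
  by move=> z; apply: pt_ext => //=; ring.
- by move=> c [c1 c2]; split => //=; apply: plf_add => //; exact: plf_scale.
Qed.

Lemma plhomeo_shear_y (f : R -> R) : continuous f -> (forall g, plf g -> plf (fun t => f (g t))) ->
  plhomeo (fun z : pt => (z.1, z.2 - f z.1)).
Proof.
move=> cf pf; have c1 : continuous (fun z : pt => f z.1).
  by apply: cont_comp cf; apply: cont_fst; exact: cont_id.
have cfst : continuous (fun z : pt => z.1) by apply: cont_fst; exact: cont_id.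
have csnd : continuous (fun z : pt => z.2) by apply: cont_snd; exact: cont_id.
split.
- by apply: cont_pair => //; exact: cont_sub.
- exists (fun z : pt => (z.1, z.2 + f z.1)); split.
  + by apply: cont_pair => //; exact: cont_add.
  + by move=> z; apply: pt_ext => //=; ring.
  + by move=> z; apply: pt_ext => //=; ring.
- by move=> c [h1 h2]; split => //=; apply: plf_sub => //; exact: pf.
Qed.

(** A horizontal shear moves [v] over or under the middle of [x0 + e, x0 + 2e], and subtracting a
    tent on this interval brings it to height 0. The preimage of the axis replaces the interval by
    the other two sides of the triangle with apex [v]: the third case, [de] telling the sides
    apart. *)
Lemma tent_homeo (v : pt) (x0 e : R) : v.2 != 0 -> 0 < e ->
  exists h, [/\ plhomeo h, (h v).2 = 0,
    forall z, z.2 = 0 -> ~ (x0 + e < z.1 < x0 + 2 * e) -> (h z).2 = 0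
    & forall z, (h z).2 = 0 -> [\/ z.2 = 0, z = v |
       exists2 de : R, de = e \/ de = 2 * e &
         z.1 - x0 - (v.1 - x0) * (z.2 / v.2) = de * (1 - z.2 / v.2) /\ 0 < 1 - z.2 / v.2 < 1]].
Proof.
move=> v0 e0.
pose ka := (x0 + 3 / 2 * e - v.1) / v.2.
pose w x := (x - (x0 + 3 / 2 * e)) / (e / 2).
pose f x := v.2 * Num.max 0 (1 - `|w x|).
have cw : continuous w.
  apply: cont_mul; last exact: cont_cst.
  by apply: cont_sub; [exact: cont_id|exact: cont_cst].
have cf : continuous f.
  apply: cont_mul; first exact: cont_cst.
  apply: cont_max; first exact: cont_cst.
  by apply: cont_sub; [exact: cont_cst|exact: cont_norm].
have pf g : plf g -> plf (fun t => f (g t)).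
  move=> pg; apply: plf_scale; apply: plf_max; first exact: plf_cst.
  apply: plf_sub; first exact: plf_cst.
  apply: plf_abs; apply: (plf_ext _ (plf_scale (e / 2)^-1 (plf_sub pg (plf_cst (x0 + 3 / 2 * e))))).
  by move=> t; rewrite /w mulrC.
exists (fun z => (z.1 + ka * z.2, z.2 - f (z.1 + ka * z.2))); split.
- exact: (plhomeo_comp (plhomeo_shear_x ka) (plhomeo_shear_y cf pf)).
- rewrite /=; have -> : v.1 + ka * v.2 = x0 + 3 / 2 * e by rewrite /ka; field.
  rewrite /f /w subrr mul0r normr0 subr0.
  by have -> : Num.max (0 : R) 1 = 1 by [apply/max_idPr; exact: ler01]; ring.
- move=> z E N /=; rewrite E mulr0 addr0 /f; apply/eqP; rewrite subr_eq0 eq_sym mulf_eq0; apply/orP; right.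
  apply/eqP/max_idPl; rewrite subr_le0 /w normrM [`|(e / 2)^-1|]ger0_norm; last by rewrite invr_ge0; lra.
  rewrite ler_pdivlMr; last lra.
  rewrite mul1r; have [h|h] := leP z.1 (x0 + e); first by rewrite ltr0_norm; lra.
  have h2 : x0 + 2 * e <= z.1 by rewrite leNgt; apply/negP => h2; apply: N; rewrite h h2.
  by rewrite gtr0_norm; lra.
- move=> z /= Ez; have [z0|z0] := eqVneq z.2 0; first exact: Or31.
  pose la := z.2 / v.2.
  have zE : z.2 = la * v.2 by rewrite /la; field.
  have laE : la = Num.max 0 (1 - `|w (z.1 + ka * z.2)|).
    apply: (mulfI v0); rewrite mulrC -zE; move/eqP: Ez; rewrite subr_eq0 => /eqP Ez.
    exact: Ez.
  have la0 : la != 0 by rewrite /la mulf_eq0 invr_eq0 (negbTE z0).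
  have kaE : ka * z.2 = (x0 + 3 / 2 * e - v.1) * la by rewrite /ka /la; field.
  have {}laE : la = 1 - `|w (z.1 + ka * z.2)| /\ 0 < la.
    have [h|h] := leP (1 - `|w (z.1 + ka * z.2)|) 0.
      by exfalso; move/eqP: la0; apply; rewrite laE; apply/max_idPl.
    have E : la = 1 - `|w (z.1 + ka * z.2)| by rewrite laE; apply/max_idPr; exact: ltW.
    by split => //; rewrite E.
  have [lE l0] := laE.
  have wle : 0 <= `|w (z.1 + ka * z.2)| by [].
  have [l1|l1] := eqVneq la 1.
    apply: Or32; apply: pt_ext; last by rewrite zE l1 mul1r.
    have : w (z.1 + ka * z.2) = 0 by apply/eqP; rewrite -normr_eq0; apply/eqP; lra.
    move/eqP; rewrite /w mulf_eq0 invr_eq0 => /orP[|] /eqP; last lra.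
    by rewrite kaE l1; lra.
  apply: Or33; rewrite -/la.
  have wE : w (z.1 + ka * z.2) * (e / 2) = z.1 + ka * z.2 - (x0 + 3 / 2 * e).
    by rewrite /w; field; lra.
  have l1' : la < 1 by rewrite lt_neqAle l1; lra.
  have [h|h] := leP 0 (w (z.1 + ka * z.2)).
    exists (2 * e); [by right|split; last lra].
    rewrite ger0_norm// in lE.
    have : (1 - la) * (e / 2) = z.1 + ka * z.2 - (x0 + 3 / 2 * e) by rewrite -wE; congr (_ * _); lra.
    by rewrite kaE; lra.
  exists e; [by left|split; last lra].
  rewrite ltr0_norm// in lE.
  have : (la - 1) * (e / 2) = z.1 + ka * z.2 - (x0 + 3 / 2 * e) by rewrite -wE; congr (_ * _); lra.
  by rewrite kaE; lra.
Qed.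

End Tent.

(** * A path from a vertex to the axis along at most two edges *)

Section PathsIn.
Variable R : realType.
Notation pt := (R * R)%type.
Implicit Types (W : set pt) (x y z : pt) (l : seq pt).

Definition path_in W x y : Prop := exists l, last x l = y /\ polyline (x :: l) `<=` W.

Lemma path_in_sub W W' x y : W `<=` W' -> path_in W x y -> path_in W' x y.
Proof. by move=> WW' [l [h1 h2]]; exists l; split => // z /h2 /WW'. Qed.

Lemma path_in_trans W x y z : path_in W x y -> path_in W y z -> path_in W x z.
Proof.
move=> [l [<- hl]] [m [<- hm]]; exists (l ++ m); rewrite last_cat; split => // u.
elim: l x hl hm => [|a l IH] x hl hm /=; first exact: hm.
move=> [h|h]; first by apply: hl; left.
by apply: (IH a) => // w hw; apply: hl; right.
Qed.

Lemma path_in_refl W x : W x -> path_in W x x.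
Proof. by move=> Wx; exists [::]; split => // z ->. Qed.

Lemma path_in_seg W x y : seg x y `<=` W -> path_in W x y.
Proof. by move=> h; exists [:: y]; split => // z [/h//|->]; apply: h; exact: seg_r. Qed.

Lemma plc_rev (c : R -> pt) : plc c -> plc (fun t => c (- t)).
Proof.
have rev (f : R -> R) : plf f -> plf (fun t => f (- t)).
  move=> [f1 f2]; split => // t; apply: (rgerm_ext ltr01 _ (f1 t)) => s _.
  by rewrite opprK.
by move=> [/rev c1 /rev c2].
Qed.

Lemma path_in_curve (c : R -> pt) a b : plc c -> a <= b ->
  path_in [set z | exists2 t, a <= t <= b & z = c t] (c a) (c b).
Proof.
move=> pc ab; have [s [Bs ls]] := plc_breaks pc ab.
exists (map c s); rewrite last_map ls; split => //.
by move=> z /(breaks_poly Bs); rewrite ls.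
Qed.

Lemma path_in_curve_rev (c : R -> pt) a b : plc c -> a <= b ->
  path_in [set z | exists2 t, a <= t <= b & z = c t] (c b) (c a).
Proof.
move=> pc ab; have ba : - b <= - a by lra.
have := path_in_curve (plc_rev pc) ba; rewrite !opprK; apply: path_in_sub.
by move=> z /= [t ht ->]; exists (- t) => //; lra.
Qed.

(** Artificial times, since loop erasure works on lists ordered by time. *)
Fixpoint timed (x : R) l : seq (R * pt) :=
  if l is a :: l' then (x, a) :: timed (x + 1) l' else [::].

Lemma path_in_simple W x y : path_in W x y ->
  exists l, [/\ last x l = y, psimple (x :: l) & polyline (x :: l) `<=` W].
Proof.
move=> [l [hl sl]].
have sndE t m : map snd (timed t m) = m by elim: m t => //= a m IH t; rewrite IH.
have pth t a m : path (fun u v : R * pt => u.1 < v.1) (t, a) (timed (t + 1) m).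
  by elim: m t a => //= b m IH t a; rewrite IH andbT; lra.
have tin (m : seq (R * pt)) : segs_in (fun=> setT) m by elim: m => // a [|b m] // IH.
have lastE t a m : (last (t, a) (timed (t + 1) m)).2 = last a m.
  by elim: m t a => //= b m IH t a; rewrite IH.
have [b [l' [[sb _] eb _ lb sub]]] := loop_erasure (pth 0 x l) (tin ((0, x) :: timed (0 + 1) l)).
have eb' : map snd (b :: l') = x :: map snd l' by rewrite /= eb.
exists (map snd l'); split.
- have xb : x = b.2 by rewrite eb.
  by rewrite -hl -(lastE 0 x l) -lb {1}xb last_map.
- by rewrite -eb'; exact: simple_psimple.
- move=> z; rewrite -eb' => /sub; rewrite /= sndE; exact: sl.
Qed.

Lemma first_time (g : R -> pt) (K : set pt) (a b : R) : continuous g -> closed K -> a <= b -> K (g b) ->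
  exists t, [/\ a <= t <= b, K (g t) & forall s, a <= s <= b -> K (g s) -> t <= s].
Proof.
move=> cg cK ab Kb.
have cg' : continuous (fun u : R => g (a + u * (b - a))).
  apply: cont_comp cg; apply: cont_add; first exact: cont_cst.
  by apply: cont_mul; [exact: cont_id|exact: cont_cst].
have [|u [hu Ku minu]] := first_hit cg' cK; first by have -> : a + 1 * (b - a) = b by ring.
exists (a + u * (b - a)); split => //; first by nra.
move=> s hs Ks; have [E|ab'] := eqVneq a b; first by subst b; nra.
have ba : 0 < b - a by rewrite subr_gt0 lt_neqAle ab'.
have : u <= (s - a) / (b - a).
  apply: minu; first by rewrite divr_ge0 ?ler_pdivrMr//; lra.
  by have -> : a + (s - a) / (b - a) * (b - a) = s by [field; rewrite gt_eqF].
by rewrite ler_pdivlMr//; lra.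
Qed.

Lemma last_time (g : R -> pt) (K : set pt) (a b : R) : continuous g -> closed K -> a <= b -> K (g a) ->
  exists t, [/\ a <= t <= b, K (g t) & forall s, a <= s <= b -> K (g s) -> s <= t].
Proof.
move=> cg cK ab Ka.
have cN : continuous (fun u : R => - u) by move=> x; apply: cvgN; exact: cvg_id.
have ba : - b <= - a by lra.
have [|t [ht Kt mt]] := first_time (cont_comp cN cg) cK ba; first by rewrite opprK.
exists (- t); split => //; first lra.
by move=> s hs Ks; have := mt (- s); rewrite opprK => /(_ _ Ks); lra.
Qed.

End PathsIn.

Section GuidePath.
Variables (R : realType) (V E : finType).
Notation pt := (R * R)%type.
Variables (k : nat) (pts : V -> pt) (c : E -> R -> pt) (src tgt : E -> V).
Hypotheses (dr : drawn k pts c src tgt) (cpl : forall e, plc (c e)).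

Let axis : set pt := [set z | z.2 = 0].
Let off_axis (f : E) : Prop := (pts (src f)).2 <> 0 \/ (pts (tgt f)).2 <> 0.

Lemma axis_closed : closed axis.
Proof.
have -> : axis = snd @^-1` [set 0] by [].
apply: closed_comp; last exact: closed_eq.
by move=> x _; exact: cvg_snd.
Qed.

(** An edge outside [G] enters [W] only by crossing an edge of [G], which allows at most k visits
    per edge of [G]. *)
Definition guided (G : {set E}) (W : set pt) : Prop :=
  forall e (t : R), e \notin G -> 0 < t < 1 -> W (c e t) ->
    exists f s, [/\ f \in G, 0 < s < 1 & c e t = c f s].

(** The point [q] may be a vertex that is already on the axis; hence the alternative [pts u = q]. *)
Definition guide (v : V) (q : pt) (G : {set E}) (W : set pt) : Prop :=
  [/\ (pts v).2 <> 0, path_in W (pts v) q, q.2 = 0 /\ (#|G| <= 2)%N,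
      (forall z, W z -> z.2 = 0 -> z = q) /\
      (forall u, W (pts u) -> u = v \/ pts u = q)
    & guided G W].

Lemma curve_guided f (W : set pt) :
  (forall z, W z -> exists2 s : R, 0 <= s <= 1 & z = c f s) -> guided [set f]%SET W.
Proof.
move=> HW e t _ ht /HW[s hs E1]; have [_ _ ce cav _] := dr.
exists f, s; rewrite inE eqxx; split => //; have [e0 e1] := ce f.
have s0 : s <> 0 by move=> s0; apply: (cav e t (src f) ht); rewrite E1 s0.
have s1 : s <> 1 by move=> s1; apply: (cav e t (tgt f) ht); rewrite E1 s1.
by lra.
Qed.

Lemma curve_vertex f u (s : R) : 0 <= s <= 1 -> c f s = pts u ->
  (s = 0 /\ u = src f) \/ (s = 1 /\ u = tgt f).
Proof.
move=> hs E1; have [pinj _ ce cav _] := dr; have [e0 e1] := ce f.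
have [s0|/eqP s0] := eqVneq s 0; first by left; split => //; apply: pinj; rewrite -E1 s0.
have [s1|/eqP s1] := eqVneq s 1; first by right; split => //; apply: pinj; rewrite -E1 s1.
by exfalso; apply: (cav f s u) => //; lra.
Qed.

(** An edge that starts or ends off the axis and reaches it is its own guide, from that end up to
    the first meeting. *)
Lemma guide_along_edge f (t : R) : off_axis f -> 0 <= t <= 1 -> (c f t).2 = 0 ->
  exists v q G W, guide v q G W.
Proof.
move=> offf ht ct; have [pinj cc ce cav _] := dr; have [e0 e1] := ce f.
have cG : (#|[set f]%SET| <= 2)%N by rewrite cards1.
have [ns|/eqP nt] : (pts (src f)).2 <> 0 \/ (pts (tgt f)).2 <> 0 by [].
  have [||T [hT KT mT]] := @first_time R (c f) axis 0 t (cc f) axis_closed => //; first lra.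
  exists (src f), (c f T), [set f]%SET, [set z | exists2 s, 0 <= s <= T & z = c f s]; split => //.
  - by rewrite -e0; apply: path_in_curve => //; lra.
  - split.
      move=> _ [s hs ->] h; have -> // : s = T.
      by have := mT s; rewrite /axis /= => /(_ _ h); lra.
    move=> u [s hs /esym E1]; have hs' : 0 <= s <= 1 by lra.
    have [[_ ->]|[s1 _]] := curve_vertex hs' E1; first by left.
    by right; rewrite -E1; congr c; lra.
  - by apply: curve_guided => z [s hs ->]; exists s => //; lra.
have [||T [hT KT mT]] := @last_time R (c f) axis t 1 (cc f) axis_closed => //; first lra.
exists (tgt f), (c f T), [set f]%SET, [set z | exists2 s, T <= s <= 1 & z = c f s]; split => //.
- exact/eqP.
- by rewrite -e1; apply: path_in_curve_rev => //; lra.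
- split.
    move=> _ [s hs ->] h; have -> // : s = T.
    by have := mT s; rewrite /axis /= => /(_ _ h); lra.
  move=> u [s hs /esym E1]; have hs' : 0 <= s <= 1 by lra.
  have [[s0 _]|[_ ->]] := curve_vertex hs' E1; last by left.
  by right; rewrite -E1; congr c; lra.
- by apply: curve_guided => z [s hs ->]; exists s => //; lra.
Qed.

Let Uset : set pt := [set z | exists i : V + E, match i with
  | inl u => (pts u).2 <> 0 /\ z = pts u
  | inr f => off_axis f /\ exists2 s : R, 0 <= s <= 1 & z = c f s end].
Let Qset : set pt := axis `|` [set z | exists f : E, ~ off_axis f /\ exists2 s : R, 0 <= s <= 1 & z = c f s].

Lemma closed_fin (I : finType) (A : I -> set pt) : (forall i, closed (A i)) ->
  closed [set z | exists i, A i z].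
Proof.
move=> cA; have -> : [set z | exists i, A i z] = \bigcup_(i in setT) A i.
  by apply/seteqP; split => z /= [i]; [exists i|move=> _; exists i].
by apply: closed_bigcup => // ; exact: finite_finset.
Qed.

Lemma edge_closed (P : Prop) f : closed [set z : pt | P /\ exists2 s : R, 0 <= s <= 1 & z = c f s].
Proof.
have [p|np] := pselect P; last first.
  have -> : [set z : pt | P /\ exists2 s : R, 0 <= s <= 1 & z = c f s] = set0.
    by apply/seteqP; split => z // [].
  exact: closed0.
have -> : [set z : pt | P /\ exists2 s : R, 0 <= s <= 1 & z = c f s] = c f @` `[0, 1].
  apply/seteqP; split => z /=.
    by move=> [_ [s hs ->]]; exists s => //; rewrite /= in_itv.
  by move=> [s]; rewrite in_itv /= => hs <-; split => //; exists s.
apply: compact_closed; first exact: norm_hausdorff.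
by apply: curve_compact; have [_ cc _ _ _] := dr.
Qed.

Lemma Uset_closed : closed Uset.
Proof.
have -> : Uset = [set z | exists u, [set z' : pt | (pts u).2 <> 0 /\ z' = pts u] z] `|`
    [set z | exists f, [set z' : pt | off_axis f /\ exists2 s : R, 0 <= s <= 1 & z' = c f s] z].
  apply/seteqP; split => z; first by move=> [[u h|f h]]; [left; exists u|right; exists f].
  by move=> [[u h]|[f h]]; [exists (inl u)|exists (inr f)].
apply: closedU; last by apply: closed_fin => f; exact: edge_closed.
apply: closed_fin => u; have [p|np] := pselect ((pts u).2 <> 0); last first.
  have -> : [set z : pt | (pts u).2 <> 0 /\ z = pts u] = set0 by apply/seteqP; split => z // [].
  exact: closed0.
have -> : [set z : pt | (pts u).2 <> 0 /\ z = pts u] = [set pts u].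
  by apply/seteqP; split => z //= [].
by apply: compact_closed; [exact: norm_hausdorff|exact: compact_set1].
Qed.

Lemma Qset_closed : closed Qset.
Proof.
by apply: closedU; [exact: axis_closed|apply: closed_fin => f; exact: edge_closed].
Qed.

(** If no edge with an end off the axis meets the axis, a vertical segment is dropped from [v0].
    Between its last point [x] on the part of the drawing attached to vertices off the axis ([Uset])
    and the next point [y] on the axis or on an edge with both ends there ([Qset]), it meets no edge
    except at [x] and [y]. An edge through [x] leads to a vertex, an edge through [y] to the
    axis. *)
Lemma guide_exists v0 : (pts v0).2 <> 0 -> exists v q G W, guide v q G W.
Proof.
move=> nv0; have [pinj cc ce cav _] := dr.
have [[f [t [offf ht ct]]]|noax] := pselect (exists f t, [/\ off_axis f, 0 <= t <= 1 & (c f t).2 = 0]).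
  exact: guide_along_edge offf ht ct.
have noaxU z : Uset z -> z.2 <> 0.
  move=> [[u|f]]; first by move=> [h ->].
  by move=> [offf [s hs ->]] h; apply: noax; exists f, s.
pose b : pt := ((pts v0).1, 0); pose ga (s : R) : pt := pts v0 + s *: (b - pts v0).
have cga : continuous ga.
  apply: cont_add; first exact: cont_cst.
  by apply: cont_scale; [exact: cont_id|exact: cont_cst].
have ga0 : ga 0 = pts v0 by rewrite /ga; pt_ring.
have ga1 : ga 1 = b by rewrite /ga; pt_ring.
have U0 : Uset (ga 0) by rewrite ga0; exists (inl v0).
have Q1 : Qset (ga 1) by left; rewrite ga1.
have [s1 [hs1 Us1 ms1]] := last_time cga Uset_closed ler01 U0.
have s11 : s1 <= 1 by lra.
have [s2 [hs2 Qs2 ms2]] := first_time cga Qset_closed s11 Q1.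
set x := ga s1 in Us1; set y := ga s2 in Qs2.
have segE z : seg x y z -> exists2 s, s1 <= s <= s2 & z = ga s.
  move=> [u hu ->]; exists (s1 + u * (s2 - s1)); first by nra.
  by rewrite /x /y /ga; pt_ring.
have segU z : seg x y z -> Uset z -> z = x.
  move=> /segE[s hs ->] h; have hs' : s <= s1 by apply: ms1 => //; lra.
  by rewrite /x; congr ga; lra.
have segQ z : seg x y z -> Qset z -> z = y.
  move=> /segE[s hs ->] h; have hs' : s2 <= s by apply: ms2 => //; lra.
  by rewrite /y; congr ga; lra.
(* [x] is a vertex, or it lies on an edge followed back to its source; the source is off the axis
   because this edge never meets it. *)
have [v [G2 [W2 [h1 h2 h3 h4 h5]]]] : exists v (G2 : {set E}) (W2 : set pt), [/\ (pts v).2 <> 0 /\ W2 x, path_in W2 (pts v) x,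
    (#|G2| <= 1)%N, (forall z, W2 z -> z.2 <> 0) /\ (forall u, W2 (pts u) -> u = v) & guided G2 W2].
  have [[u Eu]|nu] := pselect (exists u, x = pts u).
    exists u, finset.set0, [set x]; split => //.
    - by rewrite -Eu; split => //; exact: noaxU.
    - by rewrite -Eu; apply: path_in_refl.
    - by rewrite cards0.
    - by split => [z ->|w]; [exact: noaxU|rewrite /= Eu => /pinj].
    - by move=> e t _ ht; rewrite /= Eu => /cav; case.
  case: Us1 => -[u [_ Eu]|f [offf [r hr Er]]]; first by case: nu; exists u.
  have r01 : 0 < r < 1.
    have [e0 e1] := ce f.
    have r0 : r <> 0 by move=> r0; apply: nu; exists (src f); rewrite Er r0.
    have r1 : r <> 1 by move=> r1; apply: nu; exists (tgt f); rewrite Er r1.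
    by lra.
  have [e0 _] := ce f.
  exists (src f), [set f]%SET, [set z | exists2 s, 0 <= s <= r & z = c f s]; split.
  - split; last by exists r => //; lra.
    by rewrite -e0; apply: noaxU; exists (inr f); split => //; exists 0 => //; lra.
  - by rewrite -e0 Er; apply: path_in_curve => //; lra.
  - by rewrite cards1.
  - split.
      by move=> z [s hs ->]; apply: noaxU; exists (inr f); split => //; exists s => //; lra.
    move=> u [s hs /esym E1]; have hs' : 0 <= s <= 1 by lra.
    by have [[_ ->//]|[s1' _]] := curve_vertex hs' E1; exfalso; lra.
  - by apply: curve_guided => z [s hs ->]; exists s => //; lra.
(* [y] is a point of the axis on no edge of [Qset], or it lies on such an edge, followed back to its
   last earlier meeting with the axis. *)
have [q [G1 [W1 [i1 i2 i3 i4 i5]]]] : exists q (G1 : {set E}) (W1 : set pt), [/\ q.2 = 0 /\ W1 y, path_in W1 y q,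
    (#|G1| <= 1)%N, (forall z, W1 z -> z.2 = 0 -> z = q) /\ (forall u, W1 (pts u) -> pts u = q) & guided G1 W1 \/
    (W1 = [set y] /\ G1 = finset.set0 /\ forall f s, ~ off_axis f -> 0 <= s <= 1 -> y <> c f s)].
  have [[f [nof [r hr Er]]]|nof] := pselect (exists f : E, ~ off_axis f /\ exists2 s : R, 0 <= s <= 1 & y = c f s); last first.
    case: (Qs2) => [y0|//]; exists y, finset.set0, [set y]; split => //; first exact: path_in_refl.
      by rewrite cards0.
    by right; split => //; split => // f s nf hs Ey; apply: nof; exists f; split => //; exists s.
  have [e0 e1] := ce f.
  have f0 : (c f 0).2 = 0 by rewrite e0; apply: contrapT => h; apply: nof; left.
  have f1 : (c f 1).2 = 0 by rewrite e1; apply: contrapT => h; apply: nof; right.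
  have r0 : 0 <= r by lra.
  have [T [hT KT mT]] := last_time (cc f) axis_closed r0 f0.
  have onT s : T <= s <= r -> (c f s).2 = 0 -> s = T.
    by move=> hs h; have h' : s <= T by [apply: mT => //; lra]; lra.
  exists (c f T), [set f]%SET, [set z | exists2 s, T <= s <= r & z = c f s]; split => //.
  - by split => //; exists r => //; lra.
  - by rewrite Er; apply: path_in_curve_rev => //; lra.
  - by rewrite cards1.
  - split; first by move=> _ [s hs ->] /(onT _ hs) ->.
    move=> u [s hs /esym E1]; have hs' : 0 <= s <= 1 by lra.
    rewrite -E1; congr c; apply: onT => //.
    by have [[-> _]|[-> _]] := curve_vertex hs' E1.
  - by left; apply: curve_guided => z [s hs ->]; exists s => //; lra.
exists v, q, (G2 :|: G1), (W2 `|` seg x y `|` W1).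
have [h11 h12] := h1; have [i11 i12] := i1; have [h41 h42] := h4; have [i41 i42] := i4.
have x_off : x.2 <> 0 by exact: h41.
split => //.
- apply: (@path_in_trans _ _ _ x); first by apply: path_in_sub h2 => z; left; left.
  apply: (@path_in_trans _ _ _ y); last by apply: path_in_sub i2 => z; right.
  by apply: path_in_seg => z; left; right.
- by split => //; apply: (leq_trans (leq_card_setU _ _)); exact: (leq_add h3 i3).
- split.
    move=> z [[/h41//|hz]|/i41//] z0; have : z = y by apply: segQ => //; left.
    by move=> E1; apply: i41 => //; rewrite E1.
  move=> u [[/h42 ->|hu]|/i42 ->]; [by left| |by right].
  have [u0|nu0] := pselect ((pts u).2 = 0).
    by right; apply: i42; have -> : pts u = y by apply: segQ => //; left.
  by left; apply: h42; have -> : pts u = x by apply: segU => //; exists (inl u).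
- have g2 e t : e \notin G2 -> 0 < t < 1 -> W2 (c e t) -> exists f s, [/\ f \in G2 :|: G1, 0 < s < 1 & c e t = c f s].
    by move=> eG ht h; have [f [s [fG hs Es]]] := h5 e t eG ht h; exists f, s; rewrite inE fG.
  have g1 e t : ~ off_axis e \/ W1 <> [set y] -> e \notin G1 -> 0 < t < 1 -> W1 (c e t) -> exists f s, [/\ f \in G2 :|: G1, 0 < s < 1 & c e t = c f s].
    move=> ne eG ht h; case: i5 => [i5|[EW [_ i5]]].
      by have [f [s [fG hs Es]]] := i5 e t eG ht h; exists f, s; rewrite inE fG orbT.
    case: ne => [ne|//]; exfalso; rewrite EW in h.
    by apply: (i5 e t) => //; lra.
  move=> e t; rewrite inE negb_or => /andP[eG2 eG1] ht h.
  have [offe|none] := pselect (off_axis e); last first.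
    have Qe : Qset (c e t) by right; exists e; split => //; exists t => //; lra.
    case: h => [[h|h]|h]; [exact: g2| |by apply: g1 => //; left].
    by apply: g1 => //; [left|rewrite (segQ _ h Qe)].
  have Ue : Uset (c e t) by exists (inr e); split => //; exists t => //; lra.
  case: h => [[h|h]|h]; [exact: g2|by apply: g2 => //; rewrite (segU _ h Ue)|].
  have [EW|nW] := pselect (W1 = [set y]); last by apply: g1 => //; right.
  have Ey : c e t = y by move: h; rewrite EW.
  apply: g2 => //; have -> // : c e t = x.
  by apply: segU => //; rewrite Ey; exact: seg_r.
Qed.

End GuidePath.

(** * Bringing all vertices to the axis *)

Section GoodAxis.
Variables (R : realType) (V E : finType).
Notation pt := (R * R)%type.
Implicit Types (k : nat) (pts : V -> pt) (c : E -> R -> pt) (src tgt : E -> V).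

Definition axis_times (g : R -> pt) (N : nat) : Prop :=
  forall l : seq R, uniq l -> (forall t, t \in l -> 0 < t < 1 /\ (g t).2 = 0) -> (size l <= N)%N.

Lemma drawn_homeo k pts c src tgt h : plhomeo h -> drawn k pts c src tgt ->
  drawn k (fun v => h (pts v)) (fun e t => h (c e t)) src tgt.
Proof.
move=> ph [pinj cc ce cav few]; have hi := plhomeo_inj ph; have [ch _ _] := ph; split.
- by move=> u v /hi /pinj.
- by move=> e; exact: cont_comp.
- by move=> e; have [-> ->] := ce e.
- by move=> e t v ht /hi; exact: cav.
- move=> e f l ul H; apply: (few e f l ul) => z /H[h1 h2 /hi h3 h4]; by split.
Qed.

Lemma size_cover (T : eqType) (I : finType) (G : {set I}) (l : seq T) (F : T -> I) k :
  (forall t, t \in l -> F t \in G) -> (forall i, i \in G -> (size [seq t <- l | F t == i] <= k)%N) ->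
  (size l <= #|G| * k)%N.
Proof.
move=> HF Hk.
have -> : size l = (\sum_(i in G) size [seq t <- l | F t == i])%N.
  under eq_bigr => i _ do rewrite size_filter -sum1_count.
  rewrite (exchange_big_dep xpredT) //= -sum1_size big_seq [RHS]big_seq.
  apply: eq_bigr => t tl; rewrite (big_pred1 (F t))// => i.
  by rewrite /= eq_sym; case: eqP => [->|]; rewrite ?HF ?andbT ?andbF.
rewrite -sum_nat_const; apply: leq_sum => i iG; exact: Hk.
Qed.

Lemma size_three (T : eqType) (l : seq T) (P1 P2 P3 : T -> Prop) (n1 n2 n3 : nat) : uniq l ->
  (forall t, t \in l -> [\/ P1 t, P2 t | P3 t]) ->
  (forall l', uniq l' -> (forall t, t \in l' -> t \in l /\ P1 t) -> (size l' <= n1)%N) ->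
  (forall l', uniq l' -> (forall t, t \in l' -> t \in l /\ P2 t) -> (size l' <= n2)%N) ->
  (forall l', uniq l' -> (forall t, t \in l' -> t \in l /\ P3 t) -> (size l' <= n3)%N) ->
  (size l <= n1 + n2 + n3)%N.
Proof.
move=> ul H H1 H2 H3.
pose f P := [seq t <- l | `[< P t >]].
have B (P : T -> Prop) n : (forall l', uniq l' -> (forall t, t \in l' -> t \in l /\ P t) -> (size l' <= n)%N) -> (size (f P) <= n)%N.
  apply; first exact: filter_uniq.
  by move=> t; rewrite mem_filter => /andP[/asboolP].
apply: (@leq_trans (size (f P1 ++ f P2 ++ f P3))).
  apply: uniq_leq_size => // t tl; rewrite !mem_cat !mem_filter tl !andbT.
  by case: (H t tl) => h; rewrite (asboolT h) ?orbT.
by rewrite !size_cat -addnA leq_add ?leq_add ?B.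
Qed.

(** An edge outside [G] meets the straightened guide at most 2k times, k for each of two edges. By
    [few_side_times] it meets each side of the tent at most 2(2k) + 2 times, hence 8k + 4 new
    meetings; old ones can only disappear. *)
Lemma axis_step k pts c src tgt v0 : drawn k pts c src tgt -> (forall e, plc (c e)) ->
  (pts v0).2 <> 0 -> exists h v (G : {set E}),
  [/\ plhomeo h, (pts v).2 <> 0, (#|G| <= 2)%N,
      forall u, (h (pts u)).2 = 0 <-> ((pts u).2 = 0 \/ u = v)
    & forall e N, e \notin G -> axis_times (c e) N ->
        axis_times (fun t => h (c e t)) (N + (8 * k + 4))].
Proof.
move=> dr cpl nv0; have [pinj cc ce cav few] := dr.
have [v [q [G [W [nv pW [q0 cG] [Wax Wv] gW]]]]] := guide_exists dr cpl nv0.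
have [l [lq sl subW]] := path_in_simple pW.
have vq : pts v <> q by move=> E1; apply: nv; rewrite E1.
have l0 : l <> [::] by move=> El; apply: vq; rewrite -lq El.
(* The axis and all other vertices stay fixed while the guide is straightened. *)
pose F : set pt := [set z | z.2 = 0] `|` [set z | exists u, [set z' | u <> v /\ z' = pts u] z].
have cF : closed F.
  apply: closedU; first exact: axis_closed.
  apply: closed_fin => u; have [->|/eqP uv] := eqVneq u v.
    have -> : [set z' | v <> v /\ z' = pts v] = set0 by apply/seteqP; split => z // [].
    exact: closed0.
  have -> : [set z' | u <> v /\ z' = pts u] = [set pts u].
    by apply/seteqP; split => z //= [].
  by apply: compact_closed; [exact: norm_hausdorff|exact: compact_set1].
have lF z : polyline (pts v :: l) z -> F z -> z = last (pts v) l.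
  rewrite lq => /subW Wz [z0|[u [uv Ez]]]; first exact: Wax.
  by rewrite Ez in Wz *; case: (Wv u Wz).
have [h1 [ph1 hv hF hseg segF]] := straighten_path cF sl l0 lF.
rewrite lq in hv hseg segF.
have h1i := plhomeo_inj ph1.
set w := h1 (pts v) in hv hseg segF.
have w0 : w.2 != 0 by apply/eqP => w0; apply: hv; apply: segF; [exact: seg_l|left].
(* Affine coordinates: [ph] is the horizontal offset from the line through [q] and [w], and [ps] is
   0 at the height of [w] and 1 on the axis. The segment is [ph = 0], [0 <= ps <= 1], and a side of
   the tent is [ph = de * ps]. *)
pose ph z := 1 / 1 * z.1 + (- ((w.1 - q.1) / w.2)) * z.2 + (- q.1).
pose ps z := 0 * z.1 + (- w.2^-1) * z.2 + 1.
have phE z : z.1 - q.1 - (w.1 - q.1) * (z.2 / w.2) = ph z by rewrite /ph; field.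
have psE z : 1 - z.2 / w.2 = ps z by rewrite /ps; field.
have inseg z : ph z = 0 -> 0 <= ps z <= 1 -> seg w q z.
  rewrite -phE => E1 h; exists (ps z) => //; rewrite -psE in h *.
  apply: pt_ext; rewrite /= !scaleRE ?q0; last by field.
  have -> : z.1 = q.1 + (w.1 - q.1) * (z.2 / w.2) by lra.
  by field.
have [e1 e10 He1] : exists2 e1 : R, 0 < e1 & forall e, e \notin G ->
    forall de : R, 0 < de < e1 -> forall l : seq R, uniq l ->
    (forall t, t \in l -> [/\ 0 < t < 1, ph (h1 (c e t)) = de * ps (h1 (c e t)) & 0 < ps (h1 (c e t)) < 1]) ->
    (size l <= 2 * (2 * k) + 2)%N.
  apply: small_fin => [e d d' hd h eG de hde|e]; first by apply: h => //; lra.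
  have [eG|eG] := boolP (e \in G); first by exists 1.
  have pl1 : plc (fun t => h1 (c e t)) by have [_ _ p] := ph1; apply: p.
  have [||e0 e00 He0] := @few_side_times R (fun t => (ph (h1 (c e t)), ps (h1 (c e t)))) (2 * k).
  - by split; exact: plf_affine2.
  - move=> m um Hm.
    have Hm' t : t \in m -> exists f, exists2 s, 0 < s < 1 & f \in G /\ c e t = c f s.
      move=> /Hm[ht /= E1 h2]; have /hseg/subW Wt := inseg _ E1 h2.
      by have [f [s [fG hs Es]]] := gW e t eG ht Wt; exists f, s.
    have /choice[fs Hfs] : forall t, exists fs : E * R, t \in m -> [/\ 0 < fs.2 < 1, fs.1 \in G & c e t = c fs.1 fs.2].
      move=> t; have [tm|ntm] := boolP (t \in m); last by exists (e, 0).
      by have [f [s hs [fG Es]]] := Hm' t tm; exists (f, s).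
    apply: (@leq_trans (#|G| * k)); last by rewrite leq_mul2r cG orbT.
    apply: (@size_cover _ _ G m (fun t => (fs t).1)); first by move=> t /Hfs[].
    move=> f fG; have <- : size [seq (t, (fs t).2) | t <- [seq t <- m | (fs t).1 == f]] = size [seq t <- m | (fs t).1 == f].
      by rewrite size_map.
    apply: (few e f); first by rewrite map_inj_in_uniq ?filter_uniq// => t t' _ _ [].
    move=> _ /mapP[t + ->]; rewrite mem_filter => /andP[/eqP ft tm] /=.
    have [ht _ _] := Hm t tm; have [hs _ Es] := Hfs t tm; split => //; first by rewrite -ft.
    by move=> ef; move: eG; rewrite ef fG.
  - by exists e0 => // _ de hde m um Hm; exact: (He0 de hde m um Hm).
(* For small [e] the other vertices on the axis avoid the interval that is lifted off, and those off
   the axis avoid the sides of the tent. *)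
have [e2 e20 He2] : exists2 e2 : R, 0 < e2 & forall u, u <> v ->
    ((pts u).2 = 0 -> forall e : R, 0 < e -> 2 * e < e2 -> ~ (q.1 + e < (pts u).1 < q.1 + 2 * e)) /\
    ((pts u).2 <> 0 -> forall de : R, 0 < de < e2 -> ph (pts u) = de * ps (pts u) -> ~ (0 < ps (pts u) < 1)).
  apply: small_fin => [u d d' hd h uv|u].
    have [h2 h3] := h uv; split => [u0 e he0 he|u0 de hde]; first by apply: h2 => //; lra.
    by apply: h3 => //; lra.
  have [->|/eqP uv] := eqVneq u v; first by exists 1.
  have [u0|nu0] := pselect ((pts u).2 = 0).
    have [h|h] := ltP q.1 (pts u).1.
      by exists ((pts u).1 - q.1); [lra|move=> _; split => // _ e he0 he; lra].
    by exists 1 => // _; split => // _ e he0 he; lra.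
  have [p0|p0] := eqVneq (ph (pts u)) 0.
    exists 1 => // _; split => // _ de hde _ h.
    have sz : seg w q (pts u) by apply: inseg => //; lra.
    have : pts u = q by apply: segF => //; right; exists u.
    by move=> E1; apply: nu0; rewrite E1.
  exists `|ph (pts u)|; first by rewrite normr_gt0.
  move=> _; split => // _ de hde E1 h; have := hde; rewrite E1 ger0_norm; last by apply: mulr_ge0; lra.
  by nra.
pose e := Num.min e1 e2 / 3.
have [ee1 [ee2 e0]] : 2 * e < e1 /\ 2 * e < e2 /\ 0 < e.
  have m0 : 0 < Num.min e1 e2 by rewrite lt_min e10.
  have [m1 m2] : Num.min e1 e2 <= e1 /\ Num.min e1 e2 <= e2 by rewrite !ge_min !lexx orbT.
  by rewrite /e; split; [lra|split; lra].
have [h2 [ph2 h2v h2ax h2z]] := tent_homeo q.1 w0 e0.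
have h2z' z : (h2 z).2 = 0 -> [\/ z.2 = 0, z = w | exists2 de : R, de = e \/ de = 2 * e & ph z = de * ps z /\ 0 < ps z < 1].
  by move=> /h2z; rewrite phE psE.
have h1ax z : (h1 z).2 = 0 -> z.2 = 0.
  move=> h; have : h1 (h1 z) = h1 z by apply: hF; left.
  by move=> /h1i E1; rewrite -E1.
exists (fun z => h2 (h1 z)), v, G; split => //.
- exact: plhomeo_comp.
- move=> u; have [->|/eqP uv] := eqVneq u v; first by split => // _; right.
  have Eu : h1 (pts u) = pts u by apply: hF; right; exists u.
  have [He2a He2b] := He2 u uv; rewrite Eu; split.
    case/h2z' => [h|h|[de hde [E1 h]]]; [by left| |].
      by case: uv; apply: pinj; apply: h1i; rewrite Eu.
    left; apply: contrapT => nu; apply: (He2b nu de _ E1 h).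
    by case: hde => ->; lra.
  by move=> [u0|//]; apply: h2ax => //; exact: He2a.
- move=> f N fG HN m um Hm.
  have -> : (N + (8 * k + 4) = N + (2 * (2 * k) + 2) + (2 * (2 * k) + 2))%N by lia.
  pose S de t := ph (h1 (c f t)) = de * ps (h1 (c f t)) /\ 0 < ps (h1 (c f t)) < 1.
  apply: (@size_three _ m (fun t => (c f t).2 = 0) (S e) (S (2 * e))) => //.
  - move=> t /Hm[ht /h2z'[/h1ax h|/h1i h|[de hde h]]]; [exact: Or31|by case: (cav f t v ht)|].
    by case: hde => Ed; rewrite Ed in h; [apply: Or32|apply: Or33].
  - by move=> m' um' Hm'; apply: HN => // t /Hm'[/Hm[]].
  - move=> m' um' Hm'; apply: (He1 f fG e) => //; first lra.
    by move=> t /Hm'[/Hm[ht _] [h h']].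
  - move=> m' um' Hm'; apply: (He1 f fG (2 * e)) => //; first lra.
    by move=> t /Hm'[/Hm[ht _] [h h']].
Qed.

Lemma axis_induction m k pts c src tgt : drawn k pts c src tgt -> (forall e, plc (c e)) ->
  #|[set u : V | (pts u).2 != 0]%SET| = m ->
  exists h (G : {set E}), [/\ plhomeo h, (#|G| <= 2 * m)%N, forall u, (h (pts u)).2 = 0
    & forall e N, e \notin G -> axis_times (c e) N ->
        axis_times (fun t => h (c e t)) (N + (8 * k + 4) * m)].
Proof.
elim: m pts c => [|m IH] pts c dr cpl cm.
  exists id, finset.set0; split => //; [exact: plhomeo_id|by rewrite cards0| |].
    move=> u; apply/eqP; move/eqP: cm; rewrite cards_eq0 => /eqP/setP/(_ u).
    by rewrite !inE => /negbFE.
  by move=> e N _; rewrite muln0 addn0.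
have /card_gt0P[v0] : (0 < #|[set u : V | (pts u).2 != 0%R]%SET|)%N by rewrite cm.
rewrite inE => /eqP nv0.
have [h1 [v [G1 [ph1 nv cG1 H1 H2]]]] := axis_step dr cpl nv0.
have [| | |h2 [G2 [ph2 cG2 H3 H4]]] := IH (fun v => h1 (pts v)) (fun e t => h1 (c e t)).
- exact: drawn_homeo.
- by move=> e; have [_ _ p] := ph1; exact: p.
- have E1 : [set u | (pts u).2 != 0]%SET = (v |: [set u | (h1 (pts u)).2 != 0])%SET.
    apply/setP => u; rewrite !inE; apply/idP/idP.
      move=> /eqP nu; case: (eqVneq u v) => //= /eqP uv; apply/eqP => /H1[]//.
    move=> /orP[/eqP ->|/eqP h]; first exact/eqP.
    by apply/eqP => u0; apply: h; apply/H1; left.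
  move: cm; rewrite E1 cardsU1 inE.
  have -> : (h1 (pts v)).2 = 0 by apply/H1; right.
  by rewrite eqxx /= add1n => -[].
exists (fun z => h2 (h1 z)), (G1 :|: G2); split => //.
- exact: plhomeo_comp.
- by apply: (leq_trans (leq_card_setU _ _)); have := leq_add cG1 cG2; rewrite mulnS.
- move=> e N; rewrite inE negb_or => /andP[e1 e2] HN.
  by rewrite mulnS addnA; apply: H4 => //; exact: H2.
Qed.

(** The initial axis runs strictly below the drawing: no edge meets it, and each vertex costs one
    step. *)
Lemma good_axis k pts c src tgt : drawn k pts c src tgt -> (forall e, plc (c e)) ->
  exists h (G : {set E}), [/\ plhomeo h, (#|G| <= 2 * #|V|)%N, forall u, (h (pts u)).2 = 0
    & forall e, e \notin G -> axis_times (fun t => h (c e t)) ((8 * k + 4) * #|V|)].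
Proof.
move=> dr cpl; have [_ cc ce _ _] := dr.
have low e : exists M : R, forall t, 0 <= t <= 1 -> M <= (c e t).2.
  have cf : continuous (fun t => (c e t).2) by exact: cont_snd.
  have [t0 ht0 H] := EVT_min ler01 (continuous_subspaceT cf).
  by exists (c e t0).2 => t ht; apply: H; rewrite in_itv.
have [M HM] : exists M : R, (forall e t, 0 <= t <= 1 -> M < (c e t).2) /\ forall u, M < (pts u).2.
  have /choice[Me HMe] := low.
  exists (\big[Num.min/0]_(e : E) Me e + \big[Num.min/0]_(u : V) (pts u).2 - 1).
  have neg (I : finType) (f : I -> R) : \big[Num.min/0]_(i : I) f i <= 0.
    by elim/big_rec: _ => // i x _ hx; rewrite ge_min hx orbT.
  have lef (I : finType) (f : I -> R) i : \big[Num.min/0]_(i : I) f i <= f i.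
    by rewrite (bigD1 i)//= ge_min lexx.
  split => [e t ht|u].
    have := HMe e t ht; have := lef _ Me e; have := neg _ (fun u => (pts u).2); lra.
  have := neg _ Me; have := lef _ (fun u => (pts u).2) u; lra.
have [HMc HMp] := HM.
have pt0 : plhomeo (fun z : pt => (z.1, z.2 - M)).
  apply: (@plhomeo_shear_y R (fun=> M)); first exact: cont_cst.
  by move=> g _; exact: plf_cst.
have [| |h [G [ph cG H1 H2]]] := @axis_induction #|V| k (fun v => ((pts v).1, (pts v).2 - M))
   (fun e t => ((c e t).1, (c e t).2 - M)) src tgt (drawn_homeo pt0 dr).
- by move=> e; have [_ _ p] := pt0; exact: p.
- have -> : [set u : V | ((pts u).1, (pts u).2 - M).2 != 0]%SET = [set: V]%SET.
    by apply/setP => u; rewrite !inE /=; have := HMp u; rewrite -subr_gt0 => /gt_eqF ->.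
  exact: cardsT.
exists (fun z => h ((fun z : pt => (z.1, z.2 - M)) z)), G; split => //.
  exact: (plhomeo_comp pt0 ph).
move=> e eG; rewrite -[X in axis_times _ X]add0n; apply: H2 => //.
move=> [//|t l] _ /(_ t); rewrite mem_head => /(_ isT)[ht /= ct0]; exfalso.
by have := HMc e t; lra.
Qed.

End GoodAxis.

(** * Crossing chords *)

Section Parity.

Fixpoint xors (f : nat -> bool) (n : nat) : bool :=
  if n is m.+1 then xors f m (+) f m else false.

Variables (H W : nat -> nat -> bool) (N : nat).
Hypothesis cell : forall i j, (i < N)%N -> (j < N)%N ->
  H i j (+) W i.+1 j (+) H i j.+1 (+) W i j = false.

Lemma xors_row j n : (j < N)%N -> (n <= N)%N ->
  xors (H^~ j) n (+) xors (H^~ j.+1) n = W n j (+) W 0 j.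
Proof.
move=> jN; elim: n => [|n IH] nN /=; first by rewrite addbb.
have := cell nN jN; have := IH (ltnW nN).
case: (xors (H^~ j) n); case: (xors (H^~ j.+1) n); case: (W n j); case: (W 0 j);
  case: (H n j); case: (H n j.+1); case: (W n.+1 j) => //.
Qed.

(** A discrete Stokes formula modulo 2: the inner edges of the grid cancel. *)
Lemma xors_boundary m : (m <= N)%N ->
  xors (H^~ 0%N) N (+) xors (H^~ m) N = xors (W N) m (+) xors (W 0) m.
Proof.
elim: m => [|m IH] mN /=; first by rewrite addbb.
have := xors_row mN (leqnn N); have := IH (ltnW mN).
case: (xors (H^~ 0%N) N); case: (xors (H^~ m) N); case: (xors (W N) m); case: (xors (W 0) m);
  case: (W N m); case: (W 0 m); case: (xors (H^~ m.+1) N) => //.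
Qed.
End Parity.

(** Around a cell that lacks one of the three colours, the number of sides joining the colours [r]
    and [b] is even. *)
Lemma cell_parity (r1 r2 r3 r4 b1 b2 b3 b4 : bool) :
  ~~ (r1 && b1) -> ~~ (r2 && b2) -> ~~ (r3 && b3) -> ~~ (r4 && b4) ->
  ~~ [&& [|| r1, r2, r3 | r4],
         [|| ~~ r1 && ~~ b1, ~~ r2 && ~~ b2, ~~ r3 && ~~ b3 | ~~ r4 && ~~ b4]
       & [|| b1, b2, b3 | b4]] ->
  (r1 && b2 || b1 && r2) (+) (r2 && b4 || b2 && r4) (+)
  (r3 && b4 || b3 && r4) (+) (r1 && b3 || b1 && r3) = false.
Proof. by case: r1; case: b1; case: r2; case: b2; case: r3; case: b3; case: r4; case: b4. Qed.

(* Sperner-type parity argument: colour grid points by [0 < x], [x <= 0 < y]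
   and [x, y <= 0]; a cell with all three colours would force (x, y) near 0. *)
Lemma grid_parity (R : realType) (N : nat) (x y : nat -> nat -> R) (d : R) : 0 < d ->
  (forall i j, (i < N)%N -> (j <= N)%N -> `|x i.+1 j - x i j| < d / 4 /\ `|y i.+1 j - y i j| < d / 4) ->
  (forall i j, (i <= N)%N -> (j < N)%N -> `|x i j.+1 - x i j| < d / 4 /\ `|y i j.+1 - y i j| < d / 4) ->
  (forall i j, (i <= N)%N -> (j <= N)%N -> d < `|x i j| \/ d < `|y i j|) ->
  (forall i j, (0 < i < N)%N -> j = 0%N \/ j = N -> 0 < y i j) ->
  (forall i j, (j <= N)%N -> i = 0%N \/ i = N -> y i j <= 0) ->
  (forall i j, i = 0%N \/ i = N -> j = 0%N \/ j = N -> y i j = 0) ->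
  x 0%N 0%N < 0 -> x 0%N N < 0 -> 0 < x N 0%N -> x N N < 0 -> False.
Proof.
move=> d0 cx cy far ypos yneg y0 x00 x0N xN0 xNN.
pose r i j := 0 < x i j; pose bb i j := (x i j <= 0) && (y i j <= 0).
pose rb i j i' j' := (r i j && bb i' j') || (bb i j && r i' j').
pose H i j := rb i j i.+1 j; pose W i j := rb i j i j.+1.
have excl i j : ~~ (r i j && bb i j) by rewrite /r /bb; case: ltP.
have cell i j : (i < N)%N -> (j < N)%N -> H i j (+) W i.+1 j (+) H i j.+1 (+) W i j = false.
  move=> iN jN; apply: cell_parity; [exact: excl..|].
  pose cs := [:: (i, j); (i.+1, j); (i, j.+1); (i.+1, j.+1)].
  have cl z z' : z \in cs -> z' \in cs ->
      x z.1 z.2 - x z'.1 z'.2 < d / 2 /\ y z.1 z.2 - y z'.1 z'.2 < d / 2.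
    have [] := cx i j iN (ltnW jN); have [] := cx i j.+1 iN jN.
    have [] := cy i j (ltnW iN) jN; have [] := cy i.+1 j iN jN.
    rewrite !ltr_norml => h1 h2 h3 h4 h5 h6 h7 h8.
    rewrite !inE => /or4P[] /eqP -> /or4P[] /eqP -> /=; clear -d0 h1 h2 h3 h4 h5 h6 h7 h8; split; lra.
  have csN z : z \in cs -> (z.1 <= N)%N /\ (z.2 <= N)%N.
    by rewrite !inE => /or4P[] /eqP -> /=; split => //; exact: ltnW.
  have key z1 z2 z3 : z1 \in cs -> z2 \in cs -> z3 \in cs ->
      r z1.1 z1.2 -> ~~ r z2.1 z2.2 && ~~ bb z2.1 z2.2 -> bb z3.1 z3.2 -> False.
    move=> c1 c2 c3; rewrite /r /bb -leNgt => h1 /andP[h2].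
    rewrite h2 /= -ltNge => h2' /andP[h3 h3'].
    have [n1 n2] := csN z2 c2; have := far _ _ n1 n2.
    have [e1 _] := cl z1 z2 c1 c2; have [_ e2] := cl z2 z3 c2 c3.
    rewrite (ler0_norm h2) (gtr0_norm h2') => -[] h; clear -h h1 h2 h2' h3 h3' e1 e2 d0; lra.
  apply/negP => /and3P[hr ht hb].
  have /hasP[z1 c1 h1] : has (fun z => r z.1 z.2) cs by rewrite /= orbF.
  have /hasP[z2 c2 h2] : has (fun z => ~~ r z.1 z.2 && ~~ bb z.1 z.2) cs by rewrite /= orbF.
  have /hasP[z3 c3 h3] : has (fun z => bb z.1 z.2) cs by rewrite /= orbF.
  exact: (key z1 z2 z3).
have xfar i j : (i <= N)%N -> (j <= N)%N -> x i j <= 0 -> y i j = 0 -> x i j < - d.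
  move=> iN jN h h0; have := far i j iN jN; rewrite h0 normr0 (ler0_norm h) => -[]; clear -d0; lra.
(* No change of colour is counted on these two sides: inside them [y > 0] excludes [bb], and at a
   corner coloured [bb] the first coordinate is too far below 0 for its neighbour to be positive. *)
have Hfalse j n : j = 0%N \/ j = N -> (n <= N)%N -> xors (H^~ j) n = false.
  move=> hj; elim: n => //= n IH nN; rewrite IH ?(ltnW nN)//= /H /rb /r /bb.
  have jN : (j <= N)%N by case: hj => ->.
  have [+ _] := cx n j nN jN; rewrite ltr_norml => cn.
  apply/negP => /orP[/andP[h1 /andP[h2 h3]]|/andP[/andP[h2 h3] h1]].
    have [lt|le] := ltnP n.+1 N; first by have := ypos n.+1 j lt hj; clear -h3; lra.
    have En : n.+1 = N by apply/eqP; rewrite eqn_leq nN le.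
    have yz : y n.+1 j = 0 by apply: y0 => //; right.
    have := xfar n.+1 j nN jN h2 yz; clear -cn h1 h2 d0; lra.
  have [lt|] := ltnP 0 n; first by have := ypos n j; rewrite lt nN => /(_ isT hj); clear -h3; lra.
  rewrite leqn0 => /eqP En; have yz : y n j = 0 by apply: y0 => //; left.
  have := xfar n j (ltnW nN) jN h2 yz; clear -cn h1 h2 d0; lra.
(* Here [y <= 0] leaves only two colours, so the changes telescope to the corners. Only the corner
   (N, 0) has [x > 0], which makes the total odd. *)
have Wside i n : i = 0%N \/ i = N -> (n <= N)%N -> xors (W i) n = r i 0%N (+) r i n.
  move=> hi.
  have nb j : (j <= N)%N -> bb i j = ~~ r i j.
    by move=> jN; rewrite /bb /r leNgt yneg// andbT.
  elim: n => [|n IH] nN /=; first by rewrite addbb.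
  rewrite IH ?(ltnW nN)// /W /rb !nb ?(ltnW nN)//.
  by case: (r i 0%N); case: (r i n); case: (r i n.+1).
have := xors_boundary cell (leqnn N).
rewrite (Hfalse 0%N N (or_introl erefl) (leqnn N)) (Hfalse N N (or_intror erefl) (leqnn N)).
rewrite (Wside 0%N N (or_introl erefl) (leqnn N)) (Wside N N (or_intror erefl) (leqnn N)).
by rewrite /r xN0 !ltNge (ltW xNN) (ltW x00) (ltW x0N).
Qed.

Section Crossing.
Variable R : realType.
Notation pt := (R * R)%type.

(** The difference [A u - B v] on the unit square is sampled on a grid. Without a meeting its norm
    exceeds some [d] everywhere, while neighbouring samples differ by less than [d / 4]; the order
    of the end points and the signs of the heights give the boundary values excluded by
    [grid_parity]. *)
Lemma curves_meet_strict (A B : R -> pt) (x1 x2 x3 x4 : R) : continuous A -> continuous B ->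
  x1 < x2 < x3 -> x3 < x4 -> A 0 = (x1, 0) -> A 1 = (x3, 0) -> B 0 = (x2, 0) -> B 1 = (x4, 0) ->
  (forall u, 0 < u < 1 -> 0 < (A u).2) -> (forall u, 0 <= u <= 1 -> 0 <= (B u).2) ->
  exists u v, [/\ 0 <= u <= 1, 0 <= v <= 1 & A u = B v].
Proof.
move=> cA cB x123 x34 A0 A1 B0 B1 Apos Bpos; apply: contrapT => nmeet.
have [|d d0 Hd] := @curve_sep R A 0 1 _ cA (curve_compact (a := 0) (b := 1) cB).
  move=> u hu [v /=]; rewrite in_itv /= => hv E1.
  by apply: nmeet; exists u, v; split.
have {}Hd u v : 0 <= u <= 1 -> 0 <= v <= 1 -> d < `|A u - B v|.
  by move=> hu hv; apply: Hd => //; exists v => //=; rewrite in_itv.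
have d40 : 0 < d / 4 by lra.
have [m1 m10 Hm1] := @uniform_mesh R A 0 1 (d / 4) cA d40.
have [m2 m20 Hm2] := @uniform_mesh R B 0 1 (d / 4) cB d40.
pose N := (Num.truncn ((Num.min m1 m2)^-1)).+1.
have m0 : 0 < Num.min m1 m2 by rewrite lt_min m10.
have N0 : 0 < (N%:R : R) by rewrite ltr0n.
have Nm : N%:R^-1 < Num.min m1 m2.
  by rewrite invf_plt ?posrE//; exact: truncnS_gt.
have gr i : (i <= N)%N -> 0 <= (i%:R / N%:R : R) <= 1.
  by move=> iN; rewrite divr_ge0 ?ler0n//= ler_pdivrMr// mul1r ler_nat.
have st i : (i < N)%N -> `|i.+1%:R / N%:R - i%:R / N%:R| < Num.min m1 m2.
  move=> iN; have -> : i.+1%:R / N%:R - i%:R / N%:R = N%:R^-1 :> R.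
    by rewrite -mulrBl -natr1 addrAC subrr add0r mul1r.
  by rewrite ger0_norm ?invr_ge0 ?ler0n.
pose a i := A (i%:R / N%:R); pose b j := B (j%:R / N%:R).
have da i : (i < N)%N -> `|a i.+1 - a i| < d / 4.
  move=> iN; apply: Hm1; [exact: gr|apply: gr; exact: ltnW|].
  by apply: (lt_le_trans (st i iN)); rewrite ge_min lexx.
have db j : (j < N)%N -> `|b j.+1 - b j| < d / 4.
  move=> jN; apply: Hm2; [exact: gr|apply: gr; exact: ltnW|].
  by apply: (lt_le_trans (st j jN)); rewrite ge_min lexx orbT.
have far i j : (i <= N)%N -> (j <= N)%N -> d < `|a i - b j| by move=> iN jN; apply: Hd; exact: gr.
have aN : a N = (x3, 0) by rewrite /a divff ?gt_eqF.
have bN : b N = (x4, 0) by rewrite /b divff ?gt_eqF.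
have a0 : a 0%N = (x1, 0) by rewrite /a mul0r.
have b0 : b 0%N = (x2, 0) by rewrite /b mul0r.
have apos i : (0 < i < N)%N -> 0 < (a i).2.
  move=> /andP[i0 iN]; apply: Apos; rewrite divr_gt0 ?ltr0n//= ltr_pdivrMr// mul1r ltr_nat//.
have bpos j : (j <= N)%N -> 0 <= (b j).2 by move=> jN; apply: Bpos; exact: gr.
clearbody a b; clear N0 Nm gr st; clearbody N.
apply: (@grid_parity R N (fun i j => (a i - b j).1) (fun i j => (a i - b j).2) d d0) => /=.
- move=> i j iN jN; have := da i iN; rewrite pt_norm /= gt_max => /andP[h1 h2].
  have -> : (a i.+1).1 - (b j).1 - ((a i).1 - (b j).1) = (a i.+1).1 - (a i).1 by ring.
  by have -> : (a i.+1).2 - (b j).2 - ((a i).2 - (b j).2) = (a i.+1).2 - (a i).2 by ring.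
- move=> i j iN jN; have := db j jN; rewrite pt_norm /= gt_max => /andP[h1 h2].
  have -> : (a i).1 - (b j.+1).1 - ((a i).1 - (b j).1) = - ((b j.+1).1 - (b j).1) by ring.
  have -> : (a i).2 - (b j.+1).2 - ((a i).2 - (b j).2) = - ((b j.+1).2 - (b j).2) by ring.
  by rewrite !normrN.
- by move=> i j iN jN; have := far i j iN jN; rewrite pt_norm /= lt_max => /orP.
- by move=> i j iN [->|->]; rewrite ?b0 ?bN subr0; exact: apos.
- by move=> i j jN [->|->]; rewrite ?a0 ?aN sub0r oppr_le0; exact: bpos.
- by move=> i j [->|->] [->|->]; rewrite ?a0 ?aN ?b0 ?bN subr0.
- by rewrite a0 b0 /=; lra.
- by rewrite a0 bN /=; lra.
- by rewrite aN b0 /=; lra.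
- by rewrite aN bN /=; lra.
Qed.

(** Adding the height [d u (1 - u)] to [A] makes it strictly positive inside; with [d] a separation
    constant of the two curves, this creates no meeting. Coinciding end points are meetings by
    themselves. *)
Lemma curves_meet (A B : R -> pt) (x1 x2 x3 x4 : R) : continuous A -> continuous B ->
  x1 <= x2 <= x3 -> x3 <= x4 -> A 0 = (x1, 0) -> A 1 = (x3, 0) -> B 0 = (x2, 0) -> B 1 = (x4, 0) ->
  (forall u, 0 <= u <= 1 -> 0 <= (A u).2) -> (forall u, 0 <= u <= 1 -> 0 <= (B u).2) ->
  exists u v, [/\ 0 <= u <= 1, 0 <= v <= 1 & A u = B v].
Proof.
move=> cA cB x123 x34 A0 A1 B0 B1 Apos Bpos.
have [E1|n1] := eqVneq x1 x2; first by exists 0, 0; split; [lra|lra|rewrite A0 B0 E1].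
have [E2|n2] := eqVneq x2 x3; first by exists 1, 0; split; [lra|lra|rewrite A1 B0 E2].
have [E3|n3] := eqVneq x3 x4; first by exists 1, 1; split; [lra|lra|rewrite A1 B1 E3].
have l1 : x1 < x2 by rewrite lt_neqAle n1; lra.
have l2 : x2 < x3 by rewrite lt_neqAle n2; lra.
have l3 : x3 < x4 by rewrite lt_neqAle n3; lra.
apply: contrapT => nmeet.
have [|d d0 Hd] := @curve_sep R A 0 1 _ cA (curve_compact (a := 0) (b := 1) cB).
  move=> u hu [v /=]; rewrite in_itv /= => hv E1.
  by apply: nmeet; exists u, v; split.
pose A' u := A u + (0, d * (u * (1 - u))).
have cA' : continuous A'.
  apply: cont_add => //; apply: cont_pair; first exact: cont_cst.
  apply: cont_mul; first exact: cont_cst.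
  apply: cont_mul; first exact: cont_id.
  by apply: cont_sub; [exact: cont_cst|exact: cont_id].
have [||||u [v [hu hv E1]]] := @curves_meet_strict A' B x1 x2 x3 x4 cA' cB _ l3 _ _ B0 B1 _ Bpos.
- by rewrite l1 l2.
- by rewrite /A' A0; pt_ring.
- by rewrite /A' A1; pt_ring.
- by move=> u hu; rewrite /A' /=; have := Apos u; have : 0 < d * (u * (1 - u)); [by apply: mulr_gt0 => //; apply: mulr_gt0; lra|lra].
have : d < `|A u - B v| by apply: Hd => //; exists v => //=; rewrite in_itv.
have -> : A u - B v = (0, - (d * (u * (1 - u)))).
  have -> : A u = A' u - (0, d * (u * (1 - u))) by rewrite /A'; pt_ring.
  by rewrite E1; pt_ring.
have u0 : 0 <= u * (1 - u) by apply: mulr_ge0; lra.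
have u1 : u * (1 - u) <= 1 by nra.
rewrite pt_norm /= normr0 normrN ger0_norm; last by apply: mulr_ge0 => //; lra.
by rewrite lt_max => /orP[|]; [lra|rewrite -subr_gt0; nra].
Qed.

(** Reduces to [curves_meet] by traversing each arc from its left end and reflecting the plane when
    the arcs lie below the axis. *)
Lemma chords_meet (g : R -> pt) (sg a b c d : R) : continuous g -> a <= b -> c <= d ->
  (forall t, a <= t <= b \/ c <= t <= d -> 0 <= sg * (g t).2) ->
  (g a).2 = 0 -> (g b).2 = 0 -> (g c).2 = 0 -> (g d).2 = 0 ->
  Num.min (g a).1 (g b).1 <= Num.min (g c).1 (g d).1 ->
  Num.min (g c).1 (g d).1 <= Num.max (g a).1 (g b).1 ->
  Num.max (g a).1 (g b).1 <= Num.max (g c).1 (g d).1 -> sg != 0 ->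
  exists s t, [/\ a <= s <= b, c <= t <= d & g s = g t].
Proof.
move=> cg ab cd pos ga gb gc gd h1 h2 h3 sg0.
have param (p q : R) : p <= q -> (g p).2 = 0 -> (g q).2 = 0 -> exists f : R -> R,
    [/\ continuous f, forall u, 0 <= u <= 1 -> p <= f u <= q,
       g (f 0) = (Num.min (g p).1 (g q).1, 0) & g (f 1) = (Num.max (g p).1 (g q).1, 0)].
  move=> pq gp gq; have cl (x y : R) : continuous (fun u : R => x + u * (y - x)).
    apply: cont_add; first exact: cont_cst.
    by apply: cont_mul; [exact: cont_id|exact: cont_cst].
  have [h|h] := leP (g p).1 (g q).1.
    exists (fun u => p + u * (q - p)); split => //; first by move=> u hu; nra.
      by have -> : p + 0 * (q - p) = p by [ring]; rewrite -gp -surjective_pairing.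
    by have -> : p + 1 * (q - p) = q by [ring]; rewrite -gq -surjective_pairing.
  exists (fun u => q + u * (p - q)); split => //; first by move=> u hu; nra.
    by have -> : q + 0 * (p - q) = q by [ring]; rewrite -gq -surjective_pairing.
  by have -> : q + 1 * (p - q) = p by [ring]; rewrite -gp -surjective_pairing.
have [f [cf f01 f0 f1]] := param a b ab ga gb.
have [f' [cf' f'01 f'0 f'1]] := param c d cd gc gd.
pose S (z : pt) : pt := (z.1, sg * z.2).
have cS : continuous S.
  apply: cont_pair; first by apply: cont_fst; exact: cont_id.
  by apply: cont_mul; [exact: cont_cst|apply: cont_snd; exact: cont_id].
have cA : continuous (fun u => S (g (f u))) by apply: cont_comp cS; apply: cont_comp cg.
have cB : continuous (fun u => S (g (f' u))) by apply: cont_comp cS; apply: cont_comp cg.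
have h12 : Num.min (g a).1 (g b).1 <= Num.min (g c).1 (g d).1 <= Num.max (g a).1 (g b).1 by rewrite h1 h2.
have [||||||u [v [hu hv E1]]] := curves_meet cA cB h12 h3.
- by rewrite f0 /S /= mulr0.
- by rewrite f1 /S /= mulr0.
- by rewrite f'0 /S /= mulr0.
- by rewrite f'1 /S /= mulr0.
- by move=> u hu; apply: pos; left; exact: f01.
- by move=> u hu; apply: pos; right; exact: f'01.
exists (f u), (f' v); split; [exact: f01|exact: f'01|].
by case: E1 => E1 /(mulfI sg0) E2; apply: pt_ext.
Qed.

End Crossing.

(** * Homotopy from the crossing pattern with the axis *)

Section Homotopy.
Variable R : realType.
Notation pt := (R * R)%type.
Implicit Types (A : set pt) (c d g : R -> pt).

(** Homotopies are continuous on the whole plane here, which makes them easy to compose; the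
    restriction to the unit square comes at the very end. *)
Definition phom A c d : Prop := exists H : pt -> pt,
  [/\ continuous H,
      forall t : R, 0 <= t <= 1 -> H (0, t) = c t /\ H (1, t) = d t,
      forall u : R, 0 <= u <= 1 -> H (u, 0) = c 0 /\ H (u, 1) = c 1
    & forall u t : R, 0 <= u <= 1 -> 0 <= t <= 1 -> A (H (u, t))].

Lemma cont_pfst : continuous (fun z : pt => z.1).
Proof. by apply: cont_fst; exact: cont_id. Qed.

Lemma cont_psnd : continuous (fun z : pt => z.2).
Proof. by apply: cont_snd; exact: cont_id. Qed.

Lemma phom_ends A c d : phom A c d -> c 0 = d 0 /\ c 1 = d 1.
Proof.
move=> [H [_ h1 h2 _]]; have [_ <-] := h1 0 ltac:(lra); have [_ <-] := h1 1 ltac:(lra).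
by have [-> ->] := h2 1 ltac:(lra).
Qed.

Lemma phom_sym A c d : phom A c d -> phom A d c.
Proof.
move=> hcd; have [e0 e1] := phom_ends hcd; have [H [cH h1 h2 h3]] := hcd.
exists (fun z => H (1 - z.1, z.2)); split.
- apply: cont_comp cH; apply: cont_pair; last exact: cont_psnd.
  by apply: cont_sub; [exact: cont_cst|exact: cont_pfst].
- by move=> t ht /=; rewrite subr0 subrr; have [-> ->] := h1 t ht.
- by move=> u hu /=; rewrite -e0 -e1; apply: h2; lra.
- by move=> u t hu ht; apply: h3 => //=; lra.
Qed.

Lemma phom_trans A c d g : phom A c d -> phom A d g -> phom A c g.
Proof.
move=> hcd hdg; have [e0 e1] := phom_ends hcd.
have [H [cH h1 h2 h3]] := hcd; have [K [cK k1 k2 k3]] := hdg.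
(* The clamps freeze one homotopy while the other moves; subtracting the common middle curve glues
   them without a case distinction, so continuity is immediate. *)
pose L (z : pt) : pt := H (clamp (2 * z.1), clamp z.2) + K (clamp (2 * z.1 - 1), clamp z.2) - H (1, clamp z.2).
have c2 : continuous (fun z : pt => clamp z.2) by apply: cont_comp (@cont_psnd) (@clamp_cont R).
have c2u : continuous (fun z : pt => 2 * z.1) by apply: cont_mul; [exact: cont_cst|exact: cont_pfst].
have LE1 u t : u <= 1 / 2 -> 0 <= t <= 1 -> 0 <= u -> L (u, t) = H (2 * u, t).
  move=> hu ht u0; rewrite /L /= (clamp_id ht) clamp_id; last lra.
  rewrite clamp_le0; last lra.
  by have [_ ->] := h1 t ht; have [-> _] := k1 t ht; pt_ring.
have LE2 u t : 1 / 2 <= u -> 0 <= t <= 1 -> u <= 1 -> L (u, t) = K (2 * u - 1, t).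
  move=> hu ht u1; rewrite /L /= (clamp_id ht) clamp_ge1; last lra.
  by rewrite clamp_id; [pt_ring|lra].
exists L; split.
- apply: cont_sub.
    apply: cont_add; [apply: cont_comp cH|apply: cont_comp cK]; apply: cont_pair => //.
      exact: cont_comp (@clamp_cont R).
    by apply: cont_comp (@clamp_cont R); apply: cont_sub => //; exact: cont_cst.
  by apply: cont_comp cH; apply: cont_pair => //; exact: cont_cst.
- move=> t ht; split.
    by rewrite (LE1 0 t ltac:(lra) ht ltac:(lra)) mulr0; have [] := h1 t ht.
  rewrite (LE2 1 t ltac:(lra) ht ltac:(lra)).
  by have -> : 2 * 1 - 1 = 1 :> R by [ring]; have [] := k1 t ht.
- move=> u hu; have [h|h] := leP u (1 / 2).
    by rewrite (LE1 u 0 h ltac:(lra) ltac:(lra)) (LE1 u 1 h ltac:(lra) ltac:(lra)); apply: h2; lra.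
  rewrite (LE2 u 0 (ltW h) ltac:(lra) ltac:(lra)) (LE2 u 1 (ltW h) ltac:(lra) ltac:(lra)).
  by rewrite e0 e1; apply: k2; lra.
- move=> u t hu ht; have [h|h] := leP u (1 / 2).
    by rewrite (LE1 u t h ht ltac:(lra)); apply: h3 => //; lra.
  by rewrite (LE2 u t (ltW h) ht ltac:(lra)); apply: k3 => //; lra.
Qed.

Lemma phom_linear A c d : continuous c -> continuous d -> c 0 = d 0 -> c 1 = d 1 ->
  (forall u t, 0 <= u <= 1 -> 0 <= t <= 1 -> A (c t + u *: (d t - c t))) -> phom A c d.
Proof.
move=> cc cd e0 e1 h; exists (fun z => c z.2 + z.1 *: (d z.2 - c z.2)); split.
- have c1 := cont_comp (@cont_psnd) cc; have c2 := cont_comp (@cont_psnd) cd.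
  apply: cont_add => //; apply: cont_scale; first exact: cont_pfst.
  exact: cont_sub.
- by move=> t ht; split => /=; pt_ring.
- by move=> u hu /=; rewrite -e0 -e1 !subrr !scaler0 !addr0.
- by move=> u t hu ht; exact: h.
Qed.

(** The signs are weak: points where the curve touches the axis without changing sides need not be
    listed. *)
Fixpoint alternates g (b sg a : R) (s : seq R) : Prop :=
  match s with
  | [::] => a < b /\ forall t, a <= t <= b -> 0 <= sg * (g t).2
  | x :: s' => [/\ a < x, (g x).2 = 0, forall t, a <= t <= x -> 0 <= sg * (g t).2
                & alternates g b (- sg) x s']
  end.

Lemma alternates_bounds g b sg a s : alternates g b sg a s -> a < b /\ forall x, x \in s -> a < x < b.
Proof.
elim: s a sg => [|x s IH] a sg /=; first by move=> [h _].
move=> [ax _ _ /IH[xb H]]; split; first lra.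
by move=> y; rewrite inE => /orP[/eqP ->|/H]; lra.
Qed.

Lemma alternates_extend g b sg a a' s : a' <= a -> (forall t, a' <= t <= a -> 0 <= sg * (g t).2) ->
  alternates g b sg a s -> alternates g b sg a' s.
Proof.
move=> aa H; case: s => [|x s] /=.
  move=> [ab h]; split; first lra.
  by move=> t ht; have [|] := leP t a => h'; [apply: H|apply: h]; lra.
move=> [ax gx h alt]; split => //; first lra.
by move=> t ht; have [|] := leP t a => h'; [apply: H|apply: h]; lra.
Qed.

Lemma constant_sign g (a b : R) : continuous g -> a < b -> (g a).2 = 0 -> (g b).2 = 0 ->
  (forall t, a < t < b -> (g t).2 <> 0) ->
  exists2 sg : R, sg = 1 \/ sg = -1 & forall t, a <= t <= b -> 0 <= sg * (g t).2.
Proof.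
move=> cg ab ga gb nz.
have cy : continuous (fun t => (g t).2) by exact: cont_snd.
have noIVT s t : a < s < b -> a < t < b -> (g s).2 < 0 -> 0 < (g t).2 -> False.
  move=> hs ht gs gt; have [st|ts] := leP s t.
    have [|r] := @IVT R _ s t 0 st (continuous_subspaceT cy); first by rewrite ge_min le_max (ltW gs) (ltW gt) orbT.
    by rewrite in_itv /= => hr; apply: nz; lra.
  have [|r] := @IVT R _ t s 0 (ltW ts) (continuous_subspaceT cy); first by rewrite ge_min le_max (ltW gs) (ltW gt) !orbT.
  by rewrite in_itv /= => hr; apply: nz; lra.
pose m := (a + b) / 2; have hm : a < m < b by rewrite /m; lra.
have ext sg : (forall t, a < t < b -> 0 <= sg * (g t).2) -> forall t, a <= t <= b -> 0 <= sg * (g t).2.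
  move=> H t ht; have [->|ta] := eqVneq t a; first by rewrite ga mulr0.
  have [->|tb] := eqVneq t b; first by rewrite gb mulr0.
  by apply: H; rewrite !lt_neqAle [a == t]eq_sym ta tb.
have [gm|gm] := ltP (g m).2 0.
  exists (-1); [by right|apply: ext => t ht].
  rewrite mulN1r oppr_ge0 leNgt; apply/negP => h; exact: (noIVT m t).
have gm' : 0 < (g m).2 by rewrite lt0r gm andbT; apply/eqP; exact: nz.
exists 1; [by left|apply: ext => t ht].
rewrite mul1r leNgt; apply/negP => h; exact: (noIVT t m).
Qed.

(** Zeros between arcs with the same sign are dropped, so that the parity of its index tells the
    side of an arc. *)
Lemma alternates_exists g (Z : seq R) (a b : R) : continuous g -> a < b -> (g a).2 = 0 -> (g b).2 = 0 ->
  path <%R a Z -> (forall z, z \in Z -> z < b /\ (g z).2 = 0) ->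
  (forall t, a < t < b -> (g t).2 = 0 -> t \in Z) ->
  exists sg s, [/\ sg = 1 \/ sg = -1, alternates g b sg a s & forall x, x \in s -> (g x).2 = 0].
Proof.
move=> cg; elim: Z a => [|z Z IH] a ab ga gb pZ HZ nz.
  have [|sg hsg H] := constant_sign cg ab ga gb.
    by move=> t ht /(nz t ht).
  by exists sg, [::]; split.
move: pZ => /= /andP[az pZ].
have [zb gz] := HZ z (mem_head _ _).
have [||sg2 [s2 [hs2 alt2 z2]]] := IH z zb gz gb pZ.
- by move=> x xZ; apply: HZ; rewrite inE xZ orbT.
- move=> t ht gt; have := nz t _ gt; rewrite inE => /(_ _)/orP[|/eqP|//]; first lra.
  by move=> E1; exfalso; lra.
have [|sg1 hs1 H1] := constant_sign cg az ga gz.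
  move=> t ht gt; have := nz t _ gt; rewrite inE => /(_ _)/orP[|/eqP|]; first lra.
    lra.
  by move/(order_path_min lt_trans)/allP: pZ => /[apply]; lra.
have [E1|n12] := eqVneq sg1 sg2.
  by exists sg2, s2; split => //; apply: alternates_extend alt2; [exact: ltW|rewrite -E1].
exists sg1, (z :: s2); split => //.
  split => //; have -> // : - sg1 = sg2.
  by case: hs1 hs2 n12 => -> [] ->; rewrite ?eqxx ?opprK.
by move=> x; rewrite inE => /orP[/eqP ->|/z2].
Qed.

Definition tau (s : seq R) (i : nat) : R := nth 0 (0 :: rcons s 1) i.

Lemma alternates_nth g b sg a s i : alternates g b sg a s -> (i <= size s)%N ->
  let T := a :: rcons s b in
  nth 0 T i < nth 0 T i.+1 /\
  forall t, nth 0 T i <= t <= nth 0 T i.+1 -> 0 <= sg * (-1) ^+ i * (g t).2.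
Proof.
elim: s sg a i => [|x s IH] sg a [|i] //= alt hi.
- by move: alt => [h1 h2]; split => // t ht; rewrite expr0 mulr1; exact: h2.
- by move: alt => [h1 _ h2 _]; split => // t ht; rewrite expr0 mulr1; exact: h2.
- move: alt => [_ _ _ alt]; have [h1 h2] := IH _ _ i alt hi; split => // t ht.
  by rewrite exprS mulrA mulrN1; exact: h2.
Qed.

(** [sin (pi * x)] serves as a bump that vanishes at the integers and alternates like the arcs. *)
Lemma sin_sign (i : nat) (x : R) : i%:R < x < i.+1%:R -> 0 < (-1) ^+ i * sin (pi * x).
Proof.
elim: i x => [|i IH] x hx.
  rewrite expr0 mul1r; apply: sin_gt0_pi.
  have p0 := pi_gt0 R; have {}hx : 0 < x < 1 by [].
  by rewrite mulr_gt0 ?gtr_pMr; lra.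
have -> : pi * x = pi * (x - 1) + pi by ring.
rewrite sinDpi exprS mulN1r mulrNN; apply: IH.
by move: hx; rewrite -!natr1; lra.
Qed.

Lemma sin_nat (i : nat) : sin (pi * i%:R : R) = 0.
Proof.
elim: i => [|i IH]; first by rewrite mulr0 sin0.
by rewrite -natr1 mulrDr mulr1 sinDpi IH oppr0.
Qed.

Lemma interp_nat (f : nat -> pt) (n m i : nat) (x : R) : (n <= i < n + m)%N -> i%:R <= x <= i.+1%:R ->
  interp (n%:R, f n) [seq (j%:R, f j) | j <- iota n.+1 m] x = f i + (x - i%:R) *: (f i.+1 - f i).
Proof.
elim: m n => [|m IH] n hi hx; first by rewrite addn0 in hi; lia.
rewrite /=; case: ifP => h.
  have [E1|ni] := eqVneq i n.
    subst i; rewrite -!natr1 addrAC subrr add0r divr1 clamp_id //.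
    by move: hx; rewrite -natr1; lra.
  have ni' : (n.+1 <= i)%N by lia.
  have hn : (n.+1%:R <= i%:R :> R) by rewrite ler_nat.
  have xi : x = i%:R by lra.
  have En : i = n.+1 by apply/eqP; rewrite -(eqr_nat R) eq_le hn andbT -xi h.
  rewrite xi En subrr scale0r addr0 -!natr1 addrAC subrr add0r divr1 clamp_id; last by lra.
  by rewrite scale1r addrC subrK.
have : (n.+1 <= i)%N.
  rewrite ltnNge; apply/negP => le; have : (i.+1%:R <= n.+1%:R :> R) by rewrite ler_nat.
  by move/negP: h; lra.
by move=> ni; apply: IH => //; lia.
Qed.

End Homotopy.

(** * Curves with the same sides and gaps are homotopic *)

Section Signature.
Variable R : realType.
Notation pt := (R * R)%type.
Implicit Types (A : set pt) (g : R -> pt).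

Lemma nat_interval (m : nat) (x : R) : 0 <= x < m%:R ->
  exists i : nat, (i < m)%N /\ i%:R <= x < i.+1%:R.
Proof.
move=> /andP[x0 xm]; exists (Num.truncn x); have /andP[h1 h2] := truncn_itv x0.
by rewrite h1 h2 -(ltr_nat R); split => //; exact: le_lt_trans xm.
Qed.

(** Time is changed so that the integer i goes to the i-th listed point; two curves with equally
    many points then reach them simultaneously. *)
Lemma ramp (T : nat -> R) (m : nat) : (0 < m)%N -> T 0%N = 0 -> T m = 1 ->
  (forall i, (i < m)%N -> T i < T i.+1) ->
  exists psi : R -> R, [/\ continuous psi, psi 0 = 0, psi m%:R = 1,
    forall i (x : R), (i < m)%N -> i%:R <= x <= i.+1%:R -> psi x = T i + (x - i%:R) * (T i.+1 - T i)
    & forall x, 0 < x < m%:R -> 0 < psi x < 1].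
Proof.
move=> m0 T0 Tm Tinc.
pose f i : pt := (T i, 0).
pose ps x := (interp (0%:R, f 0%N) [seq (j%:R, f j) | j <- iota 1 m] x).1.
have psE i (x : R) : (i < m)%N -> i%:R <= x <= i.+1%:R -> ps x = T i + (x - i%:R) * (T i.+1 - T i).
  by move=> im hx; rewrite /ps (@interp_nat R f 0 m i).
have Tge i : (i <= m)%N -> 0 <= T i.
  elim: i => [|i IH] im; first by rewrite T0.
  by apply: le_trans (ltW (Tinc i im)); apply: IH; exact: ltnW.
have Tle i : (i <= m)%N -> T i <= 1.
  move=> im; rewrite -(subKn im); elim: (m - i)%N (leq_subr i m) => [|j IH] jm; first by rewrite subn0 Tm.
  have lt : (m - j.+1 < m)%N by lia.
  have E1 : ((m - j.+1).+1 = m - j)%N by lia.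
  by apply: (le_trans (ltW (Tinc _ lt))); rewrite E1; apply: IH; exact: ltnW.
exists ps; split => //.
- apply: cont_fst; apply: plc_continuous; apply: interp_plc.
  have pth n k : path (fun x y : R * pt => x.1 < y.1) (n%:R, f n) [seq (j%:R, f j) | j <- iota n.+1 k].
    by elim: k n => //= k IH n; rewrite ltr_nat ltnSn IH.
  exact: pth.
- by rewrite (psE 0%N) //; [rewrite T0 subrr mul0r addr0|rewrite lexx ler0n].
- have lt : (m.-1 < m)%N by rewrite prednK.
  rewrite (psE m.-1) ?prednK//; last by rewrite lexx andbT ler_nat leq_pred.
  rewrite Tm -[in m%:R](prednK m0) -natr1; ring.
- move=> x hx; have [|i [im hi]] := @nat_interval m x; first lra.
  rewrite (psE i) //; last lra.
  have := Tinc i im; have := Tge i (ltnW im); have := Tle i.+1 im => h1 h2 h3.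
  have [E1|n1] := eqVneq x i%:R.
    have i0 : (0 < i)%N by rewrite -(ltr_nat R) -E1; lra.
    rewrite E1 subrr mul0r addr0; have := Tinc i.-1; rewrite prednK// => /(_ (ltnW im)) h4.
    by have := Tge i.-1 (leq_trans (leq_pred _) (ltnW im)); lra.
  have xi : 0 < x - i%:R < 1.
    by move: hi; rewrite -natr1 => hi; rewrite subr_gt0 lt_neqAle eq_sym n1; lra.
  by nra.
Qed.

Lemma phom_reparam A g (psi : R -> R) (m : R) : continuous g -> continuous psi -> 0 < m ->
  psi 0 = 0 -> psi m = 1 -> (forall x, 0 < x < m -> 0 < psi x < 1) ->
  (forall t, 0 <= t <= 1 -> A (g t)) -> phom A g (fun t => g (psi (m * t))).
Proof.
move=> cg cp m0 p0 p1 pin Ag.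
exists (fun z => g ((1 - z.1) * z.2 + z.1 * psi (m * z.2))); split.
- apply: cont_comp cg; apply: cont_add; apply: cont_mul.
  + by apply: cont_sub; [exact: cont_cst|exact: cont_pfst].
  + exact: cont_psnd.
  + exact: cont_pfst.
  + by apply: cont_comp cp; apply: cont_mul; [exact: cont_cst|exact: cont_psnd].
- by move=> t ht; split => /=; congr g; ring.
- move=> u hu /=; split; congr g; first by rewrite !mulr0 p0; ring.
  by rewrite !mulr1 p1; ring.
- move=> u t hu ht /=; apply: Ag.
  have : 0 <= psi (m * t) <= 1.
    have [->|t0] := eqVneq t 0; first by rewrite mulr0 p0; lra.
    have [->|t1] := eqVneq t 1; first by rewrite mulr1 p1; lra.
    have t01 : 0 < t < 1 by rewrite !lt_neqAle [0 == t]eq_sym t0 t1; lra.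
    have mt : 0 < m * t < m.
      by apply/andP; split; [apply: mulr_gt0; lra|rewrite gtr_pMr; lra].
    by have := pin _ mt; lra.
  by move=> hp; nra.
Qed.

(** The homotopy is linear plus a vertical bump. At integer times both points lie on the axis with
    the same vertices to their left, so no vertex is between them. At other times both lie weakly on
    the same side and the bump pushes the intermediate points strictly off the axis, where there is
    no vertex. *)
Lemma same_signature (V : finType) (P : V -> pt) A g g' (sg : R) (s s' : seq R) :
  continuous g -> continuous g' -> g 0 = g' 0 -> g 1 = g' 1 -> sg = 1 \/ sg = -1 ->
  size s = size s' -> alternates g 1 sg 0 s -> alternates g' 1 sg 0 s' ->
  (forall x, x \in s -> (g x).2 = 0) -> (forall x, x \in s' -> (g' x).2 = 0) ->
  (forall w, (P w).2 = 0) ->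
  (forall i w, (i < size s)%N ->
     ((P w).1 < (g (nth 0 s i)).1) = ((P w).1 < (g' (nth 0 s' i)).1)) ->
  (forall t w, 0 < t < 1 -> g t <> P w) -> (forall t w, 0 < t < 1 -> g' t <> P w) ->
  A (g 0) -> A (g 1) -> (forall z, (forall w, z <> P w) -> A z) -> phom A g g'.
Proof.
move=> cg cg' e0 e1 hsg ss alt alt' zs zs' P0 gap av av' A0 A1 AP.
pose m := (size s).+1.
have mE' : m = (size s').+1 by rewrite /m ss.
have tauP (h : R -> pt) (u : seq R) : size u = size s -> alternates h 1 sg 0 u ->
    tau u 0 = 0 /\ tau u m = 1 /\ (forall i, (i < m)%N -> tau u i < tau u i.+1) /\
    (forall i t, (i < m)%N -> tau u i <= t <= tau u i.+1 -> 0 <= sg * (-1) ^+ i * (h t).2).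
  move=> su al; split => //; split; first by rewrite /tau /m -su /= nth_rcons ltnn eqxx.
  have im' i : (i < m)%N -> (i <= size u)%N by rewrite su.
  by split=> [i /im' im|i t /im' im]; have [h1 h2] := alternates_nth al im; last exact: h2.
have [t0 [t1 [tinc tpos]]] := tauP g s erefl alt.
have [t0' [t1' [tinc' tpos']]] := tauP g' s' (esym ss) alt'.
have [ps [cps p0 p1 pE pin]] := @ramp (tau s) m isT t0 t1 tinc.
have [ps' [cps' p0' p1' pE' pin']] := @ramp (tau s') m isT t0' t1' tinc'.
have mR : 0 < m%:R :> R by rewrite ltr0n.
have Ag t : 0 <= t <= 1 -> A (g t).
  move=> ht; have [->//|n0] := eqVneq t 0; have [->//|n1] := eqVneq t 1.
  by apply: AP => w; apply: av; rewrite !lt_neqAle [0 == t]eq_sym n0 n1; lra.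
have Ag' t : 0 <= t <= 1 -> A (g' t).
  move=> ht; have [->|n0] := eqVneq t 0; first by rewrite -e0.
  have [->|n1] := eqVneq t 1; first by rewrite -e1.
  by apply: AP => w; apply: av'; rewrite !lt_neqAle [0 == t]eq_sym n0 n1; lra.
apply: (phom_trans (phom_reparam cg cps mR p0 p1 pin Ag)).
apply: phom_sym; apply: (phom_trans (phom_reparam cg' cps' mR p0' p1' pin' Ag')).
apply: phom_sym.
pose E t := g (ps (m%:R * t)); pose F t := g' (ps' (m%:R * t)).
pose bump (z : pt) : R := z.1 * (1 - z.1) * (sg * sin (pi * (m%:R * z.2))).
have cm : continuous (fun z : pt => m%:R * z.2) by apply: cont_mul; [exact: cont_cst|exact: cont_psnd].
have cE : continuous (fun z : pt => E z.2) by apply: cont_comp cg; apply: cont_comp cps.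
have cF : continuous (fun z : pt => F z.2) by apply: cont_comp cg'; apply: cont_comp cps'.
have cb : continuous bump.
  apply: cont_mul.
    apply: cont_mul; first exact: cont_pfst.
    by apply: cont_sub; [exact: cont_cst|exact: cont_pfst].
  apply: cont_mul; first exact: cont_cst.
  apply: (cont_comp (f := fun z : pt => pi * (m%:R * z.2)) (h := sin)); last exact: continuous_sin.
  by apply: cont_mul; [exact: cont_cst|exact: cm].
exists (fun z => E z.2 + z.1 *: (F z.2 - E z.2) + (0, bump z)); split.
- apply: cont_add; last by apply: cont_pair => //; exact: cont_cst.
  apply: cont_add => //; apply: cont_scale; first exact: cont_pfst.
  exact: cont_sub.
- move=> t ht; split; rewrite /bump; pt_ring.
- move=> u hu; rewrite /bump /E /F /= !mulr0 !mulr1 p0 p0' p1 p1' e0 e1 !subrr !scaler0 sin_nat.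
  by rewrite mulr0 sin0 !mulr0; split; pt_ring.
- move=> u t hu ht /=.
  have [Et|n0] := eqVneq t 0.
    by rewrite /bump /E /F Et /= !mulr0 p0 p0' -e0 subrr scaler0 sin0 !mulr0 !addr0.
  have [Et|n1] := eqVneq t 1.
    by rewrite /bump /E /F Et /= !mulr1 p1 p1' -e1 subrr scaler0 sin_nat !mulr0 !addr0.
  have t01 : 0 < t < 1 by rewrite !lt_neqAle [0 == t]eq_sym n0 n1; lra.
  set x := m%:R * t; have x0m : 0 < x < m%:R.
    by apply/andP; split; [apply: mulr_gt0; lra|rewrite /x gtr_pMr; lra].
  have pin1 := pin x x0m; have pin2 := pin' x x0m.
  have [Eu|u0] := eqVneq u 0.
    have -> : E t + u *: (F t - E t) + (0, bump (u, t)) = g (ps x) by rewrite Eu /bump /E -/x; pt_ring.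
    by apply: Ag; lra.
  have [Eu|u1] := eqVneq u 1.
    have -> : E t + u *: (F t - E t) + (0, bump (u, t)) = g' (ps' x) by rewrite Eu /bump /F -/x; pt_ring.
    by apply: Ag'; lra.
  have u01 : 0 < u < 1 by rewrite !lt_neqAle [0 == u]eq_sym u0 u1; lra.
  have [|i [im hi]] := @nat_interval m x; first lra.
  apply: AP => w Ew; have Ew1 := congr1 fst Ew; have Ew2 := congr1 snd Ew.
  move: Ew1 Ew2; rewrite /= !scaleRE P0 /bump /E /F -/x /= => Ew1 Ew2.
  clear Ew cE cF cb E F bump; clearbody x.
  have ttau k (v : seq R) : size v = size s -> (0 < k < m)%N -> tau v k = nth 0 v k.-1 /\ nth 0 v k.-1 \in v.
    case: k => // k sv hk; rewrite /tau /= nth_rcons sv ifT //; split => //.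
    by apply: mem_nth; rewrite sv.
  have [xi|nxi] := eqVneq x i%:R.
    have i0 : (0 < i)%N by rewrite -(ltr_nat R) -xi; lra.
    have hi' : i%:R <= x <= i.+1%:R by lra.
    have E1 : ps x = tau s i by rewrite (pE i x im hi') xi subrr mul0r addr0.
    have E2 : ps' x = tau s' i by rewrite (pE' i x im hi') xi subrr mul0r addr0.
    have i0m : (0 < i < m)%N by rewrite i0.
    have [F1 M1] := ttau i s erefl i0m; have [F2 M2] := ttau i s' (esym ss) i0m.
    have im1 : (i.-1 < size s)%N by rewrite -ltnS prednK.
    have := gap i.-1 w im1; rewrite -F1 -F2 -E1 -E2.
    have N1 : (g (ps x)).1 <> (P w).1.
      move=> EE; apply: (av (ps x) w pin1); apply: pt_ext => //.
      by rewrite P0 E1 F1; exact: zs.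
    have N2 : (g' (ps' x)).1 <> (P w).1.
      move=> EE; apply: (av' (ps' x) w pin2); apply: pt_ext => //.
      by rewrite P0 E2 F2; exact: zs'.
    move: Ew1 N1 N2; rewrite addr0; move: (g _).1 (g' _).1 (P w).1 => X Y Z Ew1 N1 N2; clear -u01 Ew1 N1 N2.
    case: ltP => h1 /esym; [move=> h2; nra|move/negbT; rewrite -leNgt => h2].
    have h1' : X < Z by rewrite lt_neqAle h1 andbT; exact/eqP.
    by nra.
  have xi : i%:R < x < i.+1%:R by rewrite lt_neqAle eq_sym nxi; lra.
  have S := sin_sign xi.
  have hi' : i%:R <= x <= i.+1%:R by lra.
  have xi1 : 0 <= x - i%:R <= 1 by move: hi'; rewrite -natr1; lra.
  have Y1 : 0 <= sg * (-1) ^+ i * (g (ps x)).2.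
    by apply: tpos => //; rewrite (pE i x im hi'); have := tinc i im; clear -xi1; nra.
  have Y2 : 0 <= sg * (-1) ^+ i * (g' (ps' x)).2.
    by apply: tpos' => //; rewrite (pE' i x im hi'); have := tinc' i im; clear -xi1; nra.
  have sg2 : sg * sg = 1 by case: hsg => ->; ring.
  have : sg * (-1) ^+ i * ((g (ps x)).2 + u * ((g' (ps' x)).2 - (g (ps x)).2) + u * (1 - u) * (sg * sin (pi * x))) = 0.
    by rewrite Ew2 mulr0.
  have -> : sg * (-1) ^+ i * ((g (ps x)).2 + u * ((g' (ps' x)).2 - (g (ps x)).2) + u * (1 - u) * (sg * sin (pi * x))) =
    (1 - u) * (sg * (-1) ^+ i * (g (ps x)).2) + u * (sg * (-1) ^+ i * (g' (ps' x)).2) +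
    u * (1 - u) * ((sg * sg) * ((-1) ^+ i * sin (pi * x))) by ring.
  rewrite sg2 mul1r => Z.
  have h1 : 0 <= (1 - u) * (sg * (-1) ^+ i * (g (ps x)).2) by apply: mulr_ge0 => //; lra.
  have h2 : 0 <= u * (sg * (-1) ^+ i * (g' (ps' x)).2) by apply: mulr_ge0 => //; lra.
  have h3 : 0 < u * (1 - u) * ((-1) ^+ i * sin (pi * x)) by apply: mulr_gt0 => //; apply: mulr_gt0; lra.
  by clear -h1 h2 h3 Z; lra.
Qed.

End Signature.

(** * Coding the crossing pattern *)

Section Matchings.

(* Read the positions from left to right: the chords open at [r] are known, and
   the one closed at [r] has a prescribed number of open chords to its right. *)
Lemma matching_unique (N : nat) (m m' : 'I_N -> 'I_N) : involutive m -> involutive m' ->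
  (forall r : 'I_N, (r < m r)%N = (r < m' r)%N) -> (forall r : 'I_N, (m r < r)%N = (m' r < r)%N) ->
  (forall r : 'I_N, (m r < r)%N ->
    #|[set a : 'I_N | [&& (m r < a)%N, (a < r)%N & (r < m a)%N]]%SET| =
    #|[set a : 'I_N | [&& (m' r < a)%N, (a < r)%N & (r < m' a)%N]]%SET|) ->
  m =1 m'.
Proof.
move=> im im' op cl dep.
have closers n : forall r : 'I_N, (r < n)%N -> (m r < r)%N -> m r = m' r.
  elim: n => // n IH r rn mr; have m'r : (m' r < r)%N by rewrite -cl.
  (* The left ends of the chords open just before [r]. The weak bound [r <= m a] includes the chord
     closed at [r], whose rank in [S] is the prescribed number. *)
  pose S := [set a : 'I_N | [&& (a < r)%N, (a < m a)%N & (r <= m a)%N]]%SET.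
  have SS' a : (a \in S) = [&& (a < r)%N, (a < m' a)%N & (r <= m' a)%N].
    rewrite inE -op; case: (ltnP a r) => //= ar; case: (ltnP a (m a)) => //= am.
    have am' : (a < m' a)%N by rewrite -op.
    apply/idP/idP => h; rewrite leqNgt; apply/negP => lt.
      have E : m (m' a) = m' (m' a).
        by apply: IH; [exact: leq_trans lt rn|rewrite cl im'].
      by rewrite im' in E; move: h; rewrite -E im leqNgt lt.
    have E : m (m a) = m' (m a).
      by apply: IH; [exact: leq_trans lt rn|rewrite im].
    by rewrite im in E; move: h; rewrite [in m' a]E im' leqNgt lt.
  have D1 : [set a : 'I_N | [&& (m r < a)%N, (a < r)%N & (r < m a)%N]]%SET = [set a in S | (m r < a)%N]%SET.
    apply/setP => a; rewrite !inE andbC; case: (ltnP a r) => //= ar; case: (ltnP (m r) a) => /= [mra|]; last by rewrite ?andbF.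
    rewrite !andbT; apply/idP/idP => [h|/andP[_ h]]; first by rewrite (ltn_trans ar h) ltnW.
    rewrite ltn_neqAle h andbT; apply/eqP => E.
    have E2 : r = m a by exact: val_inj.
    by move: mra; rewrite E2 im ltnn.
  have D2 : [set a : 'I_N | [&& (m' r < a)%N, (a < r)%N & (r < m' a)%N]]%SET = [set a in S | (m' r < a)%N]%SET.
    apply/setP => a; rewrite [in RHS]inE SS' !inE andbC; case: (ltnP a r) => //= ar; case: (ltnP (m' r) a) => /= [mra|]; last by rewrite ?andbF.
    rewrite !andbT; apply/idP/idP => [h|/andP[_ h]]; first by rewrite (ltn_trans ar h) ltnW.
    rewrite ltn_neqAle h andbT; apply/eqP => E.
    have E2 : r = m' a by exact: val_inj.
    by move: mra; rewrite E2 im' ltnn.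
  have mS : m r \in S by rewrite inE mr im mr leqnn.
  have m'S : m' r \in S by rewrite SS' m'r im' m'r leqnn.
  have := dep r mr; rewrite D1 D2 => Ec; apply: val_inj => /=.
  have key (x y : 'I_N) : y \in S -> (x < y)%N -> (#|[set a in S | (y < a)%N]%SET| < #|[set a in S | (x < a)%N]%SET|)%N.
    move=> yS xy; apply: proper_card; apply/fintype.properP; split.
      by apply/fintype.subsetP => a; rewrite !inE => /andP[-> /(ltn_trans xy)].
    by exists y; [rewrite inE yS|rewrite inE ltnn andbF].
  case: (ltngtP (m r) (m' r)) => // lt.
    by have := key _ _ m'S lt; rewrite Ec ltnn.
  by have := key _ _ mS lt; rewrite Ec ltnn.
move=> r; have [lt|gt|E] := ltngtP r (m r); last 1 first.
- have n1 : (r < m' r)%N = false by rewrite -op -E ltnn.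
  have n2 : (m' r < r)%N = false by rewrite -cl -E ltnn.
  apply: val_inj => /=; rewrite -E.
  by move: n1 n2; case: (ltngtP r (m' r)).
- have h : (m (m r) < m r)%N by rewrite im.
  by have := closers N (m r) (ltn_ord _) h; rewrite im => /(congr1 m'); rewrite im'.
- exact: (closers N).
Qed.

End Matchings.

(** * Blocks and words over nine letters *)

Section Words.

(** Four letters end a block, three count in unary and two mark the ends of the curve: nine in
    all. *)
Definition letter := (bool * bool + 'I_5)%type.
Definition block := (nat * nat * nat * nat * (bool * bool))%type.

Definition sym (i : nat) (h : (i < 5)%N) : letter := inr (Ordinal h).

(** Unary counts are affordable, since the gap increments of a curve sum to at most n and the depths
    on each side to at most k + 1. *)
Definition enc (b : block) : seq letter :=
  let: (a1, a2, a3, k, kd) := b in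
  nseq a1 (@sym 0 isT) ++ nseq a2 (@sym 1 isT) ++ nseq a3 (@sym 2 isT) ++
  (if k is k'.+1 then if k' is 0%N then [:: @sym 3 isT] else [:: @sym 4 isT] else [::]) ++ [:: inl kd].

Fixpoint dec (a1 a2 a3 k : nat) (w : seq letter) : seq block :=
  match w with
  | [::] => [::]
  | inl kd :: w' => (a1, a2, a3, k, kd) :: dec 0 0 0 0 w'
  | inr x :: w' => match val x with
      | 0%N => dec a1.+1 a2 a3 k w' | 1%N => dec a1 a2.+1 a3 k w' | 2%N => dec a1 a2 a3.+1 k w'
      | 3%N => dec a1 a2 a3 1 w' | _ => dec a1 a2 a3 2 w' end
  end.

Lemma dec_enc (b : block) (w : seq letter) : (b.1.2 <= 2)%N -> dec 0 0 0 0 (enc b ++ w) = b :: dec 0 0 0 0 w.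
Proof.
case: b => [[[[a1 a2] a3] k] kd] /= hk; rewrite /enc -!catA.
have E1 n x u : dec x 0 0 0 (nseq n (@sym 0 isT) ++ u) = dec (n + x) 0 0 0 u.
  by elim: n x => //= n IH x; rewrite IH addnS.
have E2 n x y u : dec x y 0 0 (nseq n (@sym 1 isT) ++ u) = dec x (n + y) 0 0 u.
  by elim: n y => //= n IH y; rewrite IH addnS.
have E3 n x y z u : dec x y z 0 (nseq n (@sym 2 isT) ++ u) = dec x y (n + z) 0 u.
  by elim: n z => //= n IH z; rewrite IH addnS.
by rewrite E1 E2 E3 !addn0; case: k hk => [|[|[|]]].
Qed.

(** An unfinished block is discarded, so words can be padded to a common length. *)
Lemma dec_pad n x : dec x 0 0 0 (nseq n (@sym 0 isT)) = [::].
Proof. by elim: n x => //= n IH x; rewrite IH. Qed.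

Lemma dec_word (bs : seq block) n : (forall b, b \in bs -> (b.1.2 <= 2)%N) ->
  dec 0 0 0 0 (flatten (map enc bs) ++ nseq n (@sym 0 isT)) = bs.
Proof.
elim: bs => [|b bs IH] H /=; first exact: dec_pad.
rewrite -catA dec_enc ?IH ?H ?mem_head// => b' b'in; apply: H.
by rewrite inE b'in orbT.
Qed.

Lemma size_enc (b : block) : (size (enc b) <= b.1.1.1.1 + b.1.1.1.2 + b.1.1.2 + (0 < b.1.2) + 1)%N.
Proof.
case: b => [[[[a1 a2] a3] k] kd]; rewrite /enc !size_cat !size_nseq /=.
by case: k => [|[|k]] /=; lia.
Qed.

End Words.

(** * Chords as matchings of the points on the axis *)

Section ChordCode.
Variables (R : realType) (p : nat) (X : 'I_p.+2 -> R) (b0 : bool) (gp : 'I_p.+2 -> nat).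
Notation pnt := 'I_p.+2.
Implicit Types (i j : pnt) (sd : bool).

(** Points on the axis may coincide, for instance the ends of a loop; the index along the curve
    breaks ties. *)
Definition plt i j := (X i < X j) || ((X i == X j) && (i < j)%N).

Hypothesis gp_mono : forall i j, plt i j -> (gp i <= gp j)%N.

Lemma plt_irr i : plt i i = false.
Proof. by rewrite /plt ltxx ltnn andbF. Qed.

Lemma plt_trans : transitive plt.
Proof.
move=> j i l; rewrite /plt => /orP[h|/andP[/eqP -> h]] /orP[h'|/andP[/eqP E h']].
- by rewrite (lt_trans h h').
- by rewrite -E h.
- by rewrite h'.
- by rewrite E eqxx (ltn_trans h h') orbT.
Qed.

Lemma plt_total i j : i != j -> plt i j || plt j i.
Proof.
rewrite /plt => ij; case: (ltgtP (X i) (X j)) => //= _.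
by case: (ltngtP i j) => //= E; move: ij; rewrite -val_eqE /= E eqxx.
Qed.

Definition rank i : nat := #|[set j | plt j i]%SET|.

Lemma rank_lt i : (rank i < p.+2)%N.
Proof.
rewrite -[X in (_ < X)%N](card_ord p.+2) -cardsT; apply: proper_card; apply/fintype.properP; split => //.
by exists i; rewrite ?inE ?plt_irr.
Qed.

Definition pos i : pnt := Ordinal (rank_lt i).

Lemma pos_lt i j : (pos i < pos j)%N = plt i j.
Proof.
have key i' j' : plt i' j' -> (rank i' < rank j')%N.
  move=> h; apply: proper_card; apply/fintype.properP; split.
    by apply/fintype.subsetP => l; rewrite !inE => /plt_trans; exact.
  by exists i'; rewrite !inE ?plt_irr.
apply/idP/idP; last exact: key.
move=> h; have [E|ij] := eqVneq i j; first by move: h; rewrite E ltnn.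
by have /orP[//|/key h'] := plt_total ij; move: h; rewrite /= ltnNge (ltnW h').
Qed.

Lemma pos_inj : injective pos.
Proof.
move=> i j E; apply/eqP; apply: contraT => /plt_total.
by rewrite -!pos_lt E ltnn.
Qed.

Definition ipos : pnt -> pnt := invF pos_inj.

Lemma iposK r : pos (ipos r) = r. Proof. exact: f_invF. Qed.
Lemma posK i : ipos (pos i) = i. Proof. exact: invF_f. Qed.

Definition side (j : nat) : bool := b0 (+) odd j.

(** The arc from point j to point j + 1 lies on [side j]. On each side the arcs match the points in
    pairs, except that the first and the last point each lack an arc on one side and are then their
    own mates. *)
Definition mate sd i : pnt :=
  if (i.+1 < p.+2)%N && (side i == sd) then inord i.+1
  else if (0 < i)%N && (side i.-1 == sd) then inord i.-1 else i.

Lemma side_pred i : (0 < i)%N -> side i.-1 = ~~ side i.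
Proof. by case: i => -[|i] //= h _; rewrite /side /= addbN negbK. Qed.

Lemma mateK sd : involutive (mate sd).
Proof.
move=> i; rewrite {2}/mate; case: ifP => [/andP[h1 /eqP h2]|h].
  have v : (inord i.+1 : pnt) = i.+1 :> nat by rewrite inordK.
  rewrite /mate v /=; have -> : (side i.+1 == sd) = false.
    by rewrite -h2 /side /= addbN; case: (b0 (+) odd i).
  by rewrite andbF /= h2 eqxx inord_val.
case: ifP => [/andP[h1 /eqP h2]|h'].
  have lt : (i.-1 < p.+2)%N by apply: leq_ltn_trans (leq_pred _) _.
  have v : (inord i.-1 : pnt) = i.-1 :> nat by rewrite inordK.
  by rewrite /mate v prednK// h2 eqxx ltn_ord /= inord_val.
by rewrite /mate h h'.
Qed.

Lemma mate_next i : (i.+1 < p.+2)%N -> mate (side i) i = inord i.+1.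
Proof. by move=> h; rewrite /mate h eqxx. Qed.

Lemma mate_fix sd i : (mate sd i == i) = ((i == 0%N :> nat) && (sd != b0)) || ((i == p.+1 :> nat) && (sd == side p.+1)).
Proof.
rewrite /mate; have [i0|i0] := posnP i.
  have E : i = ord0 by exact: val_inj.
  rewrite E /= /side /= addbF.
  by case: b0; case: sd => /=; rewrite ?eqxx // -val_eqE /= inordK.
have /= [ip|ip] := ltnP i.+1 p.+2.
  have -> : (i == p.+1 :> nat) = false by rewrite ltn_eqF// -ltnS.
  rewrite /= ; case: ifP => h0; first by rewrite -val_eqE /= inordK// gtn_eqF.
  rewrite side_pred//; case: ifP => h; first by rewrite -val_eqE /= inordK ?(ltn_trans _ (ltn_ord i)) ?ltn_eqF ?prednK.
  by move: h0 h; case: (side i); case: sd.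
have Ei : i = p.+1 :> nat by apply/eqP; rewrite eqn_leq -ltnS ltn_ord.
rewrite Ei /= eqxx /=; have := side_pred i0; rewrite Ei /= => ->.
case: (eqVneq sd (side p.+1)) => [->|].
  by case: (side p.+1) => /=; rewrite eqxx.
case: (side p.+1) sd => -[] //= _; rewrite -val_eqE /= inordK ?Ei ?ltn_eqF//; exact: ltnW.
Qed.

(** At a right end [i], the number of chords opened after the chord of [i] and still open when it
    closes, that is, chords crossing it. Summed over [i], every crossing pair on side [sd] is
    counted once; without crossings the chords form a plain parenthesis word. *)
Definition depth sd i : nat :=
  if plt (mate sd i) i then #|[set j | [&& plt (mate sd i) j, plt j i & plt i (mate sd j)]]%SET| else 0%N.

Definition mark i : nat := if i == 0%N :> nat then 1 else if i == p.+1 :> nat then 2 else 0.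

(** Two bits tell on which sides a chord opens. The first point has a single arc, so one of its bits
    is free to tell the side of that arc. *)
Definition kind i : bool * bool :=
  if i == 0%N :> nat then (b0, plt i (mate b0 i)) else (plt i (mate true i), plt i (mate false i)).

(** Increments of the gap from left to right; they telescope, so that all gaps together cost at most
    one letter per vertex. *)
Definition gdiff (r : pnt) : nat := (gp (ipos r) - (if (0 < r)%N then gp (ipos (inord r.-1)) else 0))%N.

Definition blk (r : pnt) : block :=
  (gdiff r, depth true (ipos r), depth false (ipos r), mark (ipos r), kind (ipos r)).

Definition blocks : seq block := [seq blk r | r <- enum 'I_p.+2].

Lemma gp_sorted (r : pnt) : (0 < r)%N -> (gp (ipos (inord r.-1)) <= gp (ipos r))%N.
Proof.
move=> r0; apply: gp_mono; rewrite -pos_lt !iposK inordK ?ltn_predL//.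
exact: leq_ltn_trans (leq_pred _) (ltn_ord _).
Qed.

Lemma sum_gdiff : (\sum_(r : pnt) gdiff r = gp (ipos ord_max))%N.
Proof.
have H n : (n < p.+2)%N -> (\sum_(0 <= r < n.+1) gdiff (inord r) = gp (ipos (inord n)))%N.
  elim: n => [|n IH] h; first by rewrite big_nat1 /gdiff inordK //= subn0.
  rewrite big_nat_recr//= IH ?(ltnW h)// /gdiff inordK//= subnKC//.
  by have := @gp_sorted (inord n.+1); rewrite inordK//=; exact.
have := H p.+1 (ltnSn _); rewrite big_mkord => E.
have -> : ord_max = inord p.+1 :> pnt by apply: val_inj; rewrite /= inordK.
by rewrite -E; apply: eq_bigr => r _; rewrite inord_val.
Qed.

(** Each of the [p.+2] points has one closing letter, and two of them carry a mark. *)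
Lemma size_blocks : (size (flatten (map enc blocks)) <=
  gp (ipos ord_max) + (\sum_i depth true i + \sum_i depth false i) + p.+4)%N.
Proof.
rewrite size_flatten /shape -map_comp sumnE big_map big_map big_enum /=.
apply: (@leq_trans (\sum_(r : pnt) (gdiff r + depth true (ipos r) + depth false (ipos r) + (0 < mark (ipos r)) + 1)))%N.
  by apply: leq_sum => r _; exact: (size_enc (blk r)).
rewrite !big_split /= sum_gdiff.
have re (F : pnt -> nat) : (\sum_r F (ipos r) = \sum_i F i)%N.
  rewrite (reindex pos) /=; last by exists ipos => x _; [exact: posK|exact: iposK].
  by apply: eq_bigr => i _; rewrite posK.
rewrite (re (depth true)) (re (depth false)) (re (fun i => (0 < mark i) : nat)).
have -> : (\sum_(r : pnt) 1 = p.+2)%N by rewrite sum1_card card_ord.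
have : (\sum_(i : pnt) (0 < mark i) <= 2)%N.
  have -> : (\sum_(i : pnt) (0 < mark i) = #|[set i | (0 < mark i)%N]%SET|)%N.
    by rewrite -sum1_card [RHS]big_mkcond /=; apply: eq_bigr => i _; rewrite inE; case: (0 < mark i)%N.
  apply: (@leq_trans #|[set ord0; ord_max : pnt]%SET|); last by rewrite cards2; case: (_ != _).
  apply: subset_leq_card; apply/fintype.subsetP => i; rewrite !inE /mark -!val_eqE /=.
  by case: (i == 0%N :> nat) => //; case: (i == p.+1 :> nat).
move: (gp _) (\sum_i depth true i)%N (\sum_i depth false i)%N (\sum_(i : pnt) (0 < mark i))%N => a b c d; lia.
Qed.

Lemma mark_le2 i : (mark i <= 2)%N.
Proof. by rewrite /mark; case: ifP => // _; case: ifP. Qed.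

End ChordCode.

Section CodeInj.
Variables (R : realType) (p : nat).
Notation pnt := 'I_p.+2.

(* Equal codes give equal matchings of positions on either side of the axis,
   and the curve is traced by alternating between the two matchings. *)
Lemma code_inj (X X' : pnt -> R) (b0 b0' : bool) (gp gp' : pnt -> nat) :
  (forall i j, plt X i j -> (gp i <= gp j)%N) -> (forall i j, plt X' i j -> (gp' i <= gp' j)%N) ->
  blocks X b0 gp = blocks X' b0' gp' -> b0 = b0' /\ gp =1 gp'.
Proof.
move=> mono mono' Eb.
have Er r : blk X b0 gp r = blk X' b0' gp' r.
  have Eat Y b g : nth (blk X b0 gp r) (blocks (R := R) Y b g) r = blk Y b g r.
    by rewrite /blocks (nth_map r) ?size_enum_ord// nth_ord_enum.
  by rewrite -Eat Eb Eat.
have Em r : mark (ipos X r) = mark (ipos X' r) by have [] := Er r.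
have Ek r : kind X b0 (ipos X r) = kind X' b0' (ipos X' r) by have [] := Er r.
have Ed sd r : depth X b0 sd (ipos X r) = depth X' b0' sd (ipos X' r).
  by have [_ d1 d2 _ _] := Er r; case: sd.
have zero r : (ipos X r == 0%N :> nat) = (ipos X' r == 0%N :> nat).
  have := Em r; rewrite /mark; case: eqP => _; case: eqP => _ //; case: eqP => //.
have lastp r : (ipos X r == p.+1 :> nat) = (ipos X' r == p.+1 :> nat).
  have := Em r; have := zero r; rewrite /mark.
  have [->|_] := eqVneq (ipos X r : nat) 0%N; first by move=> /esym/eqP ->.
  move=> /esym ->.
  by case: (ipos X r == p.+1 :> nat); case: (ipos X' r == p.+1 :> nat).
have Ebb : b0 = b0'.
  have := Ek (pos X ord0); have := zero (pos X ord0); rewrite posK /= /kind eqxx => <- /=.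
  by move=> [].
subst b0'; split => //.
pose m (Y : pnt -> R) sd (r : pnt) := pos Y (mate b0 sd (ipos Y r)).
have mK Y sd : involutive (m Y sd) by move=> r; rewrite /m posK mateK iposK.
have mlt Y sd (r : pnt) : (r < m Y sd r)%N = plt Y (ipos Y r) (mate b0 sd (ipos Y r)).
  by rewrite -{1}(iposK Y r) /m pos_lt.
have mgt Y sd (r : pnt) : (m Y sd r < r)%N = plt Y (mate b0 sd (ipos Y r)) (ipos Y r).
  by rewrite -{2}(iposK Y r) /m pos_lt.
have fixE sd r : (mate b0 sd (ipos X r) == ipos X r) = (mate b0 sd (ipos X' r) == ipos X' r).
  by rewrite !mate_fix zero lastp.
have opens sd (r : pnt) : (r < m X sd r)%N = (r < m X' sd r)%N.
  rewrite !mlt; have := Ek r; rewrite /kind zero; case: ifP => z.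
    have z0 : ipos X r == 0%N :> nat by rewrite zero.
    move=> [E]; have [->//|ns] := eqVneq sd b0.
    have f1 : mate b0 sd (ipos X r) == ipos X r by rewrite mate_fix z0 ns.
    have f2 : mate b0 sd (ipos X' r) == ipos X' r by rewrite -fixE.
    by rewrite (eqP f1) (eqP f2) !plt_irr.
  by case: sd => -[].
(* A point closes a chord exactly when it has a mate other than itself and opens none; the marks
   determine which points are their own mates. *)
have closes sd (r : pnt) : (m X sd r < r)%N = (m X' sd r < r)%N.
  have neg Y : (m Y sd r < r)%N = (mate b0 sd (ipos Y r) != ipos Y r) && ~~ (r < m Y sd r)%N.
    rewrite ltnNge leq_eqVlt negb_or; congr (~~ _ && _).
    by rewrite val_eqE eq_sym /m -{2}(iposK Y r) (inj_eq (@pos_inj _ _ Y)).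
  by rewrite !neg fixE opens.
have deps Y sd (r : pnt) : (m Y sd r < r)%N ->
    #|[set a : pnt | [&& (m Y sd r < a)%N, (a < r)%N & (r < m Y sd a)%N]]%SET| = depth Y b0 sd (ipos Y r).
  rewrite mgt => h; rewrite /depth h.
  rewrite -[RHS](card_imset _ (@pos_inj _ _ Y)); apply: eq_card => a.
  apply/idP/imsetP => [|[j + ->]]; rewrite inE => h'.
    exists (ipos Y a); last by rewrite iposK.
    rewrite inE -!(pos_lt Y) !iposK -/(m Y sd r); exact: h'.
  move: h'; rewrite ?inE -!(pos_lt Y) iposK -/(m Y sd r) /m posK; exact.
have mm sd : m X sd =1 m X' sd.
  apply: matching_unique => // r h; have h' : (m X' sd r < r)%N by rewrite -closes.
  by rewrite (deps X sd r h) (deps X' sd r h') Ed.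
(* Tracing the curve: the first point is marked, and point n + 1 is the mate of point n on the side
   of arc n. *)
have pE n : forall i : pnt, i = n :> nat -> pos X i = pos X' i.
  elim: n => [|n IH] i Ei.
    have E0 : i = ord0 by exact: val_inj.
    have := zero (pos X i); rewrite posK E0 eqxx => /esym/eqP h.
    by rewrite -[LHS](iposK X'); congr pos; exact: val_inj.
  have lt : (n < p.+2)%N by rewrite -ltnS -Ei ltnS ltnW.
  pose j : pnt := Ordinal lt.
  have Ej : mate b0 (side b0 j) j = i.
    by rewrite mate_next -?Ei //; apply: val_inj; rewrite /= inordK -?Ei.
  have := mm (side b0 j) (pos X j); rewrite {2}(IH j erefl) /m !posK Ej.
  exact.
have Eg r : gp (ipos X r) = gp' (ipos X' r).
  have H n : forall r : pnt, r = n :> nat -> gp (ipos X r) = gp' (ipos X' r).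
    elim: n => [|n IH] r' Er'; have [+ _ _ _ _] := Er r'; rewrite /gdiff Er' /=; first by rewrite !subn0.
    have lt : (n < p.+2)%N by rewrite -ltnS -Er' ltnS ltnW.
    move=> E; have e1 := IH (inord n) (inordK lt).
    have r0 : (0 < r')%N by rewrite Er'.
    have := gp_sorted mono r0; have := gp_sorted mono' r0; rewrite Er' /= => l1 l2.
    by rewrite -(subnK l2) -(subnK l1) E e1.
  exact: (H r r).
move=> i; have := Eg (pos X i); rewrite posK (pE i i erefl) posK; exact.
Qed.
End CodeInj.

(** * Crossing chords and self-intersections *)

Section Depth.
Variables (R : realType) (g : R -> R * R) (sg : R) (s : seq R) (k : nat).
Hypotheses (cg : continuous g) (sg1 : sg = 1 \/ sg = -1) (alt : alternates g 1 sg 0 s).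
Hypotheses (g0 : (g 0).2 = 0) (g1 : (g 1).2 = 0) (gs : forall x, x \in s -> (g x).2 = 0).
Hypothesis av : forall t : R, 0 < t < 1 -> g t <> g 0 /\ g t <> g 1.
Hypothesis selfx : forall l : seq (R * R), uniq l ->
  (forall z, z \in l -> [/\ 0 < z.1 < 1, 0 < z.2 < 1, g z.1 = g z.2 & z.1 < z.2]) -> (size l <= k)%N.
Notation p := (size s).
Notation pnt := 'I_p.+2.
Variables (b0 sd : bool).

Definition axis_abscissa (i : pnt) : R := (g (tau s i)).1.
Notation X := axis_abscissa.
Notation mate := (mate b0 sd).

Lemma tau_step i : (i <= p)%N -> tau s i < tau s i.+1.
Proof. by move=> h; have [] := alternates_nth alt h. Qed.

Lemma tau_mono i j : (i < j)%N -> (j <= p.+1)%N -> tau s i < tau s j.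
Proof.
elim: j => // j IH; rewrite ltnS leq_eqVlt => /orP[/eqP ->|ij] jp; first exact: tau_step.
by apply: lt_trans (tau_step _); [apply: IH => //; exact: ltnW|].
Qed.

Lemma tau_last : tau s p.+1 = 1.
Proof. by rewrite /tau /= nth_rcons ltnn eqxx. Qed.

Lemma tau_itv i : (i <= p.+1)%N -> 0 <= tau s i <= 1.
Proof.
move=> h; have -> : 0 = tau s 0 by [].
rewrite -tau_last; apply/andP; split.
  by case: i h => [|i] // h; apply/ltW/tau_mono.
by move: h; rewrite leq_eqVlt => /orP[/eqP ->//|h]; apply/ltW/tau_mono.
Qed.

Lemma tau_zero i : (i <= p.+1)%N -> (g (tau s i)).2 = 0.
Proof.
case: i => [|i] // h; have [lt|ge] := ltnP i p.
  by rewrite /tau /= nth_rcons lt; apply: gs; rewrite mem_nth.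
have -> : i = p by apply/eqP; rewrite eqn_leq ge -ltnS h.
by rewrite tau_last.
Qed.

Definition chord (i : pnt) : nat := minn i (mate i).

Lemma chordP i : mate i != i -> [/\ (chord i <= p)%N, side b0 (chord i) = sd &
  (i = chord i :> nat /\ mate i = (chord i).+1 :> nat) \/ (i = (chord i).+1 :> nat /\ mate i = chord i :> nat)].
Proof.
rewrite /chord /mate; case: ifP => [/andP[h1 /eqP h2]|h] ne.
  have v : (inord i.+1 : pnt) = i.+1 :> nat by rewrite inordK.
  by rewrite v (minn_idPl _) ?leqnSn//; split => //; left.
case: ifP ne h => [/andP[h1 /eqP h2]|]; last by rewrite eqxx.
move=> _ _; have lt : (i.-1 < p.+2)%N by apply: leq_ltn_trans (leq_pred _) _.
have v : (inord i.-1 : pnt) = i.-1 :> nat by rewrite inordK.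
rewrite v (minn_idPr _) ?leq_pred//; split => //; last by right; rewrite prednK.
by rewrite -ltnS prednK// -ltnS.
Qed.

Lemma chord_same i j : mate i != i -> mate j != j -> chord i = chord j -> j = i \/ j = mate i.
Proof.
move=> /chordP[_ _ hi] /chordP[_ _ hj] E; rewrite -E in hj.
case: hi hj => -[h1 h2] [] [h3 h4]; [left|right|right|left]; apply: val_inj; rewrite /= ?h1 ?h2 ?h3 //.
Qed.

Definition on_chord i (t : R) := tau s (chord i) <= t <= tau s (chord i).+1.

Lemma on_chord_itv i t : mate i != i -> on_chord i t -> 0 <= t <= 1.
Proof.
move=> /chordP[h _ _] /andP[h1 h2].
have /andP[a1 _] := tau_itv (leqW h); have /andP[_ a2] := tau_itv (h : ((chord i).+1 <= p.+1)%N).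
by rewrite (le_trans a1 h1) (le_trans h2 a2).
Qed.

(** Consecutive arcs lie on opposite sides, so distinct arcs on one side share no parameter, not
    even an end. *)
Lemma on_chord_disjoint i j t : mate i != i -> mate j != j -> on_chord i t -> on_chord j t -> chord i = chord j.
Proof.
move=> /chordP[hi si _] /chordP[hj sj _].
have key a b : (a <= p)%N -> (b <= p)%N -> side b0 a = sd -> side b0 b = sd -> (a < b)%N ->
    t <= tau s a.+1 -> tau s b <= t -> False.
  move=> ha hb sa sb ab h1 h2.
  have ab2 : (a.+1 < b)%N.
    rewrite ltn_neqAle ab andbT; apply/eqP => E.
    by move: sa sb; rewrite -E /side /= => <-; rewrite addbN; case: (b0 (+) odd a).
  have := tau_mono ab2 (leqW hb); lra.
rewrite /on_chord => /andP[a1 a2] /andP[b1 b2]; case: (ltngtP (chord i) (chord j)) => // lt; exfalso.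
  exact: (key _ _ hi hj si sj lt).
exact: (key _ _ hj hi sj si lt).
Qed.

Lemma plt_le i j : plt X i j -> X i <= X j.
Proof. by rewrite /plt => /orP[/ltW//|/andP[/eqP -> _]]. Qed.

Lemma plt_neq i j : plt X i j -> i != j.
Proof. by move=> h; apply/eqP => E; move: h; rewrite E plt_irr. Qed.

Lemma chord_range i (x y : R) : mate i != i ->
  ((X i = x /\ X (mate i) = y) \/ (X i = y /\ X (mate i) = x)) -> x <= y ->
  Num.min (g (tau s (chord i))).1 (g (tau s (chord i).+1)).1 = x /\
  Num.max (g (tau s (chord i))).1 (g (tau s (chord i).+1)).1 = y.
Proof.
move=> /chordP[_ _ H] hx xy; move: hx; rewrite /axis_abscissa.
by case: H => -[-> ->] [] [-> ->]; rewrite ?(min_l xy) ?(max_r xy) ?(min_r xy) ?(max_l xy).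
Qed.

Lemma crossing_chords_meet i j : plt X (mate i) j -> plt X j i -> plt X i (mate j) ->
  exists y : R * R, [/\ y.1 < y.2, 0 <= y.1, y.2 <= 1, g y.1 = g y.2 &
    (on_chord i y.1 /\ on_chord j y.2) \/ (on_chord j y.1 /\ on_chord i y.2)].
Proof.
move=> h1 h2 h3; have mi : mate i != i by apply: plt_neq; exact: plt_trans h1 h2.
have mj : mate j != j by rewrite eq_sym; apply: plt_neq; exact: plt_trans h2 h3.
have l1 := plt_le h1; have l2 := plt_le h2; have l3 := plt_le h3.
have [ci si _] := chordP mi; have [cj sj _] := chordP mj.
have [mni mxi] := @chord_range i _ _ mi (or_intror (conj erefl erefl)) (le_trans l1 l2).
have [mnj mxj] := @chord_range j _ _ mj (or_introl (conj erefl erefl)) (le_trans l2 l3).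
have par : odd (chord i) = odd (chord j).
  by move: si sj; rewrite /side => <-; case: b0 => /=; case: (odd _); case: (odd _).
have Esg : sg * (-1) ^+ chord i = sg * (-1) ^+ chord j by rewrite -signr_odd par signr_odd.
have [|||||||||||y1 [y2 [hy1 hy2 Ey]]] := @chords_meet R g (sg * (-1) ^+ chord i) (tau s (chord i)) (tau s (chord i).+1)
  (tau s (chord j)) (tau s (chord j).+1) cg.
- exact/ltW/tau_step.
- exact/ltW/tau_step.
- move=> t [ht|ht]; first by have [_] := alternates_nth alt ci; exact.
  by rewrite Esg; have [_] := alternates_nth alt cj; exact.
- by apply: tau_zero; exact: leqW.
- exact: tau_zero.
- by apply: tau_zero; exact: leqW.
- exact: tau_zero.
- by rewrite mni mnj.
- by rewrite mnj mxi.
- by rewrite mxi mxj.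
- by rewrite mulf_neq0 ?signr_eq0//; case: sg1 => ->; rewrite ?oppr_eq0 oner_neq0.
have i1 := on_chord_itv mi hy1; have i2 := on_chord_itv mj hy2.
have [lt|gt|E] := ltgtP y1 y2.
- by exists (y1, y2); split => //=; [lra|lra|left].
- by exists (y2, y1); split => //=; [lra|lra|right].
exfalso; rewrite -E in hy2; have := on_chord_disjoint mi mj hy1 hy2.
case/(chord_same mi mj) => Ej; first by move: h2; rewrite Ej plt_irr.
by move: h1; rewrite Ej plt_irr.
Qed.

(* The only coincidence of parameters in [0, 1] that is not a self-intersection
   is the one of the two ends of a loop; hence the successor. *)
Lemma sum_depth : (\sum_i depth X b0 sd i <= k.+1)%N.
Proof.
pose cond (z : pnt * pnt) := [&& plt X (mate z.1) z.1, plt X (mate z.1) z.2, plt X z.2 z.1 & plt X z.1 (mate z.2)].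
pose D := [set z | cond z]%SET.
have -> : (\sum_i depth X b0 sd i = #|D|)%N.
  transitivity (\sum_i \sum_j (if cond (i, j) then 1 else 0))%N.
    apply: eq_bigr => i _; rewrite /depth /cond /=; case: ifP => h; last by rewrite big1.
    by rewrite -sum1_card big_mkcond /=; apply: eq_bigr => j _; rewrite inE.
  rewrite pair_bigA -sum1_card [RHS]big_mkcond /=; apply: eq_bigr => -[i j] _.
  by rewrite inE.
pose Q (z : pnt * pnt) (y : R * R) := [/\ y.1 < y.2, 0 <= y.1, y.2 <= 1, g y.1 = g y.2 &
    (on_chord z.1 y.1 /\ on_chord z.2 y.2) \/ (on_chord z.2 y.1 /\ on_chord z.1 y.2)].
have /choice[F HF] : forall z, exists y, z \in D -> Q z y.
  move=> z; case: (boolP (z \in D)) => [|_]; last by exists (0, 0).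
  rewrite inE => /and4P[h0 h1 h2 h3]; have [y hy] := crossing_chords_meet h1 h2 h3.
  by exists y.
have DP z : z \in D -> [/\ mate z.1 != z.1, mate z.2 != z.2, plt X (mate z.1) z.1, plt X z.2 (mate z.2) & plt X z.1 (mate z.2)].
  rewrite inE => /and4P[h0 h1 h2 h3]; have h4 : plt X z.2 (mate z.2) := plt_trans h2 h3.
  by split => //; [exact: plt_neq|rewrite eq_sym; exact: plt_neq].
have asym i j : plt X i j -> plt X j i -> False.
  by move=> h h'; have := plt_trans h h'; rewrite plt_irr.
(* The two parameters determine the two arcs, and the order of the four ends on the axis tells the
   roles of the arcs apart. *)
have Finj : {in enum D &, injective F}.
  move=> z z'; rewrite !mem_enum => zD z'D EF.
  have [_ _ _ _ H] := HF z zD; have [_ _ _ _ H'] := HF z' z'D; rewrite -EF in H'.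
  have [m1 m2 c1 c2 x] := DP z zD; have [m1' m2' c1' c2' x'] := DP z' z'D.
  have [[E1 E2]|[E1 E2]] : (chord z.1 = chord z'.1 /\ chord z.2 = chord z'.2) \/
      (chord z.1 = chord z'.2 /\ chord z.2 = chord z'.1).
    by case: H H' => -[a1 a2] [] [b1 b2]; [left|right|right|left]; split;
      (apply: on_chord_disjoint; [..|eassumption|eassumption]).
  - have e1 : z'.1 = z.1.
      case: (chord_same m1 m1' E1) => // e; move: c1'; rewrite e mateK => h; case: (asym _ _ h c1).
    have e2 : z'.2 = z.2.
      case: (chord_same m2 m2' E2) => // e; move: c2'; rewrite e mateK => h; case: (asym _ _ h c2).
    by case: z z' e1 e2 {zD z'D EF H H' m1 m2 c1 c2 x m1' m2' c1' c2' x' E1 E2} => ? ? [? ?] /= -> ->.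
  - have e1 : z'.2 = mate z.1.
      case: (chord_same m1 m2' E1) => // e; move: c2'; rewrite e => h; case: (asym _ _ h c1).
    have e2 : z'.1 = mate z.2.
      case: (chord_same m2 m1' E2) => // e; move: c1'; rewrite e => h; case: (asym _ _ h c2).
    by move: x'; rewrite e1 e2 mateK => /asym/(_ x).
rewrite cardE -(size_map F); set l := map F _.
have ul : uniq l by rewrite map_inj_in_uniq ?enum_uniq.
have Hl y : y \in l -> [/\ y.1 < y.2, 0 <= y.1, y.2 <= 1 & g y.1 = g y.2].
  by move=> /mapP[z + ->]; rewrite mem_enum => /HF[].
rewrite -(count_predC (pred1 (0, 1)) l) -addn1 addnC; apply: leq_add; last first.
  by rewrite count_uniq_mem//; case: (_ \in _).
rewrite -size_filter; apply: selfx; first exact: filter_uniq.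
move=> y; rewrite mem_filter /= => /andP[ny /Hl[lt y0 y1 Ey]].
have y10 : y.1 != 0.
  apply/eqP => E; have [E2|n2] := eqVneq y.2 1; first by case/eqP: ny; case: y E E2 {lt y0 y1 Ey} => ? ? /= -> ->.
  have [] := @av y.2; first by rewrite -E lt lt_neqAle n2 y1.
  by rewrite -Ey E.
have y21 : y.2 != 1.
  apply/eqP => E; have [|_] := @av y.1; last by rewrite Ey E.
  by rewrite lt_neqAle eq_sym y10 y0 -E.
have a1 : 0 < y.1 by rewrite lt_neqAle eq_sym y10.
have a2 : y.2 < 1 by rewrite lt_neqAle y21.
by split => //; apply/andP; split => //; lra.
Qed.

End Depth.

(** * Counting the edges *)

Section Codes.
Variable R : realType.
Local Notation pt := (R * R)%type.
Implicit Types (g : R -> pt) (s : seq R) (sg : R).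

Definition signature g sg s : Prop :=
  [/\ sg = 1 \/ sg = -1, alternates g 1 sg 0 s & forall x, x \in s -> (g x).2 = 0].

Lemma alternates_uniq g b sg a s : alternates g b sg a s -> uniq s.
Proof.
elim: s sg a => //= x s IH sg a [_ _ _ alt']; rewrite (IH _ _ alt') andbT.
by apply/negP => /(proj2 (alternates_bounds alt')); rewrite ltxx.
Qed.

Lemma signature_exists g N : continuous g -> (g 0).2 = 0 -> (g 1).2 = 0 -> axis_times g N ->
  exists sg s, signature g sg s /\ (size s <= N)%N.
Proof.
move=> cg g0 g1 ax; have [l Hl] := bounded_listing ax.
pose Z := sort <=%R (undup [seq t <- l | (0 < t < 1) && ((g t).2 == 0)]).
have mZ t : (t \in Z) = ((0 < t < 1) && ((g t).2 == 0)) && (t \in l) by rewrite mem_sort mem_undup mem_filter.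
have pZ : path <%R 0 Z.
  rewrite (path_sortedE lt_trans) lt_sorted_uniq_le sort_uniq undup_uniq sort_le_sorted !andbT.
  by apply/allP => t; rewrite mZ => /andP[/andP[/andP[]]].
have [||sg [s [h1 h2 h3]]] := @alternates_exists R g Z 0 1 cg ltr01 g0 g1 pZ.
- by move=> t; rewrite mZ => /andP[/andP[/andP[_ ?] /eqP ?] _].
- by move=> t ht gt; rewrite mZ ht gt eqxx Hl.
exists sg, s; split => //; apply: ax; first exact: alternates_uniq h2.
by move=> t ts; split; [exact: (proj2 (alternates_bounds h2))|exact: h3].
Qed.

Section Code.
Variables (V : finType) (P : V -> pt).
Hypothesis P0 : forall w, (P w).2 = 0.

Definition gap (x : R) : nat := #|[set w | (P w).1 < x]%SET|.

Lemma gap_mono (x y : R) : x <= y -> (gap x <= gap y)%N.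
Proof.
move=> xy; apply: subset_leq_card; apply/fintype.subsetP => w; rewrite !inE => h.
exact: lt_le_trans h xy.
Qed.

(** The sets of vertices to the left of a point are nested, so their size determines them. *)
Lemma gap_eq (x y : R) : gap x = gap y -> forall w, ((P w).1 < x) = ((P w).1 < y).
Proof.
wlog xy : x y / x <= y.
  move=> H E w; case: (leP x y) => [|/ltW] h; first exact: H.
  by apply/esym; apply: H.
move=> E w; have : [set w | (P w).1 < x]%SET = [set w | (P w).1 < y]%SET.
  apply/eqP; rewrite eqEcard -/(gap x) -/(gap y) E leqnn andbT.
  by apply/fintype.subsetP => v; rewrite !inE => h; exact: lt_le_trans h xy.
by move=> /setP/(_ w); rewrite !inE.
Qed.

(** Thanks to this the gaps at the two end points already determine the end vertices, which need no
    letters of their own. *)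
Lemma gap_vertex v v' : gap (P v).1 = gap (P v').1 -> P v = P v'.
Proof.
move=> E; have := gap_eq E v; have := gap_eq E v'; rewrite !ltxx => h1 /esym h2.
have E1 : (P v).1 = (P v').1 by apply/eqP; rewrite eq_le !leNgt h1 h2.
by apply: pt_ext; rewrite // !P0.
Qed.

Definition curve_code g sg s : seq block :=
  blocks (fun i : 'I_(size s).+2 => (g (tau s i)).1) (sg == 1) (fun i => gap (g (tau s i)).1).

Lemma gap_plt g s (i j : 'I_(size s).+2) : plt (fun i : 'I_(size s).+2 => (g (tau s i)).1) i j ->
  (gap (g (tau s i)).1 <= gap (g (tau s j)).1)%N.
Proof. by move=> /orP[/ltW|/andP[/eqP -> _]]; exact: gap_mono. Qed.

(** The depths contribute at most k + 1 for each side; with the additive 4 of [size_blocks] this is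
    2k + 6. *)
Lemma size_curve_code g sg s k : continuous g -> signature g sg s -> (g 0).2 = 0 -> (g 1).2 = 0 ->
  (forall t : R, 0 < t < 1 -> g t <> g 0 /\ g t <> g 1) ->
  (forall l : seq (R * R), uniq l ->
    (forall z, z \in l -> [/\ 0 < z.1 < 1, 0 < z.2 < 1, g z.1 = g z.2 & z.1 < z.2]) -> (size l <= k)%N) ->
  (size (flatten (map enc (curve_code g sg s))) <= #|V| + 2 * k + size s + 6)%N.
Proof.
move=> cg [sg1 alt zs] g0 g1 av selfx.
apply: leq_trans (size_blocks _ (@gap_plt g s)) _.
have d b : (\sum_i depth (fun i : 'I_(size s).+2 => (g (tau s i)).1) (sg == 1%R) b i <= k.+1)%N.
  exact: (sum_depth cg sg1 alt g0 g1 zs av selfx).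
have h : (gap (g (tau s (ipos (fun i : 'I_(size s).+2 => (g (tau s i)).1) ord_max))).1 <= #|V|)%N by exact: max_card.
have := d true; have := d false; move: h.
move: (gap _) (\sum_i _)%N (\sum_i _)%N => a b c; lia.
Qed.

Lemma curve_code_mark g sg s b : b \in curve_code g sg s -> (b.1.2 <= 2)%N.
Proof. by move=> /mapP[r _ ->]; exact: mark_le2. Qed.

(** Stated for functions on natural numbers, because the index types of the two codes agree only
    once their lengths do. *)
Lemma blocks_inj (p p' : nat) (x x' : nat -> R) (b b' : bool) (q q' : nat -> nat) :
  (forall i j : 'I_p.+2, plt (fun i : 'I_p.+2 => x i) i j -> (q i <= q j)%N) ->
  (forall i j : 'I_p'.+2, plt (fun i : 'I_p'.+2 => x' i) i j -> (q' i <= q' j)%N) ->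
  blocks (fun i : 'I_p.+2 => x i) b (fun i : 'I_p.+2 => q i) =
  blocks (fun i : 'I_p'.+2 => x' i) b' (fun i : 'I_p'.+2 => q' i) ->
  [/\ p = p', b = b' & forall i, (i < p.+2)%N -> q i = q' i].
Proof.
move=> h h' E; have Ep : p = p'.
  have sb r (Y : 'I_r.+2 -> R) d t : size (blocks Y d t) = r.+2 by rewrite size_map size_enum_ord.
  by have := congr1 size E; rewrite !sb => -[].
subst p'; have [Eb Eq] := code_inj h h' E.
by split => // i hi; have := Eq (Ordinal hi).
Qed.

Lemma same_code A g g' sg sg' s s' v0 v1 v0' v1' :
  continuous g -> continuous g' -> signature g sg s -> signature g' sg' s' ->
  g 0 = P v0 -> g 1 = P v1 -> g' 0 = P v0' -> g' 1 = P v1' ->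
  (forall t w, 0 < t < 1 -> g t <> P w) -> (forall t w, 0 < t < 1 -> g' t <> P w) ->
  A (g 0) -> A (g 1) -> (forall z, (forall w, z <> P w) -> A z) ->
  curve_code g sg s = curve_code g' sg' s' -> [/\ g 0 = g' 0, g 1 = g' 1 & phom A g g'].
Proof.
move=> cg cg' [h1 h2 h3] [h1' h2' h3'] e0 e1 e0' e1' av av' A0 A1 AP E.
have [Ep Eb Eq] := @blocks_inj (size s) (size s') (fun i => (g (tau s i)).1) (fun i => (g' (tau s' i)).1)
  (sg == 1) (sg' == 1) (fun i => gap (g (tau s i)).1) (fun i => gap (g' (tau s' i)).1)
  (@gap_plt g s) (@gap_plt g' s') E.
have n1 : (-1 == 1 :> R) = false by apply/eqP => h; lra.
have Esg : sg = sg' by move: Eb; case: h1 => ->; case: h1' => ->; rewrite ?eqxx ?n1.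
subst sg'.
have E0 : g 0 = g' 0.
  by have := Eq 0%N isT; rewrite /tau /= e0 e0'; exact: gap_vertex.
have E1 : g 1 = g' 1.
  by have := Eq (size s).+1 (ltnSn _); rewrite tau_last Ep tau_last e1 e1'; exact: gap_vertex.
split => //; apply: (@same_signature R V P A g g' sg s s') => //.
move=> i w hi; have hi' : (i < size s')%N by rewrite -Ep.
have := Eq i.+1 (leqW hi); rewrite /tau /= !nth_rcons hi hi' => /gap_eq; exact.
Qed.

End Code.

Lemma phom_homeo (A B : set pt) g g' (hi : pt -> pt) c c' : continuous hi -> phom A g g' ->
  (forall t, hi (g t) = c t) -> (forall t, hi (g' t) = c' t) -> (forall z, A z -> B (hi z)) -> phom B c c'.
Proof.
move=> chi [H [cH H1 H2 H3]] e e' AB; exists (fun z => hi (H z)); split.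
- exact: cont_comp.
- by move=> t ht; have [-> ->] := H1 t ht; rewrite e e'.
- by move=> u hu; have [-> ->] := H2 u hu; rewrite !e.
- by move=> u t hu ht; apply: AB; exact: H3.
Qed.

End Codes.

(** * The bound for finitely many edges *)

Section EdgeBound.
Variable R : realType.
Local Notation pt := (R * R)%type.

Lemma padded_code_inj (L : nat) (bs bs' : seq block) :
  (size (flatten (map enc bs)) <= L)%N -> (size (flatten (map enc bs')) <= L)%N ->
  (forall b, b \in bs -> (b.1.2 <= 2)%N) -> (forall b, b \in bs' -> (b.1.2 <= 2)%N) ->
  [ffun i : 'I_L => nth (@sym 0 isT) (flatten (map enc bs)) i] =
  [ffun i : 'I_L => nth (@sym 0 isT) (flatten (map enc bs')) i] -> bs = bs'.
Proof.
set w := flatten _; set w' := flatten _ => sw sw' m m' E.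
rewrite -(dec_word (L - size w) m) -(dec_word (L - size w') m') -/w -/w'; congr (dec _ _ _ _ _).
have nthp (u : seq letter) i : (i < L)%N -> nth (@sym 0 isT) (u ++ nseq (L - size u) (@sym 0 isT)) i = nth (@sym 0 isT) u i.
  move=> iL; rewrite nth_cat nth_nseq; case: ltnP => // h; rewrite (nth_default _ h).
  by case: ifP.
apply: (@eq_from_nth _ (@sym 0 isT)); first by rewrite !size_cat !size_nseq !subnKC.
move=> i; rewrite size_cat size_nseq subnKC// => iL; rewrite !nthp//.
by have /ffunP/(_ (Ordinal iL)) := E; rewrite !ffunE.
Qed.

(** Outside [G] the padded word is injective: equal words give homotopic curves along the axis, the
    inverse homeomorphism carries the homotopy back, and linear homotopies connect each curve with
    its polygonal replacement. The code fixes both ends in order, so excluding homotopies between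
    edges directed alike is enough. *)
Lemma edge_bound (V E : finType) k (pts : V -> pt) c (src tgt : E -> V) : drawn k pts c src tgt ->
  (forall e f, e <> f -> src e = src f -> tgt e = tgt f ->
    ~ phom (fun z => forall w, w <> src e -> w <> tgt e -> z <> pts w) (c e) (c f)) ->
  (#|E| <= 9 ^ (8 * k * #|V| + 5 * #|V| + 2 * k + 6) + 2 * #|V|)%N.
Proof.
move=> dr nonh; have [pinj cc ce cav few] := dr.
(* [rho] is below the distance of each curve from every vertex that is not its end, so the linear
   homotopies avoid these vertices. *)
have [|ev|rho rho0 far] := @small_fin R (E * V)%type (fun ev d => ev.2 <> src ev.1 -> ev.2 <> tgt ev.1 ->
    forall t : R, 0 <= t <= 1 -> d < `|c ev.1 t - pts ev.2|).
- by move=> ev d d' hd h n1 n2 t ht; have := h n1 n2 t ht; lra.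
- case: ev => e v /=; have [[->|->]|] := pselect (v = src e \/ v = tgt e); try by exists 1.
  move=> nv; have [||d d0 hd] := @curve_sep R (c e) 0 1 [set pts v] (cc e).
  + exact: compact_set1.
  + move=> t ht /= Et; have [e0 e1] := ce e.
    have [t0|t0] := eqVneq t 0; first by apply: nv; left; apply: pinj; rewrite -Et t0.
    have [t1|t1] := eqVneq t 1; first by apply: nv; right; apply: pinj; rewrite -Et t1.
    apply: (cav e t v) Et; have /andP[a1 a2] := ht.
    by rewrite !lt_neqAle eq_sym t0 t1 a1 a2.
  by exists d => // _ _ t ht; exact: hd.
have [|c' [dr' pl' close]] := pl_drawing rho0 dr.
  by move=> e v t n1 n2 ht; exact: (far (e, v)).
have [h [G [ph cG hax Hax]]] := good_axis dr' pl'.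
have [ch [hi [chi hK hiK]] _] := ph.
have [pinj' cc' ce' cav' few'] := drawn_homeo ph dr'.
have [_ cc1 ce1 _ _] := dr'.
pose g e t := h (c' e t); pose P v := h (pts v).
have /choice[S HS] : forall e, exists S : R * seq R, e \notin G ->
    signature (g e) S.1 S.2 /\ (size S.2 <= (8 * k + 4) * #|V|)%N.
  move=> e; case: (boolP (e \in G)) => [_|eG]; first by exists (0, [::]).
  have [||||sg [s hs]] := @signature_exists R (g e) ((8 * k + 4) * #|V|).
  - exact: cc'.
  - by rewrite /g; have [-> _] := ce1 e; exact: hax.
  - by rewrite /g; have [_ ->] := ce1 e; exact: hax.
  - exact: Hax.
  by exists (sg, s).
pose L := (8 * k * #|V| + 5 * #|V| + 2 * k + 6)%N.
pose code e := curve_code P (g e) (S e).1 (S e).2.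
pose word e := flatten (map enc (code e)).
have sw e : e \notin G -> (size (word e) <= L)%N.
  move=> /HS[sgn ss]; apply: leq_trans (@size_curve_code R V P (g e) _ _ k _ sgn _ _ _ _) _.
  - exact: cc'.
  - by rewrite /g; have [-> _] := ce1 e; exact: hax.
  - by rewrite /g; have [_ ->] := ce1 e; exact: hax.
  - by move=> t ht; rewrite /g; have [-> ->] := ce' e; split; exact: cav'.
  - by move=> l ul hl; apply: (few' e e l ul) => z /hl[? ? ? ?]; split.
  by rewrite /L; move: ss; nia.
pose w e := [ffun i : 'I_L => nth (@sym 0 isT) (word e) i].
have winj : {in ~: G &, injective w}.
  move=> e f; rewrite !inE => eG fG Ew; apply: contrapT => ef.
  have Ec : code e = code f.
    apply: (@padded_code_inj L) Ew; [exact: sw|exact: sw|exact: curve_code_mark|exact: curve_code_mark].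
  have [sge _] := HS e eG; have [sgf _] := HS f fG.
  have [a0 a1] := ce' e; have [b0 b1] := ce' f.
  pose A (z : pt) := forall v, v <> src e -> v <> tgt e -> z <> P v.
  have [|||||E0 E1 H] := @same_code R V P hax A (g e) (g f) _ _ _ _ _ _ _ _ (cc' e) (cc' f) sge sgf
    a0 a1 b0 b1 _ _ _ _ _ Ec.
  - by move=> t v; exact: cav'.
  - by move=> t v; exact: cav'.
  - by rewrite /g a0 => v n _ /pinj' En; apply: n.
  - by rewrite /g a1 => v _ n /pinj' En; apply: n.
  - by move=> z hz v _ _; exact: hz.
  have Es : src e = src f by apply: pinj'; rewrite -a0 -b0.
  have Et : tgt e = tgt f by apply: pinj'; rewrite -a1 -b1.
  pose B (z : pt) := forall v, v <> src e -> v <> tgt e -> z <> pts v.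
  have H' : phom B (c' e) (c' f).
    apply: (phom_homeo chi H) => [t|t|z Az v n1 n2 Ez]; rewrite ?/g ?hK//.
    by apply: (Az v n1 n2); rewrite /P -Ez hiK.
  have lin x : src x = src e -> tgt x = tgt e -> phom B (c x) (c' x).
    move=> xs xt; have [x0 x1] := ce x; have [x0' x1'] := ce1 x.
    apply: phom_linear; rewrite ?x0 ?x1//.
    move=> u t hu ht v n1 n2 Ez.
    have := far (x, v); rewrite /= xs xt => /(_ n1 n2 t ht).
    have -> : c x t - pts v = - (u *: (c' x t - c x t)) by rewrite -Ez opprD addNKr.
    rewrite normrN normrZ; have := close x t ht; have := normr_ge0 (c' x t - c x t).
    rewrite ger0_norm; [nra|lra].
  apply: (nonh e f) => //; apply: phom_trans (lin e erefl erefl) _.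
  apply: phom_trans H' _; apply: phom_sym; exact: lin.
rewrite -(cardsC G) addnC; apply: leq_add; last exact: cG.
rewrite -(card_in_imset winj); apply: leq_trans (max_card _) _.
by rewrite card_ffun card_sum card_prod card_bool !card_ord.
Qed.

(** As 9^4 = 6561 < 7776 = 6^5, it suffices that [5 * q], with [q] a quarter of L rounded up, stays
    below the exponent. The spare factor 6 absorbs the summand 2n. *)
Lemma edge_bound_numeric (n k : nat) : (1 < n)%N -> (0 < k)%N ->
  (9 ^ (8 * k * n + 5 * n + 2 * k + 6) + 2 * n <= 6 ^ (13 * n * (k + 1)))%N.
Proof.
move=> n2 k1; set L := (8 * k * n + 5 * n + 2 * k + 6)%N; set M := (13 * n * (k + 1))%N.
pose q := ((L + 3) %/ 4)%N.
have q1 : (L <= 4 * q)%N by rewrite /q; lia.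
have q2 : (4 * q <= L + 3)%N by rewrite /q; lia.
have h : (5 * q <= M.-1)%N by rewrite /M /L in q2 *; nia.
have M0 : (0 < M)%N by rewrite /M; lia.
have a1 : (9 ^ L <= 6 ^ M.-1)%N.
  apply: (@leq_trans (9 ^ (4 * q))); first by rewrite leq_exp2l.
  apply: (@leq_trans (6 ^ (5 * q))); last by rewrite leq_exp2l.
  by rewrite !expnM; by case: (posnP q) => [->//|q0]; rewrite leq_exp2r.
have a2 : (2 * n <= 6 ^ M.-1)%N.
  apply: (@leq_trans M.-1); first by rewrite /M; nia.
  by apply: ltnW; apply: ltn_expl.
apply: leq_trans (leq_add a1 a2) _; rewrite -{3}(prednK M0) expnS; lia.
Qed.

End EdgeBound.

(** * From the given drawing to one with finitely many edges *)

Section Transfer.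
Variable R : realType.
Local Notation pt := (R * R)%type.

Lemma clamp_curve_cont (f : R -> pt) : {within `[0, 1], continuous f} -> continuous (fun t => f (clamp t)).
Proof.
move=> cf t; have cA : `[(0 : R), 1]%classic (clamp t) by rewrite /= in_itv /= clamp_itv.
have H := (subspace_continuousP _ f).1 cf (clamp t) cA.
apply: (cvg_comp (@clamp R) f _ H).
move=> B wB; have K := @clamp_cont R t _ wB; apply: (@filterS _ (nbhs t) _ _ _ _ K) => x /= h; apply: h.
by rewrite in_itv /= clamp_itv.
Qed.

(** The edge set may be infinite; in either case a violated bound yields M + 1 distinct edges, and
    only these are drawn. *)
Lemma injection_of_card (T : Type) (M : nat) : ~ ([set: T] #<= `I_M) ->
  exists f : 'I_M.+1 -> T, injective f.
Proof.
move=> nle; have /card_leP[f] : `I_M.+1 #<= [set: T].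
  have [/finite_setP[n En]|inf] := pselect (finite_set [set: T]).
    have lt : (M < n)%N.
      rewrite ltnNge; apply/negP => le; apply: nle; apply: card_le_trans (_ : `I_n #<= `I_M).
        by move: En; rewrite card_eq_le => /andP[].
      by rewrite card_le_II.
    apply: card_le_trans (_ : `I_n #<= [set: T]); first by rewrite card_le_II.
    by move: En; rewrite card_eq_le => /andP[].
  by move/infiniteP: inf; apply: card_le_trans; exact: subset_card_le.
have m (i : 'I_M.+1) : nat_of_ord i \in (`I_M.+1 : set nat) by rewrite inE /=.
exists (fun i => val (f (SigSub (m i)))) => i j /val_inj E.
have /(congr1 val)/= := 'inj_f (mem_set I) (mem_set I) E; exact: val_inj.
Qed.

Lemma size_le_card (T : eqType) (U : Type) (l : seq T) (F : T -> U) (A : set U) (k : nat) : uniq l ->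
  {in l &, injective F} -> (forall z, z \in l -> A (F z)) -> A #<= `I_k -> (size l <= k)%N.
Proof.
case: l => // z0 l ul Fi FA Ak; rewrite -card_le_II.
apply: card_le_trans Ak; pose f i := F (nth z0 (z0 :: l) i).
have mem i : (i \in (`I_(size (z0 :: l)) : set nat)) -> (i < size (z0 :: l))%N by rewrite inE.
have fi : {in (`I_(size (z0 :: l)) : set nat) &, injective f}.
  move=> i j /mem hi /mem hj /Fi E; apply/eqP; rewrite -(nth_uniq z0 hi hj ul); apply/eqP.
  by apply: E; rewrite mem_nth.
apply: (@card_le_trans _ _ _ (f @` `I_(size (z0 :: l)))).
  by have := inj_card_eq fi; rewrite card_eq_le => /andP[].
by apply: subset_card_le => _ [i /= hi <-]; apply: FA; rewrite mem_nth.
Qed.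

Lemma phom_path_homotopic (A : set pt) (c d c' d' : R -> pt) : phom A c d ->
  (forall t : R, 0 <= t <= 1 -> c t = c' t) -> (forall t : R, 0 <= t <= 1 -> d t = d' t) ->
  path_homotopic A c' d'.
Proof.
move=> [H [cH h1 h2 h3]] ec ed; exists H; split.
- exact: continuous_subspaceT.
- by move=> t; rewrite in_itv /= => ht; rewrite -ec// -ed//; exact: h1.
- by move=> u; rewrite in_itv /= => hu; rewrite -!ec ?lexx ?ler01//; exact: h2.
- by move=> u t; rewrite !in_itv /= => hu ht; exact: h3.
Qed.

(** Crossings are two-element sets of labelled parameters. For [e = f] the order of the two
    parameters makes the passage from pairs to sets injective. *)
Lemma k_crossing_few (G : multigraph) (k : nat) (phi : drawing R G) (E : finType) (i : E -> edge G) :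
  injective i -> k_crossing k phi -> few_crossings k (fun e t => curve phi (i e) (clamp t)).
Proof.
move=> ii [kx ks] e f l ul Hl.
have cb : crossings_between (curve phi) (i e) (i f) #<= `I_k.
  have [->|ef] := pselect (e = f); first exact: ks.
  by apply: kx => /ii.
pose F (z : R * R) : set (edge G * R) := [set (i e, z.1); (i f, z.2)].
apply: (size_le_card ul (F := F)) cb; last first.
  move=> z /Hl[h1 h2 h3 h4]; exists z.1, z.2; split => //.
  - by move=> [/ii/h4 lt E2]; rewrite E2 ltxx in lt.
  - by move: h3; rewrite !clamp_id//; lra.
move=> z z' zl z'l EF; have [_ _ _ lt] := Hl z zl; have [_ _ _ lt'] := Hl z' z'l.
have m1 : F z' (i e, z.1) by rewrite -EF; left.
have m2 : F z' (i f, z.2) by rewrite -EF; right.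
case: z z' lt lt' m1 m2 {zl z'l EF} => [z1 z2] [z1' z2'] /= lt lt'.
case=> [[E1]|[/ii ef E1]] [[/ii fe E2]|[E2]]; first [by rewrite E1 E2|exfalso].
- by have := lt (esym fe); have := lt' (esym fe); rewrite E1 E2; lra.
- by have := lt ef; have := lt' ef; rewrite E1 E2; lra.
- by have := lt ef; have := lt' ef; rewrite E1 E2; lra.
Qed.

End Transfer.

Theorem theorem1 (R : realType) (n k : nat) (G : multigraph)
    (n_gt0 : (0 < n)%N) (k_gt0 : (0 < k)%N)
    (cardV : #|vertex G| = n)
    (drawable : exists phi : drawing R G, non_homotopic phi /\ k_crossing k phi) :
  [set: edge G] #<= `I_(6 ^ (13 * n * (k + 1)))%N.
Proof.
have [M EM] : exists M, M = (6 ^ (13 * n * (k + 1)))%N by eexists.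
rewrite -EM; have [phi [nh kc]] := drawable.
apply: contrapT => /injection_of_card[i ii].
(* Each selected edge is directed by its own parametrisation. *)
have /choice[st Hst] : forall e : 'I_M.+1, exists vw : vertex G * vertex G,
    [/\ ends (i e) = [set vw.1; vw.2]%SET, curve phi (i e) 0 = vpoint phi vw.1 & curve phi (i e) 1 = vpoint phi vw.2].
  by move=> e; have [v [w h]] := curve_ends phi (i e); exists (v, w).
pose c (e : 'I_M.+1) (t : R) := curve phi (i e) (clamp t).
pose src e := (st e).1; pose tgt e := (st e).2.
have dr : drawn k (vpoint phi) c src tgt.
  split.
  - exact: vpoint_inj.
  - by move=> e; exact: (clamp_curve_cont (@curve_continuous _ _ phi (i e))).
  - by move=> e; rewrite /c clamp_id ?clamp_id ?lexx ?ler01//; have [_ -> ->] := Hst e.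
  - by move=> e t v ht; rewrite /c clamp_id; [apply: curve_avoids; rewrite in_itv|lra].
  - exact: k_crossing_few.
have nonh e f : e <> f -> src e = src f -> tgt e = tgt f ->
    ~ phom (fun z => forall w, w <> src e -> w <> tgt e -> z <> vpoint phi w) (c e) (c f).
  move=> ef Es Et H; apply: (nh (i e) (i f)) => [/ii//|].
  have [e1 e2 e3] := Hst e; have [f1 f2 f3] := Hst f.
  have Ee : ends (i e) = ends (i f) by rewrite e1 f1 -/(src e) -/(tgt e) Es Et.
  (* The sources agree, so [curve_from] does not reverse the second curve. *)
  split => //; have -> : curve_from (curve phi (i e) 0) (curve phi (i f)) = curve phi (i f).
    by rewrite /curve_from f2 e2 -/(src e) -/(src f) Es eqxx.
  have {}H : phom (~` (vpoint phi @` [set x | x \notin ends (i e)])) (c e) (c f).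
    have [K [cK k1 k2 k3]] := H; exists K; split => // u t hu ht [w /= wn Ew].
    move: wn; rewrite e1 !inE negb_or => /andP[/eqP n1 /eqP n2].
    exact: (k3 u t hu ht w n1 n2).
  by apply: (phom_path_homotopic H) => t ht; rewrite /c clamp_id.
have [n1|n2] := leqP n 1; last first.
  have := edge_bound dr nonh; rewrite card_ord cardV => h.
  by have := leq_trans h (edge_bound_numeric n2 k_gt0); rewrite -EM ltnn.
have one (v w : vertex G) : v = w.
  by apply: (fintype_le1P (T := vertex G) _ w v); rewrite cardV.
(* A power of 6 is positive, so at least two edges are at hand for the case of a single vertex. *)
have M1 : (1 < M.+1)%N by rewrite ltnS EM expn_gt0.
have [_ cc ce _ _] := dr.
apply: (nonh ord0 (Ordinal M1)) => //.
apply: phom_linear; rewrite ?(ce _).1 ?(ce _).2; try exact: cc; try by congr (vpoint phi _); exact: one.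
by move=> u t _ _ w nw; case: nw; exact: one.
Qed.
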